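(* Let $r$ be any real number, let $m>0$ with $m\in\frac12\mathbb{Z}$, and let $\omega$ be a multiplier system of weight $r$ and index $m$ on $\Gamma(1)^J$. Suppose that $\{\varphi_\gamma\mid\gamma\in\Gamma(1)^J\}$ is a parabolic cocycle of weight $r$ and index $m$ (with multiplier system $\omega$) in $\mathcal{P}_m$ such that $\varphi_{[S,(0,0)]}=\varphi_{[I,(0,1)]}=0$. Then there is a meromorphic function $f$ on $\mathcal{H}\times\mathbb{C}$ such that $$(f|_{\omega,r,m}\gamma)(\tau,z)-f(\tau,z)=\varphi_\gamma(\tau,z)\quad\text{for all }\gamma\in\Gamma(1)^J.$$
   Context: $\mathcal{H}$ is the upper half plane; $\tau\in\mathcal{H}$, $z\in\mathbb{C}$, $v=\mathrm{Im}(\tau)$, $y=\mathrm{Im}(z)$. $S=\left(\begin{smallmatrix}1&1\\0&1\end{smallmatrix}\right)$, $I$ is the $2\times2$ identity matrix. Jacobi group: $\Gamma(1)^J=\{[M,(\lambda,\mu)]: M\in SL_2(\mathbb{Z}),\ \lambda,\mu\in\mathbb{Z}\}$ with product $[M_1,(\lambda_1,\mu_1)][M_2,(\lambda_2,\mu_2)]=[M_1M_2,(\lambda_1,\mu_1)M_2+(\lambda_2,\mu_2)]$ (row vector times matrix). It acts on $\mathcal{H}\times\mathbb{C}$ by $\gamma(\tau,z)=\left(\frac{a\tau+b}{c\tau+d},\frac{z+\lambda\tau+\mu}{c\tau+d}\right)$ for $\gamma=[\left(\begin{smallmatrix}a&b\\c&d\end{smallmatrix}\right),(\lambda,\mu)]$.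 Automorphy factor: $j_{r,m}(\gamma,(\tau,z))=(c\tau+d)^{-r}\exp\left(2\pi i m\left(-\frac{c(z+\lambda\tau+\mu)^2}{c\tau+d}+\lambda^2\tau+2\lambda z+\lambda\mu\right)\right)$ (a fixed branch of the power is used). A multiplier system $\omega$ of weight $r$ and index $m$ is a function $\omega:\Gamma(1)^J\to\mathbb{C}^*$ with $\omega(\gamma_1\gamma_2)j_{r,m}(\gamma_1\gamma_2,(\tau,z))=\omega(\gamma_1)\omega(\gamma_2)j_{r,m}(\gamma_1,\gamma_2(\tau,z))j_{r,m}(\gamma_2,(\tau,z))$ for all $\gamma_1,\gamma_2$. Slash operator: $(f|_{\omega,r,m}\gamma)(\tau,z)=\omega(\gamma)j_{r,m}(\gamma,(\tau,z))f(\gamma(\tau,z))$. $\mathcal{P}_m$ is the space of functions $f$ holomorphic on $\mathcal{H}\times\mathbb{C}$ for which there are positive constants $K,\rho,\sigma$ with $|f(\tau,z)|<K(|\tau|^\rho+v^{-\sigma})e^{2\pi m y^2/v}$. A cocycle of weight $r$ and index $m$ is a family $\{\varphi_\gamma\mid\gamma\in\Gamma(1)^J\}$ in $\mathcal{P}_m$ with $\varphi_{\gamma_1\gamma_2}=\varphi_{\gamma_1}|_{\omega,r,m}\gamma_2+\varphi_{\gamma_2}$ for all $\gamma_1,\gamma_2$. A parabolic element is one of the form $[\left(\begin{smallmatrix}1&\ell\\0&1\end{smallmatrix}\right),(0,n)]$ with $\ell,n\in\mathbb{Z}$. A cocycle is parabolic if for each parabolic element $Q$ there is $\psi\in\mathcal{P}_m$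 with $\varphi_Q=\psi|_{\omega,r,m}Q-\psi$. *)

(* Defs.v *)
From HB Require Import structures.
From mathcomp Require Import all_boot all_order all_algebra.
From mathcomp Require Import complex.
From mathcomp Require Import all_classical all_reals all_analysis.

Set Implicit Arguments.
Unset Strict Implicit.
Unset Printing Implicit Defensive.

Import Order.TTheory GRing.Theory Num.Theory.
Import numFieldNormedType.Exports.

Local Open Scope classical_set_scope.
Local Open Scope ring_scope.
Local Open Scope complex_scope.

(* R[i] carries its topology and its structure of normed module over itself
   only under the alias R[i]^o; [differentiable] on [C2 R] is therefore
   differentiability over R[i]. *)
Notation C2 R := (R[i]^o * R[i]^o)%type.

Section ComplexFunctions.
Variable R : realType.
Implicit Types (z : R[i]) (s : R).

Definition expC z : R[i] :=
  (expR (complex.Re z))%:C * (cos (complex.Im z) +i* sin (complex.Im z)).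

Definition normC z : R := complex.Re `|z|.

(* Principal value: for z != 0, argC z lies in ]-pi, pi]. *)
Definition argC z : R :=
  let t := acos (complex.Re z / normC z) in
  if 0 <= complex.Im z then t else - t.

Definition logC z : R[i] := ln (normC z) +i* argC z.

Definition powC z s : R[i] := expC (s%:C * logC z).

End ComplexFunctions.

Section JacobiGroup.

Definition SL2Z := {M : 'M[int]_2 | \det M == 1}.

(* [M, (lambda, mu)] with (lambda, mu) a row vector. *)
Definition jacobi := (SL2Z * 'rV[int]_2)%type.

Lemma SL2Z_mul_subproof (M N : SL2Z) : \det (val M *m val N) == 1.
Proof. by rewrite det_mulmx (eqP (valP M)) (eqP (valP N)). Qed.

Definition SL2Z_mul (M N : SL2Z) : SL2Z :=
  exist _ (val M *m val N) (SL2Z_mul_subproof M N).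

Definition jacobi_mul (g1 g2 : jacobi) : jacobi :=
  (SL2Z_mul g1.1 g2.1, g1.2 *m val g2.1 + g2.2).

Definition row2 (x y : int) : 'rV[int]_2 := \row_j (if j == 0 then x else y).

Definition upper_mx (l : int) : 'M[int]_2 :=
  \matrix_(i, j) (if i == j then 1 else if i == 0 then l else 0).

Lemma det_upper_mx l : \det (upper_mx l) == 1.
Proof.
rewrite -det_tr det_trig; last first.
  apply/is_trig_mxP => i j; rewrite !mxE.
  by case: i j => [[|[|i]] hi] [[|[|j]] hj].
by rewrite big1 // => i _; rewrite !mxE eqxx.
Qed.

Definition SL2Z_upper (l : int) : SL2Z := exist _ (upper_mx l) (det_upper_mx l).

Lemma det_id2 : \det (1%:M : 'M[int]_2) == 1.
Proof. by rewrite det1. Qed.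

Definition SL2Z_I : SL2Z := exist _ 1%:M det_id2.
Definition SL2Z_S : SL2Z := SL2Z_upper 1.

Definition parabolic_elt (l n : int) : jacobi := (SL2Z_upper l, row2 0 n).

End JacobiGroup.

Section JacobiAction.
Variable R : realType.
Implicit Types (g : jacobi) (p : C2 R) (f : C2 R -> R[i]^o) (r m : R).

Definition HxC : set (C2 R) := [set p | 0 < complex.Im p.1].

Definition ja g : R[i] := (val g.1 0 0)%:~R.
Definition jb g : R[i] := (val g.1 0 1)%:~R.
Definition jc g : R[i] := (val g.1 1 0)%:~R.
Definition jd g : R[i] := (val g.1 1 1)%:~R.
Definition jlambda g : R[i] := (g.2 0 0)%:~R.
Definition jmu g : R[i] := (g.2 0 1)%:~R.

Definition jacobi_act g p : C2 R :=
  let: (tau, z) := p in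
  ((ja g * tau + jb g) / (jc g * tau + jd g),
   (z + jlambda g * tau + jmu g) / (jc g * tau + jd g)).

Definition automorphy r m g p : R[i] :=
  let: (tau, z) := p in
  let den := jc g * tau + jd g in
  powC den (- r) *
  expC (2 * pi%:C * 'i * m%:C *
        (- (jc g * (z + jlambda g * tau + jmu g) ^+ 2 / den)
         + jlambda g ^+ 2 * tau + 2 * jlambda g * z + jlambda g * jmu g)).

Definition multiplier_system r m (omega : jacobi -> R[i]) : Prop :=
  (forall g, omega g != 0) /\
  (forall g1 g2 p, HxC p ->
     omega (jacobi_mul g1 g2) * automorphy r m (jacobi_mul g1 g2) p =
     omega g1 * omega g2 *
     automorphy r m g1 (jacobi_act g2 p) * automorphy r m g2 p).

Definition slash (omega : jacobi -> R[i]) r m f g : C2 R -> R[i]^o :=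
  fun p => omega g * automorphy r m g p * f (jacobi_act g p).

Definition holomorphic_on (U : set (C2 R)) f : Prop :=
  forall p, U p -> differentiable f p.

Definition holomorphic_at f p : Prop := \forall q \near p, differentiable f q.

(* A meromorphic function is represented by a total function that is locally
   a quotient of holomorphic functions on connected open sets, the
   denominator not vanishing identically. Its values where the denominator
   vanishes are arbitrary; the points at which f is [holomorphic_at] form a
   dense open subset of D. *)
Definition meromorphic_on (D : set (C2 R)) f : Prop :=
  forall p, D p -> exists U : set (C2 R),
    [/\ open U, U p, connected U, U `<=` D &
      exists g h : C2 R -> R[i]^o,
        [/\ holomorphic_on U g, holomorphic_on U h,
            (exists2 q, U q & h q != 0) &
            forall q, U q -> h q != 0 -> f q = g q / h q]].

Definition Pspace m f : Prop :=
  holomorphic_on HxC f /\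
  exists K rho sigma : R, [/\ 0 < K, 0 < rho, 0 < sigma &
    forall tau z : R[i], HxC (tau, z) ->
      normC (f (tau, z)) <
        K * (normC tau `^ rho + complex.Im tau `^ (- sigma)) *
        expR (2 * pi * m * complex.Im z ^+ 2 / complex.Im tau)].

Definition cocycle (omega : jacobi -> R[i]) r m
    (phi : jacobi -> C2 R -> R[i]^o) : Prop :=
  (forall g, Pspace m (phi g)) /\
  (forall g1 g2 p, HxC p ->
     phi (jacobi_mul g1 g2) p = slash omega r m (phi g1) g2 p + phi g2 p).

Definition parabolic_cocycle (omega : jacobi -> R[i]) r m
    (phi : jacobi -> C2 R -> R[i]^o) : Prop :=
  cocycle omega r m phi /\
  (forall l n : int, exists psi, Pspace m psi /\
     forall p, HxC p ->
       phi (parabolic_elt l n) p =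
       slash omega r m psi (parabolic_elt l n) p - psi p).

End JacobiAction.

Arguments HxC {R}.
Arguments ja {R} g.
Arguments jb {R} g.
Arguments jc {R} g.
Arguments jd {R} g.
Arguments jlambda {R} g.
Arguments jmu {R} g.

(* Main.v *)
Require Import Defs.
From mathcomp Require Import all_boot all_order all_algebra.
From mathcomp Require Import complex.
From mathcomp Require Import all_classical all_reals all_analysis.
From mathcomp Require Import ring lra zify.
Import Order.TTheory GRing.Theory Num.Theory.
Import numFieldNormedType.Exports.
Local Open Scope classical_set_scope.
Local Open Scope ring_scope.
Local Open Scope complex_scope.

(* Following Eichler and Knopp, f is a quotient of two generalized Poincare
   series. Let <S> be the group generated by [S,(0,0)] and put
     E = sum ker_gamma,   H = sum phi_gamma * ker_gamma
   over gamma = [M,(lambda,mu)] in <S>\Gamma(1)^J, where (c,d) is the bottom row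
   of M and ker_gamma(tau,z) = (c tau + d)^-K (z + lambda tau + mu)^-L. The
   cocycle vanishes on <S>, so phi_gamma depends on the coset only. Since
   ker_gamma(g p) is, up to a factor depending on g and p only, ker_(gamma g)(p),
   reindexing by right translation by g shows that f = -H/E satisfies
   f|g - f = phi_g.

   Convergence: |omega| = 1, because every homomorphism from the Jacobi group to
   the positive reals is trivial; hence |phi_gamma| v^(r/2) exp(-2 pi m y^2/v) is
   subadditive along products, and the Euclidean algorithm bounds it by a
   polynomial in c, d, lambda, mu. The decay of the kernel in (lambda,mu) is paid
   for by poles along z + lambda tau + mu = 0, which are cleared by finite
   products on bounded regions.

   Holomorphy of the sums needs Weierstrass' theorem for functions that are only
   assumed complex differentiable. It follows from the Cauchy estimate for f'
   alone: applied to x |-> f(x + k) - f(x) this estimate makes f' Lipschitz,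
   which gives a quadratic bound on the first order Taylor remainder, linear in
   sup |f|, and such bounds can be summed. The Cauchy estimate is derived from
   Goursat's lemma on a rectangle in logarithmic coordinates. *)

(** A kernel in (c,d) alone would not do: the cosets with a given (c,d) are indexed by all
    (lambda,mu) in Z^2, and (c tau + d)^-K does not decay in these. The cocycle grows with degree at
    most [N] in (c,d) and 1 in (lambda,mu); the exponents K = N + 4 and L = 1 + 4 leave order -4 in
    each pair, which is summable over Z^4.

    The rows (c,d) and (-c,-d) give different cosets, and their kernels with the same (lambda,mu)
    differ by the sign (-1)^K. For odd K they cancel in pairs and E = 0, so [N] is kept even. Even
    then the functional equation does not prevent E from vanishing identically; this is excluded at
    an explicit point high in the half plane, where two cosets dominate all the others.

    A last obstacle is that f is a total function: it has values on the zeros of E and on the polar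
    set, where the quotient has no meaning. These values are chosen so that f is nowhere
    differentiable there; holomorphy at p then implies that p is a point where the series argument
    applies. *)

Local Notation Re := complex.Re.
Local Notation Im := complex.Im.

(** * Complex norm and differentiability *)

Section ComplexNorm.
Context {R : realType}.
Implicit Types (z w : R[i]) (x y : R).

Lemma normCE z : normC z = Num.sqrt (Re z ^+ 2 + Im z ^+ 2).
Proof. by rewrite /normC normc_def. Qed.

Lemma normr_normC z : `|z| = (normC z)%:C.
Proof. by rewrite /normC normc_def. Qed.

Lemma normC_ge0 z : 0 <= normC z.
Proof. by rewrite normCE sqrtr_ge0. Qed.

Lemma normC0 : normC (0 : R[i]) = 0.
Proof. by rewrite /normC normr0. Qed.

Lemma normC1 : normC (1 : R[i]) = 1.
Proof. by rewrite /normC normr1. Qed.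

Lemma normC_eq0 z : (normC z == 0) = (z == 0).
Proof.
rewrite -(normr_eq0 z) normr_normC; apply/eqP/eqP => [->//|h].
by apply: complexI; rewrite h.
Qed.

Lemma normC_gt0 z : (0 < normC z) = (z != 0).
Proof. by rewrite lt0r normC_ge0 andbT normC_eq0. Qed.

Lemma normCM z w : normC (z * w) = normC z * normC w.
Proof. by apply: complexI; rewrite rmorphM /= -!normr_normC normrM. Qed.

Lemma normCX z n : normC (z ^+ n) = normC z ^+ n.
Proof. by elim: n => [|n ih]; rewrite ?expr0 ?normC1 // !exprS normCM ih. Qed.

Lemma normCV z : normC z^-1 = (normC z)^-1.
Proof. by apply: complexI; rewrite fmorphV /= -!normr_normC normfV. Qed.

Lemma normCN z : normC (- z) = normC z.
Proof. by rewrite /normC normrN. Qed.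

Lemma normCD z w : normC (z + w) <= normC z + normC w.
Proof. by rewrite -lecR rmorphD /= -!normr_normC ler_normD. Qed.

Lemma normCB z w : normC (z - w) <= normC z + normC w.
Proof. by rewrite -(normCN w) normCD. Qed.

Lemma normC_triB z w : normC z - normC w <= normC (z + w).
Proof. by rewrite lerBlDr -{1}(addrK w z) normCB. Qed.

Lemma normC_real x : normC x%:C = `|x|.
Proof. by rewrite normCE /= expr0n addr0 sqrtr_sqr. Qed.

Lemma normCi : normC ('i : R[i]) = 1.
Proof. by rewrite normCE /= expr0n expr1n add0r sqrtr1. Qed.

Lemma normC_sqr z : normC z ^+ 2 = Re z ^+ 2 + Im z ^+ 2.
Proof. by rewrite normCE sqr_sqrtr // addr_ge0 // sqr_ge0. Qed.

Lemma normC_Re z : `|Re z| <= normC z.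
Proof. by rewrite normCE -sqrtr_sqr ler_wsqrtr // lerDl sqr_ge0. Qed.

Lemma normC_Im z : `|Im z| <= normC z.
Proof. by rewrite normCE -sqrtr_sqr ler_wsqrtr // lerDr sqr_ge0. Qed.

Lemma normC_le z : normC z <= `|Re z| + `|Im z|.
Proof.
have -> : z = (Re z)%:C + 'i * (Im z)%:C by rewrite -complexE.
apply: le_trans (normCD _ _) _.
by rewrite normCM normCi mul1r !normC_real /= !(mul0r, mul1r, subr0, addr0, add0r, mulr0).
Qed.

Lemma ReD z w : Re (z + w) = Re z + Re w. Proof. by case: z w => [a b] [c d]. Qed.
Lemma ImD z w : Im (z + w) = Im z + Im w. Proof. by case: z w => [a b] [c d]. Qed.
Lemma ReN z : Re (- z) = - Re z. Proof. by case: z. Qed.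
Lemma ImN z : Im (- z) = - Im z. Proof. by case: z. Qed.
Lemma ReM z w : Re (z * w) = Re z * Re w - Im z * Im w.
Proof. by case: z w => [a b] [c d]. Qed.
Lemma ImM z w : Im (z * w) = Re z * Im w + Im z * Re w.
Proof. by case: z w => [a b] [c d]. Qed.

Lemma normC_sum (I : Type) (s : seq I) (F : I -> R[i]) :
  normC (\sum_(i <- s) F i) <= \sum_(i <- s) normC (F i).
Proof.
elim: s => [|i s ih]; first by rewrite !big_nil normC0.
by rewrite !big_cons (le_trans (normCD _ _)) // lerD2l.
Qed.

End ComplexNorm.

Section DiffEps.
Context {R : realType}.

Lemma gt0CE (e : R[i]) : 0 < e -> e = (Re e)%:C /\ 0 < Re e.
Proof. by case: e => a b; rewrite ltcE /= => /andP[/eqP -> ?]. Qed.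

Definition cderiv (f : R[i] -> R[i]) (z l : R[i]) : Prop :=
  forall e : R, 0 < e -> exists2 d : R, 0 < d &
    forall h, normC h < d -> normC (f (z + h) - f z - l * h) <= e * normC h.

Lemma differentiable_eps (V : normedModType R[i]) (f : V -> R[i]^o) x :
  differentiable f x ->
  forall e : R, 0 < e -> exists2 d : R, 0 < d &
    forall h, `|h| < d%:C -> `|f (x + h) - f x - 'd f x h| <= e%:C * `|h|.
Proof.
move=> /diff_locallyP[_ /eqaddoP df] e e0.
have e0' : 0 < e%:C by rewrite ltcR.
have /nbhs_normP[d /gt0CE[-> d0] dP] := df _ e0'.
exists (Re d) => // h hd.
have := dP h; rewrite /= sub0r normrN => /(_ hd).
suff -> : f (x + h) - f x - 'd f x h =
  (f \o shift x - (cst (f x) + 'd f x)) h by [].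
by rewrite -addrA -opprD [x + h]addrC.
Qed.

(* Differentiability with zero differential; other cases reduce to it by
   subtracting a linear map. *)
Lemma differentiable_diff0 (V : normedModType R[i]) (f : V -> R[i]^o) x :
  (forall e : R, 0 < e -> exists2 d : R, 0 < d &
    forall h, `|h| < d%:C -> `|f (x + h) - f x| <= e%:C * `|h|) ->
  differentiable f x.
Proof.
move=> fP.
have c0 : continuous (\0 : {linear V -> R[i]^o}) by move=> y; exact: cvg_cst.
have f0 : f \o shift x = cst (f x) + (\0 : {linear V -> R[i]^o}) +o_ 0 id.
  apply/eqaddoP => e /gt0CE[-> e0]; have [d d0 dP] := fP _ e0.
  apply/nbhs_normP; exists d%:C; first by rewrite /= ltcR.
  move=> h /=; rewrite sub0r normrN => /dP; rewrite [x + h]addrC.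
  suff -> : f (h + x) - f x = (f \o shift x - (cst (f x) + \0)) h by [].
  by rewrite addr0.
apply/diff_locallyP; rewrite (diff_unique c0 f0); split; [exact: c0 | exact: f0].
Qed.

Lemma differentiable_cderiv (f : R[i]^o -> R[i]^o) z :
  differentiable f z -> exists l, cderiv f z l.
Proof.
move=> df; exists ('d f z 1) => e e0.
have [d d0 dP] := differentiable_eps _ _ _ df _ e0.
exists d => // h; rewrite -ltcR -normr_normC => /dP.
rewrite !normr_normC -rmorphM lecR.
suff -> : 'd f z h = 'd f z 1 * h by [].
have {1}-> : h = h *: (1 : R[i]^o) by rewrite /GRing.scale /= mulr1.
by rewrite linearZ /= mulrC.
Qed.

Lemma cderiv_differentiable (f : R[i]^o -> R[i]^o) (z : R[i]^o) (l : R[i]) :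
  cderiv f z l -> differentiable f z.
Proof.
move=> fl.
have -> : f = (f - l *: (id : R[i]^o -> R[i]^o)) + l *: (id : R[i]^o -> R[i]^o).
  by rewrite subrK.
apply: differentiableD; last exact: differentiableZ.
apply: differentiable_diff0 => e e0; have [d d0 dP] := fl _ e0.
exists d => // h; rewrite !normr_normC ltcR -rmorphM lecR => /dP.
congr (normC _ <= _); rewrite !fctE /= /GRing.scale /=; ring.
Qed.

Lemma cderivB f g z l1 l2 : cderiv f z l1 -> cderiv g z l2 ->
  cderiv (fun x => f x - g x) z (l1 - l2).
Proof.
move=> f1 f2 e e0; have e20 : 0 < e / 2 by rewrite divr_gt0.
have [d1 d10 P1] := f1 _ e20; have [d2 d20 P2] := f2 _ e20.
exists (Num.min d1 d2); first by rewrite lt_min d10.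
move=> h; rewrite lt_min => /andP[/P1 h1 /P2 h2].
have -> : f (z + h) - g (z + h) - (f z - g z) - (l1 - l2) * h =
  (f (z + h) - f z - l1 * h) - (g (z + h) - g z - l2 * h) by ring.
apply: le_trans (normCB _ _) _; lra.
Qed.

Lemma cderiv_linear l z : cderiv (fun x => l * x) z l.
Proof.
move=> e e0; exists 1 => // h _.
have -> : l * (z + h) - l * z - l * h = 0 by ring.
by rewrite normC0 mulr_ge0 ?normC_ge0 // ltW.
Qed.

Lemma cderiv_shift f k z l : cderiv f (z + k) l -> cderiv (fun x => f (x + k)) z l.
Proof.
by move=> fl e /fl[d d0 dP]; exists d => // h /dP; rewrite [z + k + h]addrAC.
Qed.

Lemma cderiv_cont f z l : cderiv f z l -> forall e : R, 0 < e ->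
  exists2 d : R, 0 < d & forall h, normC h < d -> normC (f (z + h) - f z) <= e.
Proof.
move=> fl e e0; have [d d0 dP] := fl 1 ltr01.
pose K := normC l + 1; have K0 : 0 < K by rewrite ltr_wpDl ?normC_ge0.
exists (Num.min d (e / K)); first by rewrite lt_min d0 divr_gt0.
move=> h; rewrite lt_min => /andP[/dP h1 h2].
have -> : f (z + h) - f z = (f (z + h) - f z - l * h) + l * h by ring.
apply: le_trans (normCD _ _) _; rewrite normCM.
have : K * normC h <= e by rewrite mulrC -ler_pdivlMr // ltW.
rewrite /K; lra.
Qed.

End DiffEps.

(** * Goursat's lemma and the Cauchy estimate *)

Section Integral.
Context {R : realType}.
Local Notation mu := (@lebesgue_measure R).
Implicit Types (f g : R -> R[i]) (a b c t : R).

Definition cont_on g a b : Prop := forall t, a <= t <= b ->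
  forall e : R, 0 < e -> exists2 d : R, 0 < d &
    forall h : R, `|h| < d -> normC (g (t + h) - g t) <= e.

Definition cint g a b : R[i] :=
  (\int[mu]_(t in `[a, b]) Re (g t)) +i* (\int[mu]_(t in `[a, b]) Im (g t)).

Lemma contracting_integrable (k : R[i] -> R) g a b :
  (forall z w, `|k z - k w| <= normC (z - w)) -> cont_on g a b ->
  mu.-integrable `[a, b] (EFin \o (fun t => k (g t))).
Proof.
move=> kP gc.
apply: (@continuous_compact_integrable R (k \o g)); first exact: segment_compact.
apply: continuous_in_subspaceT => t; rewrite inE /= in_itv /= => tab.
apply/cvgrPdist_le => e e0; have [d d0 dP] := gc _ tab _ e0.
apply/nbhs_normP; exists d => // s /=; rewrite -normrN opprB => st.
rewrite distrC; apply: le_trans (kP _ _) _.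
by have := dP (s - t) st; rewrite [t + _]addrC subrK.
Qed.

Lemma Re_contracting (z w : R[i]) : `|Re z - Re w| <= normC (z - w).
Proof. by rewrite -ReN -ReD normC_Re. Qed.

Lemma Im_contracting (z w : R[i]) : `|Im z - Im w| <= normC (z - w).
Proof. by rewrite -ImN -ImD normC_Im. Qed.

Lemma Re_integrable g a b : cont_on g a b ->
  mu.-integrable `[a, b] (EFin \o (fun t => Re (g t))).
Proof. exact: contracting_integrable Re_contracting. Qed.

Lemma Im_integrable g a b : cont_on g a b ->
  mu.-integrable `[a, b] (EFin \o (fun t => Im (g t))).
Proof. exact: contracting_integrable Im_contracting. Qed.

Lemma Rintegral_split (k : R -> R) a b c : a <= c -> c <= b ->
  mu.-integrable `[a, b] (EFin \o k) ->
  \int[mu]_(t in `[a, b]) k t =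
  \int[mu]_(t in `[a, c]) k t + \int[mu]_(t in `[c, b]) k t.
Proof.
move=> ac cb ik; rewrite -(@Rintegral_itv_obnd_cbnd _ c); last first.
  apply: integrableS ik => //; apply: subset_itvr; rewrite bnd_simp //.
by rewrite -(@Rintegral_itvB _ k (BLeft a) (BRight b) c) // addrC subrK.
Qed.

Lemma cint_split g a b c : a <= c -> c <= b -> cont_on g a b ->
  cint g a b = cint g a c + cint g c b.
Proof.
move=> ac cb gc; rewrite /cint.
by rewrite !(Rintegral_split _ _ _ _ ac cb) //; [exact: Im_integrable | exact: Re_integrable].
Qed.

Lemma cintB f g a b : cont_on f a b -> cont_on g a b ->
  cint (fun t => f t - g t) a b = cint f a b - cint g a b.
Proof.
move=> fc gc; rewrite /cint.
have -> : (fun t => Re (f t - g t)) = (fun t => Re (f t) - Re (g t)).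
  by apply/funext => t; rewrite ReD ReN.
have -> : (fun t => Im (f t - g t)) = (fun t => Im (f t) - Im (g t)).
  by apply/funext => t; rewrite ImD ImN.
by rewrite !RintegralB //; solve [exact: Im_integrable | exact: Re_integrable].
Qed.

Lemma Rintegral_near (k : R -> R) a b (l e : R) : a <= b ->
  mu.-integrable `[a, b] (EFin \o k) ->
  (forall t, a <= t <= b -> `|k t - l| <= e) ->
  `|\int[mu]_(t in `[a, b]) k t - l * (b - a)| <= e * (b - a).
Proof.
move=> ab ik kl.
have ms : fine (mu `[a, b]) = b - a.
  by rewrite lebesgue_measure_itv /= lte_fin; case: ltP => //= ba;
    apply/esym/eqP; rewrite subr_eq0 eq_le ab ba.
have ic (x : R) : mu.-integrable `[a, b] (EFin \o (fun=> x)).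
  apply: (@continuous_compact_integrable R (fun=> x)); first exact: segment_compact.
  by apply: continuous_subspaceT => t; exact: cvg_cst.
have := @Rintegral_cst _ _ R mu `[a, b]%classic (measurable_itv _); rewrite ms => cst.
rewrite -[X in _ - X](cst l) -RintegralB // ?measurable_itv //.
apply: le_trans (le_normr_Rintegral _ _) _ => //.
  exact: (integrableB _ ik (ic l)).
rewrite -(cst e); apply: le_Rintegral => //.
  have := integrable_norm (integrableB _ ik (ic l)); apply; exact: measurable_itv.

Qed.

(** Real and imaginary parts are estimated separately, whence the factor 2. It reappears in the
    constant 8 of the Cauchy estimate. *)
Lemma cint_near g a b (l : R[i]) (e : R) : a <= b -> cont_on g a b ->
  (forall t, a <= t <= b -> normC (g t - l) <= e) ->
  normC (cint g a b - l * (b - a)%:C) <= 2 * e * (b - a).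
Proof.
move=> ab gc gl; apply: le_trans (normC_le _) _.
have h1 := @Rintegral_near (fun t => Re (g t)) a b (Re l) e ab (Re_integrable _ _ _ gc).
have h2 := @Rintegral_near (fun t => Im (g t)) a b (Im l) e ab (Im_integrable _ _ _ gc).
have -> : 2 * e * (b - a) = e * (b - a) + e * (b - a) by ring.
rewrite ReD ReN ReM ImD ImN ImM /= !mulr0 subr0 add0r.
apply: lerD; [apply: h1 | apply: h2] => t /gl tl.
  exact: le_trans (Re_contracting _ _) tl.
exact: le_trans (Im_contracting _ _) tl.
Qed.

Lemma cint_norm g a b (e : R) : a <= b -> cont_on g a b ->
  (forall t, a <= t <= b -> normC (g t) <= e) ->
  normC (cint g a b) <= 2 * e * (b - a).
Proof.
move=> ab gc ge; rewrite -[cint _ _ _]subr0 -[X in _ - X](mul0r (b - a)%:C).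
by apply: cint_near => // t /ge; rewrite subr0.
Qed.

Lemma cont_on_sub g a b a' b' : a <= a' -> b' <= b -> cont_on g a b -> cont_on g a' b'.
Proof. by move=> aa bb gc t /andP[h1 h2]; apply: gc; rewrite (le_trans aa) // (le_trans h2). Qed.

Lemma cont_onB f g a b : cont_on f a b -> cont_on g a b -> cont_on (fun t => f t - g t) a b.
Proof.
move=> fc gc t tab e e0; have e20 : 0 < e / 2 by rewrite divr_gt0.
have [d1 d10 P1] := fc _ tab _ e20; have [d2 d20 P2] := gc _ tab _ e20.
exists (Num.min d1 d2); first by rewrite lt_min d10.
move=> h; rewrite lt_min => /andP[/P1 h1 /P2 h2].
have -> : f (t + h) - g (t + h) - (f t - g t) = (f (t + h) - f t) - (g (t + h) - g t) by ring.
apply: le_trans (normCB _ _) _; lra.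
Qed.
End Integral.

(** * Goursat's lemma by bisection of rectangles *)

Section Goursat.
Context {R : realType}.
Implicit Types (a b c d x y p q s t : R).

(** The intervals [x n, x n + p/2^n] are nested, so every left end lies below every right end, and
    the supremum of the left ends belongs to all of them. *)
Lemma nested_sup (x : nat -> R) (p : R) : 0 <= p ->
  (forall n, x n <= x n.+1) ->
  (forall n, x n.+1 + p / 2 ^+ n.+1 <= x n + p / 2 ^+ n) ->
  exists u, forall n, x n <= u <= x n + p / 2 ^+ n.
Proof.
move=> p0 xS wS.
have xm : {homo x : m n / (m <= n)%N >-> m <= n}.
  by apply: homo_leq xS => // ???; exact: le_trans.
have wm : {homo (fun n => x n + p / 2 ^+ n) : m n / (m <= n)%N >-> n <= m}.
  apply: homo_leq wS => // y z t h1 h2; exact: le_trans h2 h1.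
have w0 n : 0 <= p / 2 ^+ n by rewrite divr_ge0 // exprn_ge0.
have xw m n : x m <= x n + p / 2 ^+ n.
  have [mn|nm] := leqP m n; first by rewrite (le_trans (xm _ _ mn)) // lerDl.
  by apply: le_trans (wm _ _ (ltnW nm)); rewrite lerDl.
exists (sup (range x)) => n; apply/andP; split.
  by apply: ub_le_sup; [exists (x 0%N + p / 2 ^+ 0) => _ [m _ <-]; exact: xw | exists n].
by apply: ge_sup; [exists (x 0%N); exists 0%N | move=> _ [m _ <-]].
Qed.

(* A local property of rectangles that passes from the four quarters to the whole
   holds; P x y n is about the rectangle at (x, y) of sides p/2^n and q/2^n. *)
Lemma bisection (p q x0 y0 : R) (P : R -> R -> nat -> Prop) : 0 <= p -> 0 <= q ->
  (forall x y n,
    (forall i j : bool, P (x + i%:R * (p / 2 ^+ n.+1)) (y + j%:R * (q / 2 ^+ n.+1)) n.+1) ->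
    P x y n) ->
  (forall u v, x0 <= u <= x0 + p -> y0 <= v <= y0 + q -> exists n,
     forall x y, x <= u <= x + p / 2 ^+ n -> y <= v <= y + q / 2 ^+ n -> P x y n) ->
  P x0 y0 0%N.
Proof.
move=> p0 q0 Pdiv Ploc; apply: contrapT => nP0.
have step (z : R * R * nat) : exists ij : bool * bool, ~ P z.1.1 z.1.2 z.2 ->
    ~ P (z.1.1 + ij.1%:R * (p / 2 ^+ z.2.+1)) (z.1.2 + ij.2%:R * (q / 2 ^+ z.2.+1)) z.2.+1.
  have [Pz|] := pselect (P z.1.1 z.1.2 z.2); first by exists (true, true).
  move=> nP; apply: contrapT => H; apply: nP; apply: Pdiv => i j.
  by apply: contrapT => nPij; apply: H; exists (i, j).
(* [nx] selects a quarter on which [P] still fails. The iterated quarters shrink to a point (u,v),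
   at which the local hypothesis contradicts the failure. *)
have [nx nxP] := choice step.
pose nxt (z : R * R * nat) : R * R * nat :=
  (z.1.1 + (nx z).1%:R * (p / 2 ^+ z.2.+1), z.1.2 + (nx z).2%:R * (q / 2 ^+ z.2.+1), z.2.+1).
pose z n := iter n nxt (x0, y0, 0%N).
have z2 n : (z n).2 = n by elim: n => //= n ->.
have nP n : ~ P (z n).1.1 (z n).1.2 n.
  elim: n => // n ih; have := nxP (z n); rewrite z2 => /(_ ih).
  by rewrite /= z2.
have halve (r : R) n : r / 2 ^+ n = r / 2 ^+ n.+1 + r / 2 ^+ n.+1.
  by rewrite exprS; field; rewrite expf_neq0.
have ge (r : R) (b : bool) n : 0 <= r -> 0 <= b%:R * (r / 2 ^+ n) <= r / 2 ^+ n.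
  move=> r0; have h : 0 <= r / 2 ^+ n by rewrite divr_ge0 // exprn_ge0.
  by case: b; rewrite ?mul1r ?mul0r lexx h.
have [u uP] : exists u, forall n, (z n).1.1 <= u <= (z n).1.1 + p / 2 ^+ n.
  apply: nested_sup => // n; rewrite /= z2; have := ge p (nx (z n)).1 n.+1 p0.
    by move=> /andP[h _]; rewrite lerDl.
  by rewrite (halve p n); lra.
have [v vP] : exists v, forall n, (z n).1.2 <= v <= (z n).1.2 + q / 2 ^+ n.
  apply: nested_sup => // n; rewrite /= z2; have := ge q (nx (z n)).2 n.+1 q0.
    by move=> /andP[h _]; rewrite lerDl.
  by rewrite (halve q n); lra.
have := uP 0%N; have := vP 0%N; rewrite /= expr0 !divr1 => v0 u0.
have [n nPn] := Ploc _ _ u0 v0.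
by apply: (nP n); apply: nPn.
Qed.

Variable F : R[i] -> R[i].

Definition hint a b y := cint (fun s => F (s +i* y)) a b.
Definition vint c d x := cint (fun t => F (x +i* t)) c d.
(** The integral of F(z) dz along the boundary of [a,b] x [c,d], counterclockwise; dz = i dt on the
    vertical sides. *)
Definition rect_int a b c d :=
  hint a b c - hint a b d + 'i * (vint c d b - vint c d a).

Variables (a0 b0 c0 d0 : R).
Hypothesis dF : forall s t, a0 <= s <= b0 -> c0 <= t <= d0 ->
  exists l, cderiv F (s +i* t) l.

Lemma cont_on_h y : c0 <= y <= d0 -> cont_on (fun s => F (s +i* y)) a0 b0.
Proof.
move=> yP s sP e e0; have [l /cderiv_cont/(_ e e0)[d dd dP]] := dF _ _ sP yP.
exists d => // h hd; have := dP h%:C; rewrite normC_real => /(_ hd).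
by have -> : s +i* y + h%:C = (s + h) +i* y by rewrite /GRing.add /= addr0.
Qed.

Lemma cont_on_v x : a0 <= x <= b0 -> cont_on (fun t => F (x +i* t)) c0 d0.
Proof.
move=> xP t tP e e0; have [l /cderiv_cont/(_ e e0)[d dd dP]] := dF _ _ xP tP.
exists d => // h hd; have := dP ('i * h%:C); rewrite normCM normCi mul1r normC_real => /(_ hd).
have -> // : x +i* t + 'i * h%:C = x +i* (t + h).
by apply/eqP; rewrite eq_complex /= !(mul0r, mul1r, mulr0, subr0, addr0, add0r) !eqxx.
Qed.

Lemma rect_int_split x w y k : a0 <= x -> x + (w + w) <= b0 -> 0 <= w ->
  c0 <= y -> y + (k + k) <= d0 -> 0 <= k ->
  rect_int x (x + (w + w)) y (y + (k + k)) =
  rect_int x (x + w) y (y + k) + rect_int (x + w) (x + w + w) y (y + k) +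
  (rect_int x (x + w) (y + k) (y + k + k) +
   rect_int (x + w) (x + w + w) (y + k) (y + k + k)).
Proof.
move=> ax xb w0 cy yd k0; rewrite /rect_int.
have hs t : c0 <= t <= d0 -> hint x (x + (w + w)) t = hint x (x + w) t + hint (x + w) (x + w + w) t.
  move=> tP; rewrite /hint addrA; apply: cint_split; rewrite ?lerDl //.
  by apply: cont_on_sub (cont_on_h _ tP) => //; rewrite -addrA.
have vs s : a0 <= s <= b0 -> vint y (y + (k + k)) s = vint y (y + k) s + vint (y + k) (y + k + k) s.
  move=> sP; rewrite /vint addrA; apply: cint_split; rewrite ?lerDl //.
  by apply: cont_on_sub (cont_on_v _ sP) => //; rewrite -addrA.
have [y1 y2] : c0 <= y <= d0 /\ c0 <= y + (k + k) <= d0 by split; lra.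
have [x1 x2] : a0 <= x <= b0 /\ a0 <= x + (w + w) <= b0 by split; lra.
rewrite (hs _ y1) (hs _ y2) (vs _ x1) (vs _ x2) -!addrA; ring.
Qed.

(** Opposite sides are paired before integrating. For the affine approximation of F at u + iv with
    slope l, the two differences are the constants -ilk and lw, whose contributions -ilkw and ilwk
    cancel. Each difference has error at most 2e(w + k), which [cint_near] doubles; the pairs of
    sides, of lengths w and k, add up to 4e(w + k)^2. *)
Lemma rect_int_local (e : R) u v : 0 < e -> a0 <= u <= b0 -> c0 <= v <= d0 ->
  exists2 d : R, 0 < d & forall x w y k,
    a0 <= x -> x + w <= b0 -> 0 <= w -> c0 <= y -> y + k <= d0 -> 0 <= k ->
    x <= u <= x + w -> y <= v <= y + k -> w + k < d ->
    normC (rect_int x (x + w) y (y + k)) <= 4 * e * (w + k) ^+ 2.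
Proof.
move=> e0 uP vP; have [l Fl] := dF _ _ uP vP; have [d dd dP] := Fl _ e0.
exists d => // x w y k ax xb w0 cy yd k0 xu yv wkd.
have near s t : x <= s <= x + w -> y <= t <= y + k ->
    normC (F (s +i* t) - F (u +i* v) - l * ((s - u) +i* (t - v))) <= e * (w + k).
  move=> sP tP.
  have nle : normC ((s - u) +i* (t - v)) <= w + k.
    apply: le_trans (normC_le _) _ => /=.
    by apply: lerD; rewrite ler_norml; apply/andP; split; lra.
  have := dP _ (le_lt_trans nle wkd).
  have -> : u +i* v + ((s - u) +i* (t - v)) = s +i* t.
    by apply/eqP; rewrite eq_complex /=; apply/andP; split; apply/eqP; ring.
  by move=> h; apply: le_trans h _; rewrite ler_pM2l.
rewrite /rect_int /hint /vint -!cintB; try by [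
  apply: cont_on_sub (cont_on_h _ _); lra | apply: cont_on_sub (cont_on_v _ _); lra].
have H1 : normC (cint (fun s => F (s +i* y) - F (s +i* (y + k))) x (x + w) - (l * (0 -i* k)) * (x + w - x)%:C) <= 2 * (2 * e * (w + k)) * (x + w - x).
  apply: cint_near; first lra.
    by apply: cont_onB; apply: cont_on_sub (cont_on_h _ _); lra.
  move=> s sP.
  have -> : F (s +i* y) - F (s +i* (y + k)) - l * (0 -i* k) =
    (F (s +i* y) - F (u +i* v) - l * ((s - u) +i* (y - v))) -
    (F (s +i* (y + k)) - F (u +i* v) - l * ((s - u) +i* (y + k - v))).
    have -> : 0 -i* k = ((s - u) +i* (y - v)) - ((s - u) +i* (y + k - v)).
      by apply/eqP; rewrite eq_complex /=; apply/andP; split; apply/eqP; ring.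
    ring.
  have n1 := near s y; have n2 := near s (y + k).
  apply: le_trans (normCB _ _) _.
  have -> : 2 * e * (w + k) = e * (w + k) + e * (w + k) by ring.
  by apply: lerD; [apply: n1 | apply: n2] => //; lra.
have H2 : normC (cint (fun t => F ((x + w) +i* t) - F (x +i* t)) y (y + k) - (l * w%:C) * (y + k - y)%:C) <= 2 * (2 * e * (w + k)) * (y + k - y).
  apply: cint_near; first lra.
    by apply: cont_onB; apply: cont_on_sub (cont_on_v _ _); lra.
  move=> t tP.
  have -> : F ((x + w) +i* t) - F (x +i* t) - l * w%:C =
    (F ((x + w) +i* t) - F (u +i* v) - l * ((x + w - u) +i* (t - v))) -
    (F (x +i* t) - F (u +i* v) - l * ((x - u) +i* (t - v))).
    have -> : w%:C = ((x + w - u) +i* (t - v)) - ((x - u) +i* (t - v)).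
      by apply/eqP; rewrite eq_complex /=; apply/andP; split; apply/eqP; ring.
    ring.
  have n1 := near (x + w) t; have n2 := near x t.
  apply: le_trans (normCB _ _) _.
  have -> : 2 * e * (w + k) = e * (w + k) + e * (w + k) by ring.
  by apply: lerD; [apply: n1 | apply: n2] => //; lra.
set A := cint _ _ _ in H1 *; set B := cint _ _ _ in H2 *.
have -> : A + 'i * B = (A - (l * (0 -i* k)) * (x + w - x)%:C) + 'i * (B - (l * w%:C) * (y + k - y)%:C).
  have -> : 0 -i* k = - ('i * k%:C).
    by apply/eqP; rewrite eq_complex /=; apply/andP; split; apply/eqP; ring.
  have -> : x + w - x = w by ring.
  have -> : y + k - y = k by ring.
  ring.
apply: le_trans (normCD _ _) _; rewrite normCM normCi mul1r.
by apply: le_trans (lerD H1 H2) _; rewrite le_eqVlt; apply/orP; left; apply/eqP; ring.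
Qed.

Theorem goursat : a0 <= b0 -> c0 <= d0 -> rect_int a0 b0 c0 d0 = 0.
Proof.
move=> ab cd; apply/eqP; rewrite -normC_eq0 eq_le normC_ge0 andbT.
apply/ler_addgt0Pr => e' e'0; rewrite add0r.
set p := b0 - a0; set q := d0 - c0.
have p0 : 0 <= p by rewrite subr_ge0.
have q0 : 0 <= q by rewrite subr_ge0.
(* The bound reached at the end is 4e(p + q)^2 = e(K - 1) <= e'. The 1 keeps [K] positive for a
   degenerate rectangle. *)
pose K := 4 * (p + q) ^+ 2 + 1.
have K0 : 0 < K by rewrite ltr_wpDl // mulr_ge0 // sqr_ge0.
pose e := e' / K; have e0 : 0 < e by rewrite divr_gt0.
(* The bound is quadratic in the sides, so the bounds of the four quarters add up exactly to that of
   the whole. *)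
pose P x y (n : nat) := a0 <= x -> x + p / 2 ^+ n <= b0 -> c0 <= y -> y + q / 2 ^+ n <= d0 ->
  normC (rect_int x (x + p / 2 ^+ n) y (y + q / 2 ^+ n)) <= 4 * e * (p / 2 ^+ n + q / 2 ^+ n) ^+ 2.
have ge (r : R) n : 0 <= r -> 0 <= r / 2 ^+ n by move=> r0; rewrite divr_ge0 // exprn_ge0.
have halve (r : R) n : r / 2 ^+ n = r / 2 ^+ n.+1 + r / 2 ^+ n.+1.
  by rewrite exprS; field; rewrite expf_neq0.
have : P a0 c0 0%N.
  apply: (bisection p q) => //.
    move=> x y n; rewrite /P (halve p n) (halve q n).
    have := ge p n.+1 p0; have := ge q n.+1 q0.
    set w := p / _; set k := q / _ => k0 w0 H ax xb cy yd.
    have h1 := H true true; have h2 := H false true; have h3 := H true false; have h4 := H false false.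
    rewrite !(mul0r, mul1r, addr0) in h1 h2 h3 h4.
    have xw : x + w + w = x + (w + w) by rewrite addrA.
    have yk : y + k + k = y + (k + k) by rewrite addrA.
    have ax' : a0 <= x + w by rewrite (le_trans ax) // lerDl.
    have cy' : c0 <= y + k by rewrite (le_trans cy) // lerDl.
    have xb' : x + w <= b0 by apply: le_trans xb; rewrite lerD2l lerDl.
    have yd' : y + k <= d0 by apply: le_trans yd; rewrite lerD2l lerDl.
    rewrite rect_int_split // xw yk.
    rewrite !xw !yk in h1 h2 h3 h4.
    apply: le_trans (normCD _ _) _.
    apply: le_trans (lerD (normCD _ _) (normCD _ _)) _.
    apply: le_trans (lerD (lerD (h4 _ _ _ _) (h3 _ _ _ _)) (lerD (h2 _ _ _ _) (h1 _ _ _ _))) _ => //.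
    by rewrite le_eqVlt; apply/orP; left; apply/eqP; ring.
  move=> u v uP vP.
  have uP' : a0 <= u <= b0 by rewrite /p in uP; lra.
  have vP' : c0 <= v <= d0 by rewrite /q in vP; lra.
  have [d dd dP] := rect_int_local _ _ _ e0 uP' vP'.
  have [n nP] : exists n, (p + q) / 2 ^+ n < d.
    exists (Num.truncn ((p + q) / d)).+1.
    rewrite ltr_pdivrMr ?exprn_gt0 // mulrC -ltr_pdivrMr //.
    apply: lt_trans (truncnS_gt _) _.
    by rewrite -natrX ltr_nat ltn_expl.
  exists n => x y xu yv ax xb cy yd.
  by apply: dP; rewrite ?ge // -mulrDl.
have pE : a0 + p = b0 by rewrite /p; ring.
have qE : c0 + q = d0 by rewrite /q; ring.
rewrite /P expr0 !divr1 pE qE => /(_ (lexx _) (lexx _) (lexx _) (lexx _)) h.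
apply: le_trans h _.
have -> : 4 * e * (p + q) ^+ 2 = e * (K - 1) by rewrite /K; ring.
apply: (@le_trans _ _ (e * K)); first by rewrite ler_pM2l // gerBl.
by rewrite /e divfK // gt_eqF.
Qed.
End Goursat.

(** * The complex exponential and its derivative *)

Section ExpC.
Context {R : realType}.
Implicit Types (z w : R[i]) (s t : R).

Lemma is_derive_eps (f : R -> R) (x l : R) : is_derive x (1 : R) f l ->
  forall e : R, 0 < e -> exists2 d : R, 0 < d &
    forall h, `|h| < d -> `|f (x + h) - f x - l * h| <= e * `|h|.
Proof.
move=> [fd dl] e e0.
have : h^-1 *: ((f \o shift x) (h *: 1) - f x) @[h --> 0^'] --> l by rewrite -dl; exact: fd.
move=> /cvgrPdist_le/(_ _ e0)/nbhs_normP[d d0 dP].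
exists d => // h hd; have [->|h0] := eqVneq h 0.
  by rewrite addr0 subrr mulr0 subrr normr0 mulr0.
have := dP h; rewrite /= sub0r normrN => /(_ hd h0).
rewrite distrC -(ler_pM2r (x := `|h|)) ?normr_gt0 // -normrM.
by rewrite /GRing.scale /= mulr1 [h + x]addrC mulrBl mulrAC mulVf // mul1r.
Qed.

Lemma expCD z w : expC (z + w) = expC z * expC w.
Proof.
rewrite /expC ReD ImD expRD sinD cosD.
by apply/eqP; rewrite eq_complex /=; apply/andP; split; apply/eqP; ring.
Qed.

Lemma expC0 : expC (0 : R[i]) = 1.
Proof.
by rewrite /expC /= expR0 cos0 sin0 mul1r.
Qed.

Lemma normC_expC z : normC (expC z) = expR (Re z).
Proof.
by rewrite /expC normCM normC_real (gtr0_norm (expR_gt0 _)) normCE /= cos2Dsin2 sqrtr1 mulr1.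
Qed.

Lemma expC_neq0 z : expC z != 0.
Proof. by rewrite -normC_gt0 normC_expC expR_gt0. Qed.

Lemma expCN z : expC (- z) = (expC z)^-1.
Proof.
by apply: (mulfI (expC_neq0 z)); rewrite -expCD subrr expC0 divff // expC_neq0.
Qed.

Lemma expC_periodic s t : expC (s +i* (t + pi *+ 2)) = expC (s +i* t).
Proof. by rewrite /expC /= cosD2pi sinD2pi. Qed.

Lemma cderiv_expC0 : cderiv (@expC R) 0 1.
Proof.
(* [k] is the common accuracy of the first order expansions of exp, cos and sin at 0. The errors
   below add up to 11 k |h|, and 11 <= 16. *)
move=> e e0; pose k := Num.min 1 (e / 16).
have k0 : 0 < k by rewrite lt_min ltr01 divr_gt0.
have k1 : k <= 1 by rewrite ge_min lexx.
have ke : k <= e / 16 by rewrite ge_min lexx orbT.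
clearbody k.
have [d1 d10 P1] := is_derive_eps _ _ _ (is_derive_expR 0) _ k0.
have [d2 d20 P2] := is_derive_eps _ _ _ (is_derive_cos 0) _ k0.
have [d3 d30 P3] := is_derive_eps _ _ _ (is_derive_sin 0) _ k0.
exists (Num.min k (Num.min d1 (Num.min d2 d3))); first by rewrite !lt_min k0 d10 d20 d30.
case=> a b; rewrite !lt_min => /and4P[hk h1 h2 h3].
have na : `|a| <= normC (a +i* b) := normC_Re (a +i* b).
have nb : `|b| <= normC (a +i* b) := normC_Im (a +i* b).
have {P1} := P1 a (le_lt_trans na h1).
have {P2} := P2 b (le_lt_trans nb h2).
have {P3} := P3 b (le_lt_trans nb h3).
rewrite !add0r expR0 cos0 sin0 oppr0 !mul1r mul0r !addr0 ?subr0.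
set n := normC _ in na nb hk h1 h2 h3 *.
have n0 : 0 <= n by rewrite /n normC_ge0.
set E := expR a; set C := cos b; set S := sin b => hS hC hE.
rewrite expC0 /expC.
apply: le_trans (normC_le _) _ => /=; rewrite -/E -/C -/S !(mul0r, subr0, addr0, oppr0).
have kn (x : R) : `|x| <= n -> k * `|x| <= k * n by move=> h; rewrite ler_pM2l.
have {}hS := le_trans hS (kn _ nb); have {}hC := le_trans hC (kn _ nb).
have {}hE := le_trans hE (kn _ na).
have nk : k * n <= k * 1 by rewrite ler_pM2l //; apply: ltW; apply: lt_le_trans hk k1.
have Eb : `|E| <= 4.
  rewrite (_ : E = (E - 1 - a) + a + 1); last by ring.
  rewrite (le_trans (ler_normD _ _)) // normr1 (le_trans (lerD (ler_normD _ _) (lexx _))) //; lra.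
have ab : `|(E - 1) * b| <= 2 * n * k.
  rewrite normrM; have h : `|E - 1| <= 2 * n.
    rewrite (_ : E - 1 = (E - 1 - a) + a); last by ring.
    rewrite (le_trans (ler_normD _ _)) //.
    have : k * n <= 1 * n by rewrite ler_wpM2r.
    lra.
  apply: ler_pM => //; lra.
have -> : E * C - 1 - a = E * (C - 1) + (E - 1 - a) by ring.
have -> : E * S - b = E * (S - b) + (E - 1) * b by ring.
have i1 : `|E * (C - 1) + (E - 1 - a)| <= 4 * (k * n) + k * n.
  apply: le_trans (ler_normD _ _) _; apply: lerD => //.
  by rewrite normrM ler_pM.
have i2 : `|E * (S - b) + (E - 1) * b| <= 4 * (k * n) + 2 * n * k.
  apply: le_trans (ler_normD _ _) _; apply: lerD => //.
  by rewrite normrM ler_pM.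
have i3 : k * n <= e / 16 * n by rewrite ler_wpM2r.
have e1 : 2 * n * k = 2 * (k * n) by ring.
rewrite e1 in i2.
have kn0 : 0 <= k * n by rewrite mulr_ge0 // ltW.
apply: le_trans (lerD i1 i2) _; lra.
Qed.

Lemma differentiable_expC (z : R[i]^o) : differentiable (@expC R : R[i]^o -> R[i]^o) z.
Proof.
apply: (@cderiv_differentiable _ _ _ (expC z)) => e e0.
have ez : 0 < normC (expC z) by rewrite normC_gt0 expC_neq0.
have [d d0 dP] := cderiv_expC0 (e / normC (expC z)) (divr_gt0 e0 ez).
exists d => // h /dP; rewrite add0r expC0 mul1r mulrAC ler_pdivlMr // -normCM.
by congr (normC _ <= _); rewrite expCD; ring.
Qed.

End ExpC.

Section CauchyEstimate.
Context {R : realType}.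

(* F(w) = (f(z0 + e^w) - f(z0)) e^-w is 2 i pi-periodic, so by Goursat's lemma its
   integral over a vertical segment of length 2 pi does not depend on the
   abscissa s; it tends to 2 pi l as s tends to -oo. *)
Lemma cauchy_estimate (f : R[i]^o -> R[i]^o) (z0 : R[i]^o) (r M : R) (l : R[i]) : 0 < r ->
  (forall z : R[i]^o, normC (z - z0) < r -> differentiable f z) ->
  (forall z : R[i]^o, normC (z - z0) < r -> normC (f z) <= M) ->
  cderiv f z0 l -> normC l <= 8 * M / r.
Proof.
move=> r0 df fM fl.
pose F (w : R[i]^o) : R[i]^o := (f (z0 + expC w) - f z0) * expC (- w).
have r20 : 0 < r / 2 by rewrite divr_gt0.
pose s2 := ln (r / 2).
have inD (w : R[i]) : Re w <= s2 -> normC ((z0 + expC w) - z0) < r.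
  move=> h; rewrite addrC addKr normC_expC.
  apply: (@le_lt_trans _ _ (r / 2)); last lra.
  by rewrite -(@lnK _ (r / 2)) ?posrE // ler_expR.
have dF (w : R[i]^o) : Re w <= s2 -> differentiable F w.
  move=> h.
  have d1 : differentiable (f \o (fun w : R[i]^o => z0 + @expC R w : R[i]^o)) w.
    apply: differentiable_comp; last exact/df/inD.
    apply: (@differentiableD _ _ _ (cst z0) (@expC R : R[i]^o -> R[i]^o)).
      exact: differentiable_cst.
    exact: differentiable_expC.
  have d2 : differentiable ((@expC R : R[i]^o -> R[i]^o) \o (fun w : R[i]^o => - w : R[i]^o)) w.
    apply: differentiable_comp; last exact: differentiable_expC.
    exact: (@differentiableN _ _ _ id).
  have d3 : differentiable (cst (f z0) : R[i]^o -> R[i]^o) w by exact: differentiable_cst.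
  exact: (differentiableM (differentiableB d1 d3) d2).
apply/ler_addgt0Pr => e e0; have e20 : 0 < e / 2 by rewrite divr_gt0.
have [d d0 dP] := fl _ e20.
(* At this abscissa |e^w| <= d/2 < d, so F is within e/2 of l on the left side. The right side, at
   [s2], corresponds to the circle of radius r/2. *)
pose s1 := Num.min s2 (ln (d / 2)).
have s12 : s1 <= s2 by rewrite ge_min lexx.
have es2 : expR s2 = r / 2 by rewrite /s2 lnK ?posrE.
have es1 : expR s1 <= d / 2.
  by rewrite -[leRHS]lnK ?posrE ?divr_gt0 // ler_expR ge_min lexx orbT.
have FE w : F w = (f (z0 + expC w) - f z0) * expC (- w) by [].
clearbody s1 F; clearbody s2.
have pi0 := pi_gt0 R.
have tpi : 0 <= pi *+ 2 :> R by rewrite mulrn_wge0 // ltW.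
have Fc s t : s1 <= s <= s2 -> 0 <= t <= pi *+ 2 -> exists l', cderiv F (s +i* t) l'.
  by move=> /andP[_ hs] _; apply: differentiable_cderiv; exact: dF.
have := goursat _ _ _ _ _ Fc s12 tpi.
rewrite /rect_int.
have -> : hint F s1 s2 0 = hint F s1 s2 (pi *+ 2).
  rewrite /hint; congr cint; apply/funext => s.
  by rewrite !FE !expCN -(expC_periodic s 0) add0r.
rewrite subrr add0r => /eqP; rewrite mulf_eq0 -normC_eq0 normCi oner_eq0 /= subr_eq0 => /eqP Veq.
have Fcont s : s1 <= s <= s2 -> cont_on (fun t => F (s +i* t)) 0 (pi *+ 2).
  by move=> hs; apply: (cont_on_v _ _ _ _ _ Fc).
have V2 : normC (vint F 0 (pi *+ 2) s2) <= 2 * (2 * M / (r / 2)) * (pi *+ 2 - 0).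
  apply: cint_norm => //; first by apply: Fcont; rewrite s12 lexx.
  move=> t _; rewrite FE normCM expCN normCV normC_expC /= es2.
  rewrite ler_pM2r ?invr_gt0 //; apply: le_trans (normCB _ _) _.
  have -> : 2 * M = M + M by ring.
  by apply: lerD; apply: fM; rewrite ?subrr ?normC0 //; apply: inD.
have V1 : normC (vint F 0 (pi *+ 2) s1 - l * (pi *+ 2 - 0)%:C) <= 2 * (e / 2) * (pi *+ 2 - 0).
  apply: cint_near => //; first by apply: Fcont; rewrite s12 lexx.
  move=> t _; set h := expC (s1 +i* t).
  have h0 : h != 0 by exact: expC_neq0.
  have hd : normC h < d.
    rewrite normC_expC /=; apply: (@le_lt_trans _ _ (d / 2)); last lra.
    exact: es1.
  have -> : F (s1 +i* t) - l = (f (z0 + h) - f z0 - l * h) / h.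
    by rewrite FE expCN -/h [RHS]mulrBl mulfK.
  rewrite normCM normCV ler_pdivrMr ?normC_gt0 //; exact: dP.
have p2 : 0 < pi *+ 2 :> R by rewrite mulrn_wgt0.
move: V1 V2; rewrite -Veq subr0 => V1 V2.
have : normC (l * (pi *+ 2)%:C) <= 2 * (2 * M / (r / 2)) * (pi *+ 2) + 2 * (e / 2) * (pi *+ 2).
  set V := vint _ _ _ _ in V1 V2.
  have -> : l * (pi *+ 2)%:C = V - (V - l * (pi *+ 2)%:C) by ring.
  by apply: le_trans (normCB _ _) _; apply: lerD.
rewrite normCM normC_real (gtr0_norm p2) -mulrDl ler_pM2r //.
have -> : 2 * (2 * M / (r / 2)) + 2 * (e / 2) = 8 * M / r + e by field; rewrite gt_eqF.
by [].
Qed.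
End CauchyEstimate.

(** * Taylor remainders of order two *)

Section SecondOrder.
Context {R : realType}.

Lemma eps_is_derive (f : R -> R) (x l : R) :
  (forall e : R, 0 < e -> exists2 d : R, 0 < d &
    forall h, `|h| < d -> `|f (x + h) - f x - l * h| <= e * `|h|) ->
  is_derive x (1 : R) f l.
Proof.
move=> fP.
have cv : h^-1 *: ((f \o shift x) (h *: 1) - f x) @[h --> 0^'] --> l.
  apply/cvgrPdist_le => e e0; have [d d0 dP] := fP _ e0.
  apply/nbhs_normP; exists d => // h; rewrite /= sub0r normrN => hd h0.
  have h0' : 0 < `|h| by rewrite normr_gt0.
  rewrite distrC -(ler_pM2r h0') -normrM.
  have := dP _ hd.
  by rewrite /GRing.scale /= mulr1 [h + x]addrC mulrBl mulrAC mulVf // mul1r.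
apply: DeriveDef; first by apply/cvg_ex; exists l.
exact: cvg_lim cv.
Qed.

(** [k] stands for the real or the imaginary part: the mean value theorem with equality holds for
    real functions only, and is applied to t |-> k (f (x + tv)) on [0,1]. *)
Lemma mean_value_functional (k : R[i] -> R) (f : R[i] -> R[i]) (x v : R[i]) (B : R) :
  (forall z w, k (z - w) = k z - k w) -> (forall z, `|k z| <= normC z) ->
  (forall (t : R) z, k (t%:C * z) = t * k z) ->
  (forall t : R, 0 <= t <= 1 -> exists2 l, cderiv f (x + t%:C * v) l & normC l <= B) ->
  `|k (f (x + v)) - k (f x)| <= B * normC v.
Proof.
move=> kB kn kZ fP.
pose u (t : R) := k (f (x + t%:C * v)).
have fP' (t : R) : exists l, 0 <= t <= 1 -> cderiv f (x + t%:C * v) l /\ normC l <= B.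
  have [/fP[l l1 l2]|nt] := pselect (is_true (0 <= t <= 1)); first by exists l.
  by exists 0.
have [l lP] := choice fP'.
have uP (t : R) : 0 <= t <= 1 -> is_derive t (1 : R) u (k (l t * v)).
  move=> /lP[ft _]; apply: eps_is_derive => e e0.
  pose K := normC v + 1; have K0 : 0 < K by rewrite ltr_wpDl ?normC_ge0.
  have [d d0 dP] := ft _ (divr_gt0 e0 K0).
  exists (d / K); first by rewrite divr_gt0.
  move=> h; rewrite ltr_pdivlMr // => hd.
  have nhv : normC (h%:C * v) <= `|h| * K.
    by rewrite normCM normC_real ler_wpM2l // lerDl.
  have := dP _ (le_lt_trans nhv hd).
  rewrite /u rmorphD mulrDl addrA => H.
  rewrite -kB [_ * h]mulrC -kZ -kB; apply: le_trans (kn _) _.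
  rewrite mulrCA; apply: le_trans H _.
  rewrite -mulrA ler_pM2l // mulrC ler_pdivrMr //.
have uc : {within `[0, 1], continuous u}.
  apply: continuous_in_subspaceT => t; rewrite inE /= in_itv /= => /uP[tu _].
  exact/differentiable_continuous/derivable1_diffP.
have uP' (t : R) : t \in `]0, 1[ -> is_derive t (1 : R) u (k (l t * v)).
  by rewrite in_itv /= => /andP[h1 h2]; apply: uP; rewrite !ltW.
have [c] := MVT ltr01 uP' uc.
rewrite in_itv /= => /andP[c0 c1]; rewrite /u mul1r mul0r addr0 subr0 mulr1 => ->.
have [|_ lB] := lP c; first by rewrite !ltW.
by apply: le_trans (kn _) _; rewrite normCM ler_wpM2r ?normC_ge0.
Qed.

Lemma mean_value_ineq (f : R[i] -> R[i]) (x y : R[i]) (B : R) :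
  (forall t : R, 0 <= t <= 1 -> exists2 l, cderiv f (x + t%:C * (y - x)) l & normC l <= B) ->
  normC (f y - f x) <= 2 * B * normC (y - x).
Proof.
move=> fP; have yE : y = x + (y - x) by rewrite addrC subrK.
apply: le_trans (normC_le _) _; rewrite ReD ReN ImD ImN {1 2}yE.
have -> : 2 * B * normC (y - x) = B * normC (y - x) + B * normC (y - x) by ring.
apply: lerD.
  apply: (@mean_value_functional (@complex.Re R)) => //.
  - by move=> z w; rewrite ReD ReN.
  - exact: normC_Re.
  - by move=> t z; rewrite ReM /= mul0r subr0.
apply: (@mean_value_functional (@complex.Im R)) => //.
- by move=> z w; rewrite ImD ImN.
- exact: normC_Im.
- by move=> t z; rewrite ImM /= mul0r addr0.
Qed.

Lemma disc_convex (z0 x y : R[i]) (r t : R) : 0 <= t <= 1 ->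
  normC (x - z0) < r -> normC (y - z0) < r -> normC (x + t%:C * (y - x) - z0) < r.
Proof.
move=> /andP[t0 t1] xr yr.
have -> : x + t%:C * (y - x) - z0 = (1 - t)%:C * (x - z0) + t%:C * (y - z0).
  by rewrite rmorphB rmorph1; ring.
apply: le_lt_trans (normCD _ _) _; rewrite !normCM !normC_real !ger0_norm ?subr_ge0 //.
have [->|tn] := eqVneq t 0; first by rewrite subr0 mul0r mul1r addr0.
have tp : 0 < t by rewrite lt0r tn.
have h1 : t * normC (y - z0) < t * r by rewrite ltr_pM2l.
have h2 : (1 - t) * normC (x - z0) <= (1 - t) * r by rewrite ler_wpM2l ?subr_ge0 // ltW.
lra.
Qed.

Definition bounded_holo (f : R[i]^o -> R[i]^o) (z0 : R[i]^o) (r M : R) : Prop :=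
  forall z : R[i]^o, normC (z - z0) < r -> differentiable f z /\ normC (f z) <= M.

Lemma bounded_holo_deriv f z0 r M l : 0 < r -> bounded_holo f z0 r M ->
  cderiv f z0 l -> normC l <= 8 * M / r.
Proof. by move=> r0 fP; apply: cauchy_estimate => // z /fP[]. Qed.

Lemma bounded_holo_sub f z0 r M (z1 : R[i]^o) r1 : normC (z1 - z0) + r1 <= r ->
  bounded_holo f z0 r M -> bounded_holo f z1 r1 M.
Proof.
move=> rr fP z zr; apply: fP.
have -> : z - z0 = (z - z1) + (z1 - z0) by ring.
apply: le_lt_trans (normCD _ _) _; lra.
Qed.

(** About each point of the half disc the Cauchy estimate applies with radius r/2 and gives |f'| <=
    16M/r; [mean_value_ineq] doubles this. *)
Lemma bounded_holo_lipschitz f z0 r M (x y : R[i]^o) : 0 < r -> bounded_holo f z0 r M ->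
  normC (x - z0) < r / 2 -> normC (y - z0) < r / 2 ->
  normC (f y - f x) <= 32 * M / r * normC (y - x).
Proof.
move=> r0 fP xr yr.
have -> : 32 * M / r * normC (y - x) = 2 * (16 * M / r) * normC (y - x) by ring.
apply: mean_value_ineq => t tP; have h := disc_convex _ _ _ _ _ tP xr yr.
set p : R[i]^o := x + t%:C * (y - x).
have [l pl] : exists l, cderiv f p l.
  apply: differentiable_cderiv; apply: (fP p _).1; apply: lt_le_trans h _; lra.
exists l => //.
have -> : 16 * M / r = 8 * M / (r / 2) by field; rewrite gt_eqF.
apply: bounded_holo_deriv pl; first by rewrite divr_gt0.
apply: bounded_holo_sub fP; rewrite -/p in h; lra.
Qed.

Lemma differentiable_idfun (V : normedModType R[i]) (x : V) : differentiable (id : V -> V) x.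
Proof. exact: (@ex_diff _ _ _ _ _ _ _ (is_diff_id x)). Qed.

Lemma differentiable_fst (p : C2 R) : differentiable (fst : C2 R -> R[i]^o) p.
Proof. by apply: linear_differentiable => q; exact: cvg_fst. Qed.

Lemma differentiable_snd (p : C2 R) : differentiable (snd : C2 R -> R[i]^o) p.
Proof. by apply: linear_differentiable => q; exact: cvg_snd. Qed.

Lemma bounded_holoB (f g : R[i]^o -> R[i]^o) (z0 : R[i]^o) (r M : R) :
  (forall z : R[i]^o, normC (z - z0) < r -> differentiable f z) ->
  (forall z : R[i]^o, normC (z - z0) < r -> differentiable g z) ->
  (forall z : R[i]^o, normC (z - z0) < r -> normC (f z - g z) <= M) ->
  bounded_holo (f \- g) z0 r M.
Proof. by move=> fd gd fg z zr; split; [apply: differentiableB; [exact: fd|exact: gd]|exact: fg]. Qed.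

Lemma differentiable_shift (f : R[i]^o -> R[i]^o) (k z : R[i]^o) :
  differentiable f (z + k) -> differentiable (fun x : R[i]^o => f (x + k)) z.
Proof.
move=> df.
have dk : differentiable (id + cst k : R[i]^o -> R[i]^o) z.
  by apply: differentiableD; [exact: differentiable_idfun | exact: differentiable_cst].
exact: differentiable_comp dk df.
Qed.

(** For |k| <= |h| the function x |-> f(x + k) - f(x) is at most 32M|k|/r on the disc of radius r/4,
    so its derivative at [z0], which is f'(z0 + k) - f'(z0), is at most 8 (32M|k|/r) / (r/4) =
    1024M|k|/r^2. The mean value inequality for x |-> f(x) - lx doubles this. *)
Lemma second_order f z0 r M l (h : R[i]) : 0 < r -> 0 <= M -> bounded_holo f z0 r M ->
  cderiv f z0 l -> normC h < r / 4 ->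
  normC (f (z0 + h) - f z0 - l * h) <= 2048 * M / r ^+ 2 * normC h ^+ 2.
Proof.
move=> r0 M0 fP fl hr.
pose g x := f x - l * x.
have -> : f (z0 + h) - f z0 - l * h = g (z0 + h) - g z0 by rewrite /g; ring.
pose B := 1024 * M / r ^+ 2 * normC h.
have -> : 2048 * M / r ^+ 2 * normC h ^+ 2 = 2 * B * normC (z0 + h - z0).
  by rewrite [z0 + h]addrC addrK /B; ring.
apply: mean_value_ineq => t /andP[t0 t1]; rewrite [z0 + h]addrC addrK.
set k := t%:C * h.
have kh : normC k <= normC h by rewrite normCM normC_real ger0_norm // ler_piMl ?normC_ge0.
have dfr z : normC (z - z0) < r -> differentiable f z by move=> /fP[].
have [l' pl] : exists l', cderiv f (z0 + k) l'.
  apply: differentiable_cderiv; apply: dfr; rewrite addrC addKr.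
  apply: (le_lt_trans kh); lra.
exists (l' - l); first exact: cderivB pl (cderiv_linear _ _).
have dk := cderivB _ _ _ _ _ (cderiv_shift _ _ _ _ pl) fl.
have r40 : 0 < r / 4 by rewrite divr_gt0.
have bh : bounded_holo ((fun x : R[i]^o => f (x + k)) \- f) z0 (r / 4) (32 * M / r * normC k).
  apply: bounded_holoB => z zr.
  - apply: differentiable_shift; apply: dfr.
    have -> : z + k - z0 = (z - z0) + k by ring.
    apply: le_lt_trans (normCD _ _) _; lra.
  - by apply: dfr; lra.
  - have -> : normC k = normC (z + k - z) by rewrite addrC addKr.
    apply: (bounded_holo_lipschitz f z0) => //; first lra.
    have -> : z + k - z0 = (z - z0) + k by ring.
    apply: le_lt_trans (normCD _ _) _; lra.
apply: le_trans (bounded_holo_deriv _ _ _ _ _ r40 bh dk) _.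
have -> : 8 * (32 * M / r * normC k) / (r / 4) = 1024 * M / r ^+ 2 * normC k.
  by field; rewrite gt_eqF.
apply: ler_wpM2l; last exact: kh.
by apply: divr_ge0; [apply: mulr_ge0; [exact: ler0n|exact: M0]|exact: sqr_ge0].
Qed.

Definition bounded_holo2 (f : C2 R -> R[i]^o) (a b : R[i]^o) (r M : R) : Prop :=
  forall x y : R[i]^o, normC (x - a) < r -> normC (y - b) < r ->
    differentiable f (x, y) /\ normC (f (x, y)) <= M.

Lemma differentiable_sectl (f : C2 R -> R[i]^o) (x y : R[i]^o) :
  differentiable f (x, y) -> differentiable (fun x : R[i]^o => f (x, y)) x.
Proof.
move=> df.
have dy := differentiable_pair (differentiable_idfun _ x) (differentiable_cst y x).
exact: differentiable_comp dy df.
Qed.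

Lemma differentiable_sectr (f : C2 R -> R[i]^o) (x y : R[i]^o) :
  differentiable f (x, y) -> differentiable (fun y : R[i]^o => f (x, y)) y.
Proof.
move=> df.
have dx := differentiable_pair (differentiable_cst x y) (differentiable_idfun _ y).
exact: differentiable_comp dx df.
Qed.

(** The increment is taken along h at second coordinate b + k, then along k at first coordinate a.
    Replacing the first partial derivative at (a, b + k) by the one at (a, b) costs a mixed term of
    order |h||k|, by the Cauchy estimate for x |-> f(x, b + k) - f(x, b). *)
Lemma second_order2 (f : C2 R -> R[i]^o) a b r M : 0 < r -> 0 <= M ->
  bounded_holo2 f a b r M -> exists l1 l2,
  [/\ normC l1 <= 8 * M / r, normC l2 <= 8 * M / r & forall h k : R[i],
    normC h < r / 4 -> normC k < r / 4 ->
    normC (f (a + h, b + k) - f (a, b) - (l1 * h + l2 * k)) <=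
      2048 * M / r ^+ 2 * (normC h + normC k) ^+ 2].
Proof.
move=> r0 M0 fP.
have sl (y : R[i]^o) : normC (y - b) < r -> bounded_holo (fun x : R[i]^o => f (x, y)) a r M.
  by move=> yr x xr; have [df fM] := fP _ _ xr yr; split=> //; exact: differentiable_sectl.
have sr (x : R[i]^o) : normC (x - a) < r -> bounded_holo (fun y : R[i]^o => f (x, y)) b r M.
  by move=> xr y yr; have [df fM] := fP _ _ xr yr; split=> //; exact: differentiable_sectr.
have bb : normC (b - b) < r by rewrite subrr normC0.
have aa : normC (a - a) < r by rewrite subrr normC0.
have dl y : normC (y - b) < r -> exists l, cderiv (fun x => f (x, y)) a l.
  by move=> yr; apply: differentiable_cderiv; exact: (sl _ yr _ aa).1.
have [l1 l1P] := dl b bb.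
have [l2 l2P] : exists l, cderiv (fun y => f (a, y)) b l.
  by apply: differentiable_cderiv; exact: (sr _ aa _ bb).1.
exists l1, l2; split.
- exact: bounded_holo_deriv (sl _ bb) l1P.
- exact: bounded_holo_deriv (sr _ aa) l2P.
move=> h k hr kr.
have kb : normC (b + k - b) < r by rewrite addrC addKr; lra.
have [l1' l1'P] := dl _ kb.
have s1 := second_order _ _ _ _ _ _ r0 M0 (sl _ kb) l1'P hr.
have s2 := second_order _ _ _ _ _ _ r0 M0 (sr _ aa) l2P kr.
have d : normC (l1' - l1) <= 8 * (32 * M / r * normC k) / r.
  apply: (bounded_holo_deriv _ _ _ _ _ r0 _ (cderivB _ _ _ _ _ l1'P l1P)).
  apply: bounded_holoB => x xr.
  - exact: (sl _ kb _ xr).1.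
  - exact: (sl _ bb _ xr).1.
  - have -> : normC k = normC (b + k - b) by rewrite addrC addKr.
    apply: (bounded_holo_lipschitz (fun y : R[i]^o => f (x, y)) b r M b (b + k) r0 (sr _ xr)).
      by rewrite subrr normC0 divr_gt0.
    by rewrite addrC addKr; lra.
have -> : f (a + h, b + k) - f (a, b) - (l1 * h + l2 * k) =
  (f (a + h, b + k) - f (a, b + k) - l1' * h) + (l1' - l1) * h +
  (f (a, b + k) - f (a, b) - l2 * k) by ring.
apply: le_trans (normCD _ _) _; apply: le_trans (lerD (normCD _ _) (lexx _)) _.
rewrite normCM.
have {}d : normC (l1' - l1) * normC h <= 2048 * M / r ^+ 2 * (2 * (normC h * normC k)).
  apply: le_trans (ler_wpM2r (normC_ge0 _) d) _.
  have -> : 8 * (32 * M / r * normC k) / r * normC h = 256 * (M / r ^+ 2 * (normC h * normC k)).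
    by field; rewrite gt_eqF.
  have -> : 2048 * M / r ^+ 2 * (2 * (normC h * normC k)) = 4096 * (M / r ^+ 2 * (normC h * normC k)) by ring.
  apply: ler_wpM2r; last by rewrite ler_nat.
  apply: mulr_ge0; last by apply: mulr_ge0; exact: normC_ge0.
  by apply: divr_ge0; [exact: M0|exact: sqr_ge0].
apply: le_trans (lerD (lerD s1 d) s2) _.
by rewrite le_eqVlt; apply/orP; left; apply/eqP; ring.
Qed.

Definition maxC (h : C2 R) : R := Num.max (normC h.1) (normC h.2).

Lemma normr_maxC (h : C2 R) : `|h| = (maxC h)%:C.
Proof.
by rewrite prod_normE /maxC !normr_normC /Order.max ltcR; case: ifP.
Qed.

Lemma differentiable_second_order (F : C2 R -> R[i]^o) (p : C2 R) (l1 l2 : R[i]) (r K : R) :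
  0 < r -> 0 <= K ->
  (forall h k : R[i], normC h < r -> normC k < r ->
    normC (F (p.1 + h, p.2 + k) - F p - (l1 * h + l2 * k)) <=
      K * (normC h + normC k) ^+ 2) ->
  differentiable F p.
Proof.
move=> r0 K0 FP.
pose L : C2 R -> R[i]^o := (l1 *: (fst : C2 R -> R[i]^o)) + (l2 *: (snd : C2 R -> R[i]^o)).
have dL : differentiable L p.
  by apply: differentiableD; apply: differentiableZ; [exact: differentiable_fst|exact: differentiable_snd].
have -> : F = (F - L) + L by rewrite subrK.
apply: differentiableD; last exact: dL.
apply: differentiable_diff0 => e e0.
move: dL => _.
exists (Num.min r (e / (4 * K + 1))).
  by rewrite lt_min r0 divr_gt0 // ltr_wpDl // mulr_ge0.
move=> h; rewrite normr_maxC ltcR lt_min => /andP[hr he].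
have h1 : normC h.1 <= maxC h by rewrite le_max lexx.
have h2 : normC h.2 <= maxC h by rewrite le_max lexx orbT.
have m0 : 0 <= maxC h := le_trans (normC_ge0 _) h1.
have -> : (F - L) (p + h) - (F - L) p =
    F (p.1 + h.1, p.2 + h.2) - F p - (l1 * h.1 + l2 * h.2).
  rewrite /L !fctE /= /GRing.scale /=.
  have -> : p + h = (p.1 + h.1, p.2 + h.2) by case: p h {h1 h2 hr he m0 FP} => [? ?] [].
  ring.
rewrite normr_normC -rmorphM lecR.
apply: le_trans (FP _ _ (le_lt_trans h1 hr) (le_lt_trans h2 hr)) _.
have s : normC h.1 + normC h.2 <= 2 * maxC h by lra.
apply: (@le_trans _ _ (K * (2 * maxC h) ^+ 2)).
  rewrite ler_wpM2l // ler_pXn2r ?nnegrE ?addr_ge0 ?normC_ge0 ?mulr_ge0 //.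
have -> : K * (2 * maxC h) ^+ 2 = (4 * K * maxC h) * maxC h by ring.
rewrite ler_wpM2r //.
have K1 : 0 < 4 * K + 1 by rewrite ltr_wpDl // mulr_ge0.
move: he; rewrite ltr_pdivlMr // => he.
have : maxC h * (4 * K + 1) = 4 * K * maxC h + maxC h by ring.
lra.
Qed.

End SecondOrder.

(** * Unconditional sums *)

Section Sums.
Context {R : realType}.

(** Here and in [has_sum], finite subsets are duplicate-free lists directed by inclusion. No
    enumeration of the index type is chosen, so reindexing by a bijection, the step behind the
    functional equation, is immediate. *)
Definition bsum (I : eqType) (b : I -> R) (K : R) : Prop :=
  forall s : seq I, uniq s -> \sum_(i <- s) b i <= K.

Definition has_sum (I : eqType) (f : I -> R[i]) (S : R[i]) : Prop :=
  forall e : R, 0 < e -> exists s0 : seq I, forall s, uniq s -> {subset s0 <= s} ->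
    normC (\sum_(i <- s) f i - S) <= e.

Arguments bsum {I}.
Arguments has_sum {I}.

Section Basic.
Variable I : eqType.
Implicit Types (f g : I -> R[i]) (b : I -> R).

Lemma sum_subset b (s0 s : seq I) : (forall i, 0 <= b i) -> uniq s0 -> uniq s ->
  {subset s0 <= s} -> \sum_(i <- s0) b i <= \sum_(i <- s) b i.
Proof.
move=> b0 u0 us sub; rewrite [leRHS](bigID (fun i => i \in s0)) /= -[X in X + _]big_filter.
have pm : perm_eq [seq i <- s | i \in s0] s0.
  apply: uniq_perm => //; first exact: filter_uniq.
  by move=> i; rewrite mem_filter; apply/andP/idP => [[]//|h]; split=> //; exact: sub.
by rewrite (perm_big _ pm) lerDl sumr_ge0.
Qed.

Lemma has_sum_unique f S T : has_sum f S -> has_sum f T -> S = T.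
Proof.
move=> fS fT; apply/eqP; rewrite -subr_eq0 -normC_eq0 eq_le normC_ge0 andbT.
apply/ler_addgt0Pr => e e0; rewrite add0r; have e20 : 0 < e / 2 by rewrite divr_gt0.
have [s1 P1] := fS _ e20; have [s2 P2] := fT _ e20.
have h1 := P1 (undup (s1 ++ s2)) (undup_uniq _).
have h2 := P2 (undup (s1 ++ s2)) (undup_uniq _).
set X := \sum_(i <- _) _ in h1 h2.
have -> : S - T = (X - T) - (X - S) by ring.
apply: le_trans (normCB _ _) _.
have {}h1 : normC (X - S) <= e / 2 by apply: h1 => i; rewrite mem_undup mem_cat => ->.
have {}h2 : normC (X - T) <= e / 2.
  by apply: h2 => i; rewrite mem_undup mem_cat => ->; rewrite orbT.
lra.
Qed.

Lemma has_sum_tail f S (s0 : seq I) K : uniq s0 ->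
  bsum (fun i => if i \in s0 then 0 else normC (f i)) K ->
  has_sum f S -> normC (S - \sum_(i <- s0) f i) <= K.
Proof.
move=> u0 bK fS; apply/ler_addgt0Pr => e e0; have [s1 P1] := fS _ e0.
pose s := undup (s0 ++ s1).
have us : uniq s by exact: undup_uniq.
have h1 : normC (\sum_(i <- s) f i - S) <= e.
  by apply: P1 => // i h; rewrite mem_undup mem_cat h orbT.
have E : \sum_(i <- s) f i - \sum_(i <- s0) f i = \sum_(i <- s | i \notin s0) f i.
  rewrite (bigID (fun i => i \in s0)) /= -[X in X + _ - _]big_filter.
  have pm : perm_eq [seq i <- s | i \in s0] s0.
    apply: uniq_perm => //; first exact: filter_uniq.
    move=> i; rewrite mem_filter mem_undup mem_cat; by case: (i \in s0).
  by rewrite (perm_big _ pm) addrC addKr.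
have h2 : normC (\sum_(i <- s) f i - \sum_(i <- s0) f i) <= K.
  rewrite E -big_filter; apply: le_trans (normC_sum _ _ _) _.
  apply: le_trans (bK _ us); rewrite big_filter big_mkcond /=.
  by apply: ler_sum => i _; case: (i \in s0).
set A := \sum_(i <- s) _ in h1 h2; set B := \sum_(i <- s0) _ in h2 *.
have -> : S - B = (A - B) - (A - S) by ring.
by apply: le_trans (normCB _ _) _; exact: lerD.
Qed.

Lemma has_sum_norm f S K : bsum (fun i => normC (f i)) K -> has_sum f S -> normC S <= K.
Proof.
move=> bK fS; have := has_sum_tail f S [::] K isT _ fS.
by rewrite big_nil subr0; apply.
Qed.

Lemma has_sumD f g S T : has_sum f S -> has_sum g T -> has_sum (fun i => f i + g i) (S + T).
Proof.
move=> fS gT e e0; have e20 : 0 < e / 2 by rewrite divr_gt0.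
have [s1 P1] := fS _ e20; have [s2 P2] := gT _ e20.
exists (s1 ++ s2) => s us sub; rewrite big_split /= opprD addrACA.
apply: le_trans (normCD _ _) _; rewrite [leRHS]splitr; apply: lerD.
  by apply: P1 => // i h; apply: sub; rewrite mem_cat h.
by apply: P2 => // i h; apply: sub; rewrite mem_cat h orbT.
Qed.

Lemma has_sumZ k f S : has_sum f S -> has_sum (fun i => k * f i) (k * S).
Proof.
move=> fS e e0; have K0 : 0 < normC k + 1 by rewrite ltr_wpDl // normC_ge0.
have [s0 P0] := fS _ (divr_gt0 e0 K0).
exists s0 => s us /(P0 _ us); rewrite ler_pdivlMr // => h.
rewrite -big_distrr /= -mulrBr normCM; apply: le_trans h.
by rewrite mulrC ler_wpM2l ?normC_ge0 // lerDl.
Qed.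

Lemma has_sumB f g S T : has_sum f S -> has_sum g T -> has_sum (fun i => f i - g i) (S - T).
Proof.
move=> fS gT; have := has_sumD _ _ _ _ fS (has_sumZ (-1) _ _ gT).
rewrite mulN1r; congr has_sum; apply/funext => i; by rewrite mulN1r.
Qed.

Lemma has_sum_reindex f S (g g' : I -> I) : cancel g g' -> cancel g' g ->
  has_sum f S -> has_sum (fun i => f (g i)) S.
Proof.
move=> gK gK' fS e /fS[s0 P0]; exists (map g' s0) => s us sub.
rewrite -(big_map g predT f); apply: P0; first by rewrite map_inj_uniq //; exact: can_inj gK.
by move=> i h; rewrite -(gK' i); apply: map_f; apply: sub; apply: map_f.
Qed.

Lemma has_sum_real b K : (forall i, 0 <= b i) -> bsum b K ->
  exists S, has_sum (fun i => (b i)%:C) S.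
Proof.
move=> b0 bK; pose A := [set x | exists2 s, uniq s & x = \sum_(i <- s) b i].
have hA : has_sup A.
  by split; [exists (\sum_(i <- [::]) b i), [::] | exists K => _ [s us ->]; exact: bK].
exists (sup A)%:C => e e0.
have [_ [s0 u0 ->] h0] := sup_adherent e0 hA.
exists s0 => s us sub.
have -> : \sum_(i <- s) (b i)%:C = (\sum_(i <- s) b i)%:C by rewrite rmorph_sum.
rewrite -rmorphB normC_real distrC ger0_norm.
  by have := sum_subset _ _ _ b0 u0 us sub; lra.
rewrite subr_ge0; apply: ub_le_sup; [exact: hA.2 | by exists s].
Qed.

Lemma bsum_le b b' K : (forall i, b i <= b' i) -> bsum b' K -> bsum b K.
Proof. by move=> bb bK s us; apply: le_trans (bK s us); apply: ler_sum. Qed.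

Lemma bsumZ b K k : 0 <= k -> bsum b K -> bsum (fun i => k * b i) (k * K).
Proof. by move=> k0 bK s us; rewrite -big_distrr /= ler_wpM2l // bK. Qed.

(** For k = Re or Im the family k(f i) + |f i| is nonnegative and at most 2|f i|, so it has a sum as
    a supremum; the sum of |f i| is then subtracted. *)
Lemma has_sum_exists f K : bsum (fun i => normC (f i)) K -> exists S, has_sum f S.
Proof.
move=> bK.
have bK2 : bsum (fun i => 2 * normC (f i)) (2 * K) by exact: bsumZ.
have [N NP] := has_sum_real _ _ (fun i => normC_ge0 (f i)) bK.
have shifted (k : R[i] -> R) : (forall z, `|k z| <= normC z) ->
    exists S, has_sum (fun i => (k (f i))%:C) S.
  move=> kn.
  have kn' i : - normC (f i) <= k (f i) <= normC (f i) by rewrite -ler_norml.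
  have [i| |S SP] := has_sum_real (fun i => k (f i) + normC (f i)) (2 * K).
  - by have := kn' i; lra.
  - by apply: bsum_le bK2 => i; have := kn' i; lra.
  exists (S - N); have := has_sumB _ _ _ _ SP NP; congr has_sum.
  by apply/funext => i; rewrite rmorphD addrK.
have [A AP] := shifted (@complex.Re R) normC_Re; have [B BP] := shifted (@complex.Im R) normC_Im.
exists (A + 'i * B); have := has_sumD _ _ _ _ AP (has_sumZ 'i _ _ BP).
by congr has_sum; apply/funext => i; rewrite -complexE.
Qed.

Definition sumC f : R[i] := xget 0 [set S | has_sum f S].

Lemma sumCP f K : bsum (fun i => normC (f i)) K -> has_sum f (sumC f).
Proof. by move=> /has_sum_exists[S SP]; rewrite /sumC; case: xgetP => [//|/(_ S)]. Qed.

Lemma sumCE f S : has_sum f S -> sumC f = S.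
Proof.
move=> fS; rewrite /sumC; case: xgetP => [T _ fT|/(_ S)//].
exact: has_sum_unique fT fS.
Qed.

End Basic.
Arguments sumC {I}.


Lemma bsum_inj (I J : eqType) (g : I -> J) (b : J -> R) K :
  injective g -> bsum b K -> bsum (fun i => b (g i)) K.
Proof. by move=> gi bK s us; rewrite -(big_map g predT b); apply: bK; rewrite map_inj_uniq. Qed.

Lemma bsum_prod (I J : eqType) (b : I -> R) (c : J -> R) K L :
  (forall i, 0 <= b i) -> (forall j, 0 <= c j) -> bsum b K -> bsum c L ->
  bsum (fun ij : I * J => b ij.1 * c ij.2) (K * L).
Proof.
move=> b0 c0 bK cL s us.
pose s1 := undup (map fst s); pose s2 := undup (map snd s).
apply: (@le_trans _ _ (\sum_(ij <- [seq (i, j) | i <- s1, j <- s2]) b ij.1 * c ij.2)).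
  apply: sum_subset => //.
  - by move=> ij; rewrite mulr_ge0.
  - by rewrite allpairs_uniq ?undup_uniq // => -[? ?] [? ?].
  - move=> [i j] h; apply/allpairsP; exists (i, j).
    by split; rewrite // mem_undup; [exact: (map_f fst h) | exact: (map_f snd h)].
rewrite big_allpairs /= .
under eq_bigr do rewrite -big_distrr /=.
rewrite -big_distrl /=; apply: ler_pM; rewrite ?sumr_ge0 //.
  by apply: bK; exact: undup_uniq.
by apply: cL; exact: undup_uniq.
Qed.

(** By telescoping: 1/(n + 2)^2 <= 1/(n + 1) - 1/(n + 2). *)
Lemma bsum_nat : bsum (fun n : nat => ((1 + n%:R) ^+ 2)^-1 : R) 2.
Proof.
move=> s us.
have b0 (n : nat) : 0 <= ((1 + n%:R) ^+ 2)^-1 :> R by rewrite invr_ge0 sqr_ge0.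
pose N := (\max_(i <- s) i).+1.
apply: (@le_trans _ _ (\sum_(i <- iota 0 N) ((1 + i%:R) ^+ 2)^-1)).
  apply: sum_subset => //; first exact: iota_uniq.
  by move=> i h; rewrite mem_iota add0n ltnS /=; apply: leq_bigmax_seq.
have : forall n, \sum_(i <- iota 0 n.+1) ((1 + i%:R) ^+ 2)^-1 <= 2 - (1 + n%:R)^-1 :> R.
  elim=> [|n ih].
    by rewrite /= big_seq1 addr0 expr1n invr1; lra.
  rewrite -[n.+2]addn1 iotaD big_cat big_seq1 add0n.
  apply: le_trans (lerD ih (lexx _)) _.
  have n0 : 0 <= n%:R :> R by [].
  rewrite -[n.+1%:R]natr1; set x : R := n%:R in n0 *.
  have -> : 2 - (1 + x)^-1 + ((1 + (x + 1)) ^+ 2)^-1 =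
     2 - (1 + (x + 1))^-1 - ((1 + x) * (1 + (x + 1)) ^+ 2)^-1.
    by field; apply/andP; split; apply/eqP; lra.
  by rewrite gerBl invr_ge0 mulr_ge0 ?sqr_ge0 //; lra.
move=> /(_ (\max_(i <- s) i)%N) h; apply: le_trans h _.
by rewrite gerBl invr_ge0 addr_ge0.
Qed.

Definition absr (z : int) : R := (absz z)%:R.

Lemma bsum_int : bsum (fun z : int => ((1 + absr z) ^+ 2)^-1) 4.
Proof.
have b0 (n : nat) : 0 <= ((1 + n%:R) ^+ 2)^-1 :> R by rewrite invr_ge0 sqr_ge0.
have h1 : bsum (fun b : bool => 1 : R) 2.
  move=> s us; rewrite big_const_seq count_predT iter_addr_0.
  by rewrite -[leRHS]/(2%:R) ler_nat -(card_uniqP us) -card_bool max_card.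
have h := bsum_prod _ _ _ _ _ _ (fun _ => ler01) b0 h1 bsum_nat.
have := bsum_inj _ _ (fun z : int => (z < 0, absz z)) _ _ _ h.
have -> : 2 * 2 = 4 :> R by ring.
move=> H; apply: bsum_le (H _) => [z|]; first by rewrite mul1r.
by case=> [m|m] [n|n] //= -[->].
Qed.

Definition norm1 (u : 'rV[int]_2) : R := absr (u 0 0) + absr (u 0 1).

Lemma norm1_ge0 u : 0 <= norm1 u.
Proof. by rewrite addr_ge0 // ler0n. Qed.

(** (1 + |a| + |b|)^4 dominates (1 + |a|)^2 (1 + |b|)^2, which reduces the sum over Z^2 to a product
    of two sums over Z. *)
Lemma bsum_rV2 : bsum (fun u : 'rV[int]_2 => ((1 + norm1 u) ^+ 4)^-1) 16.
Proof.
have b0 (z : int) : 0 <= ((1 + absr z) ^+ 2)^-1 by rewrite invr_ge0 sqr_ge0.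
have h := bsum_prod _ _ _ _ _ _ b0 b0 bsum_int bsum_int.
have := bsum_inj _ _ (fun u : 'rV[int]_2 => (u 0 0, u 0 1)) _ _ _ h.
have -> : 4 * 4 = 16 :> R by ring.
move=> H; apply: bsum_le (H _) => [u|].
  rewrite /= -invfM /norm1.
  have a0 : 0 <= absr (u 0 0) by exact: ler0n.
  have a1 : 0 <= absr (u 0 1) by exact: ler0n.
  set x := absr _ in a0 *; set y := absr _ in a1 *.
  rewrite lef_pV2 ?posrE ?exprn_gt0 ?mulr_gt0 ?exprn_gt0; try lra.
  rewrite (_ : (1 + (x + y)) ^+ 4 = (1 + (x + y)) ^+ 2 * (1 + (x + y)) ^+ 2); last by ring.
  by apply: ler_pM; rewrite ?sqr_ge0 // ler_pXn2r // ?nnegrE; lra.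
move=> u v [e0 e1]; apply/rowP => j.
by case: j => [[|[|j]] hj] //; [move: e0|move: e1]; congr (_ = _); congr (_ _ _); apply/val_inj.
Qed.

Lemma has_sum_differentiable (I : eqType) (f : I -> C2 R -> R[i]^o) (b : I -> R) (K r : R)
    (F : C2 R -> R[i]^o) (x y : R[i]^o) : 0 < r -> (forall i, 0 <= b i) -> bsum b K ->
  (forall i, bounded_holo2 (f i) x y r (b i)) ->
  (forall x' y' : R[i]^o, normC (x' - x) < r -> normC (y' - y) < r ->
     has_sum (fun i => f i (x', y')) (F (x', y'))) ->
  differentiable F (x, y).
Proof.
move=> r0 b0 bK fP FP.
have bK8 k : 0 <= k -> bsum (fun i => k * b i) (k * K) by move=> k0; exact: bsumZ.
have K0 : 0 <= K by have := bK [::] isT; rewrite big_nil.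
have /choice[l1 {}lP] : forall i, exists l1, exists l2,
  [/\ normC l1 <= 8 * b i / r, normC l2 <= 8 * b i / r & forall h k : R[i],
    normC h < r / 4 -> normC k < r / 4 ->
    normC (f i (x + h, y + k) - f i (x, y) - (l1 * h + l2 * k)) <=
      2048 * b i / r ^+ 2 * (normC h + normC k) ^+ 2].
  by move=> i; exact: second_order2.
have /choice[l2 {}lP] := lP.
have r80 : 0 <= 8 / r by rewrite divr_ge0 // ltW.
have [L1 L1P] : exists S, has_sum l1 S.
  apply: (has_sum_exists _ _ (8 / r * K)); apply: bsum_le (bK8 _ r80) => i.
  by rewrite mulrAC; case: (lP i).
have [L2 L2P] : exists S, has_sum l2 S.
  apply: (has_sum_exists _ _ (8 / r * K)); apply: bsum_le (bK8 _ r80) => i.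
  by rewrite mulrAC; case: (lP i).
have r40 : 0 < r / 4 by rewrite divr_gt0.
have c0 : 0 <= 2048 / r ^+ 2 by apply: divr_ge0; [exact: ler0n | exact: sqr_ge0].
apply: (differentiable_second_order _ _ L1 L2 (r / 4) (2048 / r ^+ 2 * K) r40).
  exact: mulr_ge0.
move=> h k hr kr /=.
have -> : 2048 / r ^+ 2 * K * (normC h + normC k) ^+ 2 =
  (2048 / r ^+ 2 * (normC h + normC k) ^+ 2) * K by ring.
have s0 : has_sum (fun i => f i (x, y)) (F (x, y)) by apply: FP; rewrite subrr normC0.
have s1 : has_sum (fun i => f i (x + h, y + k)) (F (x + h, y + k)).
  by apply: FP; rewrite addrC addKr; lra.
have s2 := has_sumD _ _ _ _ _ (has_sumZ _ h _ _ L1P) (has_sumZ _ k _ _ L2P).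
have := has_sumB _ _ _ _ _ (has_sumB _ _ _ _ _ s1 s0) s2.
rewrite [h * L1]mulrC [k * L2]mulrC; apply: has_sum_norm.
apply: bsum_le (bK8 _ _) => [i|]; last by apply: mulr_ge0; [exact: c0 | exact: sqr_ge0].
have [_ _ /(_ h k hr kr)] := lP i.
rewrite [h * _]mulrC [k * _]mulrC => H; apply: le_trans H _.
by rewrite le_eqVlt; apply/orP; left; apply/eqP; ring.
Qed.

End Sums.

Arguments bsum {R I}.
Arguments has_sum {R I}.
Arguments sumC {R I}.

(** * The Jacobi group and its action *)

Section SL2.
Implicit Types (M N : SL2Z) (u x : 'rV[int]_2) (l : int).

Lemma ord2P (P : 'I_2 -> Prop) : P 0 -> P 1 -> forall i, P i.
Proof.
move=> P0 P1 [[|[|i]] hi] //.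
  by have -> : Ordinal hi = 0 by apply/val_inj.
by have -> : Ordinal hi = 1 by apply/val_inj.
Qed.

Lemma SL2Z_eq M N : val M 0 0 = val N 0 0 -> val M 0 1 = val N 0 1 ->
  val M 1 0 = val N 1 0 -> val M 1 1 = val N 1 1 -> M = N.
Proof.
move=> h00 h01 h10 h11; apply/val_inj/matrixP.
by apply: ord2P; apply: ord2P.
Qed.

Lemma rV2_eq u x : u 0 0 = x 0 0 -> u 0 1 = x 0 1 -> u = x.
Proof. by move=> h0 h1; apply/rowP; apply: ord2P. Qed.

Lemma sum_ord2 (V : nmodType) (F : 'I_2 -> V) : \sum_i F i = F 0 + F 1.
Proof. by rewrite !big_ord_recl big_ord0 addr0; congr (_ + F _); apply/val_inj. Qed.

Lemma mulmx2E m n (A : 'M[int]_(m, 2)) (B : 'M[int]_(2, n)) i j :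
  (A *m B) i j = A i 0 * B 0 j + A i 1 * B 1 j.
Proof. by rewrite mxE sum_ord2. Qed.

Lemma det_SL2Z M : val M 0 0 * val M 1 1 - val M 0 1 * val M 1 0 = 1.
Proof.
have /eqP := valP M; rewrite (expand_det_row _ 0) sum_ord2 /cofactor !det_mx11 !mxE /=.
have -> : lift 0 0 = 1 :> 'I_2 by apply/val_inj.
have -> : lift 1 0 = 0 :> 'I_2 by apply/val_inj.
by rewrite /= expr0 expr1 mul1r mulN1r mulrN.
Qed.

Definition mx2 (a b c d : int) : 'M[int]_2 :=
  \matrix_(i, j) (if i == 0 then if j == 0 then a else b else if j == 0 then c else d).

Lemma det_mx2 a b c d : a * d - b * c == 1 -> \det (mx2 a b c d) == 1.
Proof.
move=> /eqP h; rewrite (expand_det_row _ 0) sum_ord2 /cofactor !det_mx11 !mxE /=.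
by rewrite expr0 expr1 mul1r mulN1r mulrN h.
Qed.

Definition SL2Z_T : SL2Z := exist _ (mx2 0 (-1) 1 0) (det_mx2 0 (-1) 1 0 isT).
Definition SL2Z_Tinv : SL2Z := exist _ (mx2 0 1 (-1) 0) (det_mx2 0 1 (-1) 0 isT).
Definition SL2Z_N : SL2Z := exist _ (mx2 (-1) 0 0 (-1)) (det_mx2 (-1) 0 0 (-1) isT).

Lemma SL2Z_mul1 M : SL2Z_mul SL2Z_I M = M.
Proof. by apply/val_inj; rewrite /= mul1mx. Qed.

Lemma SL2Z_mulr1 M : SL2Z_mul M SL2Z_I = M.
Proof. by apply/val_inj; rewrite /= mulmx1. Qed.

Ltac sl2 := apply: SL2Z_eq; rewrite /= ?mulmx2E ?mxE /= ?mulmx2E ?mxE /=.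

Lemma SL2Z_upperD k l : SL2Z_mul (SL2Z_upper k) (SL2Z_upper l) = SL2Z_upper (k + l).
Proof. by sl2; ring. Qed.

Lemma SL2Z_upper0 : SL2Z_upper 0 = SL2Z_I.
Proof. by sl2. Qed.

Lemma SL2Z_TT : SL2Z_mul SL2Z_T SL2Z_T = SL2Z_N. Proof. by sl2. Qed.
Lemma SL2Z_NN : SL2Z_mul SL2Z_N SL2Z_N = SL2Z_I. Proof. by sl2. Qed.
Lemma SL2Z_STSTST : let ST := SL2Z_mul SL2Z_S SL2Z_T in
  SL2Z_mul ST (SL2Z_mul ST ST) = SL2Z_N.
Proof. by move=> ST; sl2. Qed.

(** Induction along the Euclidean algorithm on the first column. The row (c,d) of N is the top row
    of M; the two inequalities say that passing from N to M lowers |c| by at least 1 and raises |d|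
    by at most 1, so |c| + |d| does not grow. *)
Lemma SL2Z_euclid (P : SL2Z -> Prop) :
  (forall M, val M 1 0 = 0 -> P M) ->
  (forall l M, let N := SL2Z_mul (SL2Z_upper l) (SL2Z_mul SL2Z_T M) in
    val N 1 0 = val M 0 0 -> val N 1 1 = val M 0 1 ->
    (absz (val M 1 0)%R < absz (val M 0 0)%R)%N ->
    (absz (val M 1 1)%R <= (absz (val M 0 1)%R).+1)%N -> P M -> P N) ->
  forall M, P M.
Proof.
move=> P0 PS M; move: {2}(absz _) (leqnn (absz (val M 1 0)%R)) => n; elim: n M => [|n ih] M hn.
  by apply: P0; apply/eqP; rewrite -absz_eq0 -leqn0.
have [/P0//|c0] := eqVneq (val M 1 0) 0.
(* With [l] the quotient of a by c, the lower left entry of T^-1 S^-l M is minus the remainder. *)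
pose l := ((val M 0 0)%R %/ (val M 1 0)%R)%Z.
pose K := SL2Z_mul SL2Z_Tinv (SL2Z_mul (SL2Z_upper (- l)) M).
have K00 : val K 0 0 = val M 1 0 by rewrite /= ?mulmx2E ?mxE /= ?mulmx2E ?mxE /=; ring.
have K01 : val K 0 1 = val M 1 1 by rewrite /= ?mulmx2E ?mxE /= ?mulmx2E ?mxE /=; ring.
have K10 : val K 1 0 = - ((val M 0 0)%R %% (val M 1 0)%R)%Z.
  by rewrite /modz /= ?mulmx2E ?mxE /= ?mulmx2E ?mxE /= -/l; ring.
have lt10 : (absz (val K 1 0)%R < absz (val K 0 0)%R)%N.
  rewrite K10 K00 abszN -ltz_nat gez0_abs ?modz_ge0 //.
  by rewrite ?abszE ltz_mod.
have ME : M = SL2Z_mul (SL2Z_upper l) (SL2Z_mul SL2Z_T K).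
  by sl2; rewrite ?mulmx2E ?mxE /= ?mulmx2E ?mxE /=; ring.
rewrite ME; apply: PS => //.
- by rewrite -ME K00.
- by rewrite -ME K01.
(* With rows (c,d) and (c',d') of [K]: cd' = 1 + dc' and |c'| < |c| give |d'| <= |d| + 1. *)
- have := det_SL2Z K; move: (val K 0 0) (val K 0 1) (val K 1 0) (val K 1 1) lt10.
  clear; move=> c d c' d' lt; nia.
- by apply: ih; rewrite -ltnS (leq_trans _ hn) // -K00.
Qed.

Lemma SL2Z_c0 M : val M 1 0 = 0 -> exists l, M = SL2Z_upper l \/ M = SL2Z_mul (SL2Z_upper l) SL2Z_N.
Proof.
move=> c0; have := det_SL2Z M; rewrite c0 mulr0 subr0 => ad.
have [[a1 d1]|[a1 d1]] : (val M 0 0 = 1 /\ val M 1 1 = 1) \/ (val M 0 0 = -1 /\ val M 1 1 = -1).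
  move: ad; move: (val M 0 0) (val M 1 1) => a d ad.
  have /eqP : absz (a * d) = 1%N by rewrite ad.
  rewrite abszM muln_eq1 => /andP[/eqP a1 /eqP d1].
  have [aE|aE] : a = 1 \/ a = -1 by clear - a1; lia.
    by left; split=> //; rewrite aE mul1r in ad.
  by right; split=> //; rewrite aE mulN1r in ad; rewrite -ad opprK.
- by exists (val M 0 1); left; sl2.
- by exists (- val M 0 1); right; sl2; rewrite ?c0 ?a1 ?d1; ring.
Qed.

Definition bot M : 'rV[int]_2 := row 1 (val M).

Lemma bot_mul M N : bot (SL2Z_mul M N) = bot M *m val N.
Proof. by rewrite /bot /= row_mul. Qed.

Lemma det_SL2Z_inv M : val M 1 1 * val M 0 0 - (- val M 0 1) * (- val M 1 0) == 1.
Proof. by rewrite mulrNN [val M 1 1 * _]mulrC det_SL2Z. Qed.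

Definition SL2Z_inv M : SL2Z := exist (fun A => \det A == 1) _ (det_mx2 _ _ _ _ (det_SL2Z_inv M)).

Lemma SL2Z_mulV M : SL2Z_mul M (SL2Z_inv M) = SL2Z_I.
Proof. by have /= h := det_SL2Z M; sl2; [apply: etrans h|..|apply: etrans h]; ring. Qed.

Lemma SL2Z_mulVl M : SL2Z_mul (SL2Z_inv M) M = SL2Z_I.
Proof. by have /= h := det_SL2Z M; sl2; [apply: etrans h|..|apply: etrans h]; ring. Qed.

(** N M^-1 has bottom row (0,1), hence is S^l with [l] its upper right entry. Thus the cosets of <S>
    in SL_2(Z) correspond to their bottom rows. *)
Lemma bot_eq M N : bot M = bot N -> exists l, N = SL2Z_mul (SL2Z_upper l) M.
Proof.
move=> MN.
have e0 : val M 1 0 = val N 1 0 by have := congr1 (fun u : 'rV_2 => u 0 0) MN; rewrite !mxE.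
have e1 : val M 1 1 = val N 1 1 by have := congr1 (fun u : 'rV_2 => u 0 1) MN; rewrite !mxE.
have dM := det_SL2Z M; have dN := det_SL2Z N; rewrite -e0 -e1 in dN.
exists (val M 0 0 * val N 0 1 - val M 0 1 * val N 0 0).
have k0 : val N 0 0 = val M 0 0 + (val M 0 0 * val N 0 1 - val M 0 1 * val N 0 0) * val M 1 0.
  have : val N 0 0 * (val M 0 0 * val M 1 1 - val M 0 1 * val M 1 0) -
    val M 0 0 * (val N 0 0 * val M 1 1 - val N 0 1 * val M 1 0) =
    (val M 0 0 * val N 0 1 - val M 0 1 * val N 0 0) * val M 1 0 by ring.
  by rewrite dM dN !mulr1 => <-; rewrite addrC subrK.
have k1 : val N 0 1 = val M 0 1 + (val M 0 0 * val N 0 1 - val M 0 1 * val N 0 0) * val M 1 1.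
  have : val N 0 1 * (val M 0 0 * val M 1 1 - val M 0 1 * val M 1 0) -
    val M 0 1 * (val N 0 0 * val M 1 1 - val N 0 1 * val M 1 0) =
    (val M 0 0 * val N 0 1 - val M 0 1 * val N 0 0) * val M 1 1 by ring.
  by rewrite dM dN !mulr1 => <-; rewrite addrC subrK.
move: (_ - _) k0 k1 => l /= k0 k1.
sl2; rewrite -?e0 -?e1 ?mul0r ?mul1r ?add0r //.
Qed.

End SL2.

Section Action.
Context {R : realType}.
Implicit Types (u x : 'rV[int]_2) (tau z : R[i]) (M : SL2Z) (g : jacobi).

Lemma ReV z : Re z^-1 = Re z / normC z ^+ 2.
Proof. by rewrite normC_sqr; case: z. Qed.

Lemma ImV z : Im z^-1 = - Im z / normC z ^+ 2.
Proof. by rewrite normC_sqr mulNr; case: z. Qed.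

Lemma intrC (n : int) : n%:~R = (n%:~R : R)%:C :> R[i].
Proof. by rewrite rmorph_int. Qed.

Lemma Re_intr (n : int) : Re (n%:~R : R[i]) = n%:~R. Proof. by rewrite intrC. Qed.
Lemma Im_intr (n : int) : Im (n%:~R : R[i]) = 0. Proof. by rewrite intrC. Qed.

Lemma normr_absr (n : int) : `|n%:~R : R| = absr n.
Proof. by rewrite /absr -intr_norm -abszE. Qed.

Lemma normC_intr (n : int) : normC (n%:~R : R[i]) = absr n.
Proof. by rewrite intrC normC_real normr_absr. Qed.

(** One linear form serves for c tau + d, for a tau + b and for lambda tau + mu; under the action
    all of them transform through right multiplication of the row ([lin_act]). *)
Definition lin u tau : R[i] := (u 0 0)%:~R * tau + (u 0 1)%:~R.

Lemma Re_lin u tau : Re (lin u tau) = (u 0 0)%:~R * Re tau + (u 0 1)%:~R.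
Proof. by rewrite /lin ReD ReM !Re_intr Im_intr mul0r subr0. Qed.

Lemma Im_lin u tau : Im (lin u tau) = (u 0 0)%:~R * Im tau.
Proof. by rewrite /lin ImD ImM !Im_intr Re_intr mul0r !addr0. Qed.

Lemma linD u x tau : lin (u + x) tau = lin u tau + lin x tau.
Proof. by rewrite /lin !mxE !rmorphD /=; ring. Qed.

Lemma lin_neq0 u tau : 0 < Im tau -> u != 0 -> lin u tau != 0.
Proof.
move=> v0; apply: contra_neq => h.
have /eqP := congr1 (@complex.Im R) h; rewrite Im_lin /= mulf_eq0 intr_eq0 (gt_eqF v0) orbF => /eqP u0.
have /eqP := congr1 (@complex.Re R) h; rewrite Re_lin u0 mul0r add0r /= intr_eq0 => /eqP u1.
by apply: rV2_eq; rewrite mxE.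
Qed.

Lemma bot_neq0 M : bot M != 0.
Proof.
apply/eqP => h; have := det_SL2Z M.
have -> : val M 1 0 = 0 by have := congr1 (fun u : 'rV_2 => u 0 0) h; rewrite !mxE.
have -> : val M 1 1 = 0 by have := congr1 (fun u : 'rV_2 => u 0 1) h; rewrite !mxE.
by rewrite !mulr0 subr0.
Qed.

Lemma denE g tau : jc g * tau + jd g = lin (bot g.1) tau.
Proof. by rewrite /lin /bot !mxE. Qed.

Lemma numE g tau : ja g * tau + jb g = lin (row 0 (val g.1)) tau.
Proof. by rewrite /lin !mxE. Qed.

Lemma den_neq0 g tau : 0 < Im tau -> jc g * tau + jd g != 0.
Proof. by move=> v0; rewrite denE lin_neq0 // bot_neq0. Qed.

Lemma lin_act u g (p : C2 R) : HxC p ->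
  lin u (jacobi_act g p).1 = lin (u *m val g.1) p.1 / lin (bot g.1) p.1.
Proof.
case: p => tau z v0; have d0 := den_neq0 g _ v0.
rewrite -denE /lin !mulmx2E /= !rmorphD !rmorphM /= -/(ja g) -/(jb g) -/(jc g) -/(jd g).
by field.
Qed.

Lemma Im_act g (p : C2 R) : HxC p ->
  Im (jacobi_act g p).1 = Im p.1 / normC (lin (bot g.1) p.1) ^+ 2.
Proof.
case: p => tau z v0; have d0 := den_neq0 g _ v0.
rewrite /jacobi_act denE numE.
have n0 : normC (lin (bot g.1) tau) != 0 by rewrite normC_eq0 -denE.
rewrite ImM ReV ImV.
suff -> : Im tau = Im (lin (row 0 (val g.1)) tau) * Re (lin (bot g.1) tau) -
    Re (lin (row 0 (val g.1)) tau) * Im (lin (bot g.1) tau) by field.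
rewrite !Im_lin !Re_lin !mxE.
have /(congr1 (fun n : int => n%:~R : R)) := det_SL2Z g.1.
rewrite rmorphB !rmorphM /= rmorph1 => h.
by rewrite -[LHS]mul1r -[in LHS]h; ring.
Qed.

Lemma HxC_act g (p : C2 R) : HxC p -> HxC (jacobi_act g p).
Proof.
move=> hp; rewrite /HxC /= Im_act // divr_gt0 // exprn_gt0 // normC_gt0.
by rewrite lin_neq0 // bot_neq0.
Qed.

Lemma act_snd g (p : C2 R) : (jacobi_act g p).2 = (p.2 + lin g.2 p.1) / lin (bot g.1) p.1.
Proof. by case: p => tau z; rewrite /= denE /lin /jlambda /jmu addrA. Qed.

Lemma act_fst g (p : C2 R) : (jacobi_act g p).1 = lin (row 0 (val g.1)) p.1 / lin (bot g.1) p.1.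
Proof. by case: p => tau z; rewrite /= denE numE. Qed.

Lemma jacobi_act_mul g1 g2 (p : C2 R) : HxC p ->
  jacobi_act (jacobi_mul g1 g2) p = jacobi_act g1 (jacobi_act g2 p).
Proof.
move=> hp; have hp2 := HxC_act g2 p hp.
have n2 : lin (bot g2.1) p.1 != 0 by rewrite lin_neq0 // bot_neq0.
have n12 : lin (bot g1.1 *m val g2.1) p.1 != 0.
  by rewrite -bot_mul lin_neq0 // bot_neq0.
apply: (@injective_projections).
  rewrite [LHS]act_fst [RHS]act_fst !lin_act // -bot_mul /jacobi_mul /= row_mul bot_mul.
  by field; rewrite n2 n12.
rewrite !act_snd !lin_act // /jacobi_mul /= bot_mul linD.
by field; rewrite n2 n12.
Qed.

Section Norm.
Variables r m : R.

(* |f| * weight is invariant under the slash action. *)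
Definition weight (p : C2 R) : R :=
  expR (r / 2 * ln (Im p.1) - 2 * pi * m * (Im p.2 ^+ 2 / Im p.1)).

Lemma weight_gt0 p : 0 < weight p.
Proof. exact: expR_gt0. Qed.

Lemma Re_logC z : Re (logC z) = ln (normC z). Proof. by []. Qed.

(* Both sides are exponents of weight and of the automorphy factor, divided by
   -2 pi m; Z / D is the second coordinate of the image point. *)
Lemma cocycle_exponent (c d l k u v x y : R) : v != 0 -> (c * u + d) ^+ 2 + (c * v) ^+ 2 != 0 ->
  let tau := u +i* v in let z := x +i* y in let D := c%:C * tau + d%:C in
  let Z := z + l%:C * tau + k%:C in
  Im (- (c%:C * Z ^+ 2 / D) + l%:C ^+ 2 * tau + 2 * l%:C * z + l%:C * k%:C) + y ^+ 2 / v =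
  Im (Z / D) ^+ 2 / (v / normC D ^+ 2).
Proof.
move=> v0 n0 tau z D Z.
have ReD' : Re D = c * u + d by rewrite /D ReD ReM /= mul0r subr0.
have ImD' : Im D = c * v by rewrite /D ImD ImM /= mul0r !addr0.
have ReZ : Re Z = x + l * u + k by rewrite /Z !ReD ReM /= mul0r subr0.
have ImZ : Im Z = y + l * v by rewrite /Z !ImD ImM /= mul0r !addr0.
have two : (2 : R[i]) = (2 : R)%:C by rewrite rmorphMn.
rewrite [Z ^+ 2]expr2 [l%:C ^+ 2]expr2 !ImD ImN !(ImM, ReM, ImV, ReV) two normC_sqr ReD' ImD' ReZ ImZ /=.
by field; rewrite v0 n0.
Qed.

(** The modulus does not see the branch of the power: |(c tau + d)^-r| = |c tau + d|^-r, which is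
    the change of v^(r/2). The exponential factors match by [cocycle_exponent]. *)
Lemma weight_act g (p : C2 R) : HxC p ->
  normC (automorphy r m g p) * weight p = weight (jacobi_act g p).
Proof.
move=> hp; have hp' := HxC_act g p hp.
have D0 : lin (bot g.1) p.1 != 0 by rewrite lin_neq0 // bot_neq0.
rewrite /weight Im_act //; case: p hp hp' D0 => tau z hp hp' D0.
have v0 : 0 < Im tau by [].
have n0 : 0 < normC (lin (bot g.1) tau) by rewrite normC_gt0.
rewrite act_snd /automorphy normCM !normC_expC -!expRD denE.
congr expR; rewrite ReM Re_logC /= mul0r subr0.
rewrite ln_div ?posrE ?exprn_gt0 // lnXn //.
set L := ln (normC _).
have -> (X : R[i]) : Re (2 * pi%:C * 'i * m%:C * X) = - (2 * pi * m) * Im X.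
  have -> : 2 * pi%:C * 'i * m%:C = 0 +i* (2 * pi * m) :> R[i].
    have -> : (2 : R[i]) = (2 : R)%:C by rewrite rmorphMn.
    by apply/eqP; rewrite eq_complex /=; apply/andP; split; apply/eqP; ring.
  by rewrite ReM /= mul0r sub0r mulNr.
have := @cocycle_exponent (val g.1 1 0)%:~R (val g.1 1 1)%:~R (g.2 0 0)%:~R (g.2 0 1)%:~R
  (Re tau) (Im tau) (Re z) (Im z) (lt0r_neq0 v0).
have nE : ((val g.1 1 0)%:~R * Re tau + (val g.1 1 1)%:~R) ^+ 2 + ((val g.1 1 0)%:~R * Im tau) ^+ 2 =
    normC (lin (bot g.1) tau) ^+ 2.
  by rewrite normC_sqr Re_lin Im_lin !mxE.
rewrite nE => /(_ (lt0r_neq0 (exprn_gt0 2 n0))).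
have tauE : Re tau +i* Im tau = tau by case: (tau).
have zE : Re z +i* Im z = z by case: (z).
cbv zeta; rewrite tauE zE -!intrC.
rewrite -/(jc g) -/(jd g) -/(jlambda g) -/(jmu g) denE.
have -> : z + jlambda g * tau + jmu g = z + lin g.2 tau by rewrite /lin addrA.
set E1 := Im (_ + _); set E2 := _ / (Im tau / _) => h.
have -> : E1 = E2 - Im z ^+ 2 / Im tau by rewrite -h addrK.
move: (_ / Im tau) => y2; clearbody E2 L; rewrite mulr2n; by field.
Qed.

End Norm.
End Action.

(** * Growth of cocycles *)

Section Growth.
Context {R : realType}.
Variables (r m : R) (omega : jacobi -> R[i]).
Hypothesis homega : multiplier_system r m omega.
Implicit Types (u x : 'rV[int]_2) (M : SL2Z) (g : jacobi) (p : C2 R).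

Definition jM M : jacobi := (M, 0).
Definition jX x : jacobi := (SL2Z_I, x).
Definition jacobi1 : jacobi := jM SL2Z_I.

Lemma jM_mul M N : jacobi_mul (jM M) (jM N) = jM (SL2Z_mul M N).
Proof. by rewrite /jacobi_mul /jM /= mul0mx addr0. Qed.

Lemma jX_mul x y : jacobi_mul (jX x) (jX y) = jX (x + y).
Proof. by rewrite /jacobi_mul /jX /= mulmx1 SL2Z_mul1. Qed.

Lemma jMX g : g = jacobi_mul (jM g.1) (jX g.2).
Proof. by case: g => M x; rewrite /jacobi_mul /jM /jX /= mul0mx add0r SL2Z_mulr1. Qed.

Lemma jacobi_mul1 g : jacobi_mul jacobi1 g = g.
Proof. by case: g => M x; rewrite /jacobi_mul /jacobi1 /jM /= mul0mx add0r SL2Z_mul1. Qed.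

Definition base_point : C2 R := ('i, 0).

Lemma HxC_base : HxC base_point.
Proof. exact: ltr01. Qed.

Definition chi g : R := normC (omega g).

Lemma chi_gt0 g : 0 < chi g.
Proof. by rewrite normC_gt0; case: homega. Qed.

(** By [weight_act] the modulus of the automorphy factor is a ratio of weights, hence satisfies the
    cocycle relation exactly; it cancels from the defining relation of omega, read at (i, 0). *)
Lemma chi_mul g1 g2 : chi (jacobi_mul g1 g2) = chi g1 * chi g2.
Proof.
have hp := HxC_base; have hp2 := HxC_act g2 _ hp.
have /(congr1 (@normC R)) := homega.2 g1 g2 _ hp; rewrite (normCM (omega (jacobi_mul _ _))) (normCM (omega g1 * omega g2 * _)) (normCM (omega g1 * omega g2)) (normCM (omega g1)).
have w0 := weight_gt0 r m base_point.
have w2 := weight_gt0 r m (jacobi_act g2 base_point).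
have w12 := weight_gt0 r m (jacobi_act (jacobi_mul g1 g2) base_point).
have := weight_act r m (jacobi_mul g1 g2) _ hp.
have := weight_act r m g2 _ hp.
have := weight_act r m g1 _ hp2.
rewrite -jacobi_act_mul // -/(chi _) -/(chi g1) -/(chi g2).
set a1 := normC _; set a2 := normC _; set a12 := normC _.
set W := weight r m base_point in w0 *; set W2 := weight r m (jacobi_act g2 base_point) in w2 *.
set W12 := weight _ _ _ in w12 *.
move=> e1 e2 e12 h.
have a20 : a2 != 0 by apply: contraTneq w2 => a0; rewrite -e2 a0 mul0r ltxx.
have a10 : a1 != 0 by apply: contraTneq w12 => a0; rewrite -e1 a0 mul0r ltxx.
have E : a12 = a1 * a2.
  by apply: (mulIf (lt0r_neq0 w0)); rewrite e12 -e1 -e2 mulrA.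
move: h; rewrite E; move=> h; apply: (mulIf (mulf_neq0 a10 a20)).
by rewrite h; ring.
Qed.

Lemma pos_pow1 (x : R) n : 0 < x -> x ^+ n.+1 = 1 -> x = 1.
Proof.
by move=> x0 /eqP; rewrite pexpr_eq1 ?ltW // => /eqP.
Qed.

Lemma chi1 : chi jacobi1 = 1.
Proof.
apply: (mulIf (lt0r_neq0 (chi_gt0 jacobi1))).
by rewrite -chi_mul jacobi_mul1 mul1r.
Qed.

Lemma chi_N : chi (jM SL2Z_N) = 1.
Proof.
apply: (pos_pow1 _ 1); first exact: chi_gt0.
by rewrite expr2 -chi_mul jM_mul SL2Z_NN chi1.
Qed.

Lemma chi_T : chi (jM SL2Z_T) = 1.
Proof.
apply: (pos_pow1 _ 1); first exact: chi_gt0.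
by rewrite expr2 -chi_mul jM_mul SL2Z_TT chi_N.
Qed.

(** From (ST)^3 = -I, once T and -I are known to have value 1. *)
Lemma chi_S : chi (jM SL2Z_S) = 1.
Proof.
apply: (pos_pow1 _ 2); first exact: chi_gt0.
have /(congr1 (fun M => chi (jM M))) := SL2Z_STSTST; rewrite -!jM_mul !chi_mul chi_T chi_N => <-.
by rewrite !mulr1 !exprS expr0 mulr1.
Qed.

Lemma chi_upper l : chi (jM (SL2Z_upper l)) = 1.
Proof.
have h (n : nat) : chi (jM (SL2Z_upper n)) = 1.
  elim: n => [|n ih]; first by rewrite SL2Z_upper0 chi1.
  by rewrite -addn1 PoszD -SL2Z_upperD -jM_mul chi_mul ih chi_S mulr1.
case: (intP l) => [|n|n]; [exact: (h 0%N)|exact: h|].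
have := h n.+1; rewrite -[LHS]mul1r => e.
have : chi (jM (SL2Z_upper (- (n.+1%:Z)))) * chi (jM (SL2Z_upper n.+1)) = 1.
  by rewrite -chi_mul jM_mul SL2Z_upperD addNr SL2Z_upper0 chi1.
by rewrite (h n.+1) mulr1.
Qed.

(** Conjugation by -I turns the translation by x into that by -x, so the value at x equals its own
    inverse. *)
Lemma chi_jX x : chi (jX x) = 1.
Proof.
apply: (pos_pow1 _ 1); first exact: chi_gt0.
have e : jacobi_mul (jacobi_mul (jM SL2Z_N) (jX x)) (jM SL2Z_N) = jX (- x).
  rewrite /jacobi_mul /jM /jX /= mul0mx add0r addr0 SL2Z_mulr1 SL2Z_NN; congr pair.
  by apply: rV2_eq; rewrite mulmx2E !mxE /=; ring.
have : chi (jX (- x)) = chi (jX x) by rewrite -e !chi_mul chi_N mul1r mulr1.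
move=> h; rewrite expr2 -{1}h -chi_mul jX_mul addNr.
exact: chi1.
Qed.

Lemma chi_eq1 g : chi g = 1.
Proof.
rewrite (jMX g) chi_mul chi_jX mulr1.
elim/SL2Z_euclid: (g.1) => [M /SL2Z_c0[l [->|->]]|l M N _ _ _ _ ih].
- exact: chi_upper.
- by rewrite -jM_mul chi_mul chi_upper chi_N mulr1.
- by rewrite /N -!jM_mul !chi_mul chi_upper chi_T ih !mul1r.
Qed.

Lemma slash_weight f g p : HxC p ->
  normC (slash omega r m f g p) * weight r m p =
  normC (f (jacobi_act g p)) * weight r m (jacobi_act g p).
Proof.
move=> hp; rewrite /slash (normCM (omega g * _)) (normCM (omega g)) -/(chi g) chi_eq1 mul1r -(weight_act r m g p hp).
by ring.
Qed.

Variable phi : jacobi -> C2 R -> R[i]^o.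
Hypothesis hphi : cocycle omega r m phi.

Definition weighted_norm g p : R := normC (phi g p) * weight r m p.

Lemma Phi_mul g1 g2 p : HxC p ->
  weighted_norm (jacobi_mul g1 g2) p <= weighted_norm g1 (jacobi_act g2 p) + weighted_norm g2 p.
Proof.
move=> hp; rewrite /weighted_norm hphi.2 // -(slash_weight (phi g1)) // -mulrDl.
by rewrite ler_pM2r ?weight_gt0 // normCD.
Qed.

(* This is 2 cosh of the hyperbolic distance from i to tau. *)
Definition height (tau : R[i]) : R := (normC tau ^+ 2 + 1) / Im tau.

Lemma height_ge (tau : R[i]) : 0 < Im tau ->
  [/\ 1 <= height tau, normC tau <= height tau, (Im tau)^-1 <= height tau & Im tau <= height tau].
Proof.
move=> v0; have vn : Im tau <= normC tau := le_trans (ler_norm _) (normC_Im tau).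
have n0 := normC_ge0 tau.
have h : normC tau <= height tau.
  rewrite /height ler_pdivlMr //.
  have : 0 <= (normC tau - Im tau) * normC tau by rewrite mulr_ge0 // subr_ge0.
  have : 0 <= 1 :> R by [].
  nra.
split => //.
- rewrite /height ler_pdivlMr // mul1r.
  have := sqr_ge0 (normC tau - 1); nra.
- by rewrite /height -{1}[_^-1]mul1r ler_pM2r ?invr_gt0 // lerDr sqr_ge0.
- exact: le_trans vn h.
Qed.

Lemma powR_le_expn (b x s : R) n : 1 <= b -> 0 < x -> x <= b -> 0 <= s -> s <= n%:R -> x `^ s <= b ^+ n.
Proof.
move=> b1 x0 xb s0 sn.
have b0 : 0 <= b := le_trans ler01 b1.
apply: (@le_trans _ _ (b `^ s)); first by apply: ge0_ler_powR; rewrite // nnegrE // ltW.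
by rewrite -powR_mulrn ?(le_trans ler01) // ler_powR.
Qed.

(** [weight] cancels the exponential in the bound of P_m, and |tau|^rho, v^-sigma and v^(r/2) are
    each dominated by a power of [height]. *)
Lemma Phi_gen g : exists C A, 0 <= C /\ forall p, HxC p -> weighted_norm g p <= C * height p.1 ^+ A.
Proof.
have [_ [K [rho [sigma [K0 rho0 sigma0 bnd]]]]] := hphi.1 g.
pose n1 := Num.truncn rho; pose n2 := Num.truncn sigma; pose n3 := Num.truncn (`|r / 2|).
have t1 : rho <= n1.+1%:R by rewrite ltW // truncnS_gt.
have t2 : sigma <= n2.+1%:R by rewrite ltW // truncnS_gt.
have t3 : `|r / 2| <= n3.+1%:R by rewrite ltW // truncnS_gt.
exists (2 * K), (n1.+1 + n2.+1 + n3.+1)%N; split; first by rewrite mulr_ge0 // ltW.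
case=> tau z hp; have v0 : 0 < Im tau by [].
have [b1 bn bi bv] := height_ge _ v0.
set b := height tau in b1 bn bi bv *.
have b0 : 0 < b by exact: lt_le_trans b1.
rewrite /weighted_norm /weight /= expRD.
have e1 : normC (phi g (tau, z)) <= K * (normC tau `^ rho + Im tau `^ (- sigma)) *
        expR (2 * pi * m * Im z ^+ 2 / Im tau) by rewrite ltW // bnd.
have e2 : expR (r / 2 * ln (Im tau)) <= b ^+ n3.+1.
  rewrite -[b ^+ _]lnK ?posrE ?exprn_gt0 // ler_expR lnXn // -[ln b *+ _]mulr_natl.
  apply: le_trans (ler_norm _) _; rewrite normrM.
  apply: ler_pM => //; rewrite ler_norml; apply/andP; split; last by rewrite ler_ln ?posrE.
  rewrite lerNl -lnV ?posrE // ler_ln ?posrE ?invr_gt0 //.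
have e3 : normC tau `^ rho <= b ^+ (n1.+1 + n2.+1).
  have n0 : 0 < normC tau by exact: lt_le_trans v0 (le_trans (ler_norm _) (normC_Im tau)).
  apply: (@powR_le_expn b) => //; first exact: ltW.
  by apply: le_trans t1 _; rewrite ler_nat leq_addr.
have e4 : Im tau `^ (- sigma) <= b ^+ (n1.+1 + n2.+1).
  have -> : Im tau `^ (- sigma) = (Im tau)^-1 `^ sigma.
    by rewrite /powR !gt_eqF ?invr_gt0 // lnV ?posrE // mulrN mulNr.
  apply: (@powR_le_expn b) => //; [by rewrite invr_gt0|exact: ltW|].
  by apply: le_trans t2 _; rewrite ler_nat leq_addl.
set Y := expR (- _); have Y0 : 0 < Y by exact: expR_gt0.
have YE : expR (2 * pi * m * Im z ^+ 2 / Im tau) * Y = 1.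
  by rewrite /Y -expRD mulrA subrr expR0.
have X0 := expR_gt0 (r / 2 * ln (Im tau)); set X := expR (r / 2 * _) in e2 X0 *.
rewrite mulrCA mulrC.
apply: (@le_trans _ _ (K * (normC tau `^ rho + Im tau `^ (- sigma)) *
        expR (2 * pi * m * Im z ^+ 2 / Im tau) * Y * X)).
  by rewrite ler_pM2r // ler_pM2r.
rewrite -[_ * _ * Y]mulrA YE mulr1 exprD -mulrA.
have -> : 2 * K * (b ^+ (n1.+1 + n2.+1) * b ^+ n3.+1) = K * ((b ^+ (n1.+1 + n2.+1) + b ^+ (n1.+1 + n2.+1)) * b ^+ n3.+1) by ring.
rewrite ler_pM2l //; apply: ler_pM.
- by apply: addr_ge0; exact: powR_ge0.
- exact: ltW.
- exact: lerD.
- exact: e2.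
Qed.

End Growth.

Section CocycleGrowth.
Context {R : realType}.
Variables (r m : R) (omega : jacobi -> R[i]).
Hypothesis homega : multiplier_system r m omega.
Variable phi : jacobi -> C2 R -> R[i]^o.
Hypothesis hphi : cocycle omega r m phi.
Hypothesis hS : forall p : C2 R, HxC p -> phi (SL2Z_S, row2 0 0) p = 0.
Implicit Types (u x : 'rV[int]_2) (M : SL2Z) (g : jacobi) (p : C2 R) (l : int).
Local Notation Phi := (weighted_norm r m phi).

Lemma jacobi_act1 p : HxC p -> jacobi_act jacobi1 p = p.
Proof.
case: p => tau z hp; rewrite /jacobi_act /ja /jb /jc /jd /jlambda /jmu /= !mxE /=.
by congr pair; rewrite !(mul0r, mul1r, add0r, addr0, divr1).
Qed.

Lemma jX_act_fst x p : HxC p -> (jacobi_act (jX x) p).1 = p.1.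
Proof.
by case: p => tau z hp; rewrite /jacobi_act /ja /jb /jc /jd /= !mxE /= !(mul0r, mul1r, add0r, addr0, divr1).
Qed.

Lemma slash_eq0 f g p : HxC p -> (forall q, HxC q -> f q = 0) -> slash omega r m f g p = 0.
Proof. by move=> hp f0; rewrite /slash f0 ?mulr0 //; exact: HxC_act. Qed.

(** The cocycle relation at (1,1) gives phi_1|1 = 0. Since the slash action preserves the weighted
    modulus, phi_1 = 0 follows without evaluating omega(1) or the automorphy factor. *)
Lemma phi1 p : HxC p -> phi jacobi1 p = 0.
Proof.
move=> hp; have := hphi.2 jacobi1 jacobi1 p hp; rewrite jacobi_mul1.
rewrite -[LHS]add0r => /addIr /esym /(congr1 (@normC R)).
move=> h; have := slash_weight r m omega homega (phi jacobi1) jacobi1 p hp.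
rewrite h normC0 mul0r jacobi_act1 // => /esym /eqP.
by rewrite mulf_eq0 (gt_eqF (weight_gt0 _ _ _)) orbF normC_eq0 => /eqP.
Qed.

Lemma phi_upper l p : HxC p -> phi (jM (SL2Z_upper l)) p = 0.
Proof.
have h (n : nat) q : HxC q -> phi (jM (SL2Z_upper n)) q = 0.
  elim: n q => [|n ih] q hq; first by rewrite SL2Z_upper0 phi1.
  rewrite -addn1 PoszD -SL2Z_upperD -jM_mul hphi.2 // slash_eq0 // add0r.
  have -> : jM (SL2Z_upper 1) = (SL2Z_S, row2 0 0) by congr pair; apply: rV2_eq; rewrite !mxE.
  exact: hS.
move=> hp; case: (intP l) => [|n|n]; [exact: (h 0%N)|exact: h|].
have := hphi.2 (jM (SL2Z_upper n.+1)) (jM (SL2Z_upper (- (n.+1%:Z)))) p hp.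
rewrite jM_mul SL2Z_upperD subrr SL2Z_upper0 phi1 // slash_eq0 ?add0r //.
by move=> q hq; rewrite h.
Qed.

Lemma phi_upper_mul l g p : HxC p -> phi (jacobi_mul (jM (SL2Z_upper l)) g) p = phi g p.
Proof.
move=> hp; rewrite hphi.2 // slash_eq0 ?add0r // => q hq; exact: phi_upper.
Qed.

Lemma Phi_gens (s : seq jacobi) : exists C A, 0 <= C /\
  forall g p, g \in s -> HxC p -> Phi g p <= C * height p.1 ^+ A.
Proof.
elim: s => [|g s [C [A [C0 ih]]]]; first by exists 0, 0%N.
have [C1 [A1 [C10 h1]]] := Phi_gen r m omega phi hphi g.
exists (C + C1), (A + A1)%N; split; first exact: addr_ge0.
move=> k p ks hp; have [b1 _ _ _] := height_ge p.1 hp.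
have e1 : height p.1 ^+ A <= height p.1 ^+ (A + A1) by rewrite ler_weXn2l // leq_addr.
have e2 : height p.1 ^+ A1 <= height p.1 ^+ (A + A1) by rewrite ler_weXn2l // leq_addl.
have b0 n : 0 <= height p.1 ^+ n by rewrite exprn_ge0 // (le_trans ler01).
rewrite mulrDl; move: ks; rewrite inE => /predU1P[->|ks].
  apply: le_trans (h1 _ hp) _; apply: le_trans (ler_wpM2l C10 e2) _.
  by rewrite lerDr mulr_ge0.
apply: le_trans (ih _ _ ks hp) _; apply: le_trans (ler_wpM2l C0 e1) _.
by rewrite lerDl mulr_ge0.
Qed.

Lemma normC_lin u (tau : R[i]) : normC (lin u tau) ^+ 2 <= norm1 u ^+ 2 * (normC tau ^+ 2 + 1).
Proof.
have a0 : 0 <= absr (u 0 0) :> R by exact: ler0n.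
have a1 : 0 <= absr (u 0 1) :> R by exact: ler0n.
have n0 := normC_ge0 tau.
have h : normC (lin u tau) <= absr (u 0 0) * normC tau + absr (u 0 1).
  by rewrite /lin (le_trans (normCD _ _)) // normCM !normC_intr.
rewrite /norm1; set a := absr _ in a0 h *; set b := absr _ in a1 h *.
apply: (@le_trans _ _ ((a * normC tau + b) ^+ 2)).
  by rewrite ler_pXn2r ?nnegrE ?normC_ge0 // addr_ge0 // mulr_ge0.
set n := normC tau in n0 *.
rewrite -subr_ge0.
have -> : (a + b) ^+ 2 * (n ^+ 2 + 1) - (a * n + b) ^+ 2 =
  (a - b * n) ^+ 2 + 2 * (a * b) * (n ^+ 2 + 1) by ring.
by rewrite addr_ge0 ?sqr_ge0 // !mulr_ge0 // addr_ge0 // sqr_ge0.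
Qed.

(** The height of the image is (|a tau + b|^2 + |c tau + d|^2)/v. *)
Lemma height_act g p : HxC p -> height (jacobi_act g p).1 <=
  (norm1 (row 0 (val g.1)) ^+ 2 + norm1 (bot g.1) ^+ 2) * height p.1.
Proof.
move=> hp; rewrite /height Im_act // act_fst normCM normCV.
have D0 : 0 < normC (lin (bot g.1) p.1) by rewrite normC_gt0 lin_neq0 // bot_neq0.
have v0 : 0 < Im p.1 by [].
set N := normC (lin (row _ _) _); set D := normC _ in D0 *.
have -> : ((N / D) ^+ 2 + 1) / (Im p.1 / D ^+ 2) = (N ^+ 2 + D ^+ 2) / Im p.1.
  by field; rewrite !gt_eqF.
rewrite mulrA ler_pM2r ?invr_gt0 // mulrDl.
by apply: lerD; exact: normC_lin.
Qed.

(* Write M = S^l T M' with M' of smaller lower left entry. Only T contributes,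
   since phi vanishes at S^l; and |c| + |d| does not increase along the way. *)
Lemma Phi_SL2Z C A : 0 <= C ->
  (forall g p, g \in [:: jM SL2Z_T; jM SL2Z_N] -> HxC p -> Phi g p <= C * height p.1 ^+ A) ->
  forall M p, HxC p -> Phi (jM M) p <=
    C * (1 + absr (val M 1 0)) * (2 * (1 + norm1 (bot M)) ^+ 2 * height p.1) ^+ A.
Proof.
move=> C0 gens.
have PhiU l M p : HxC p -> Phi (jM (SL2Z_mul (SL2Z_upper l) M)) p = Phi (jM M) p.
  by move=> hp; rewrite /weighted_norm -jM_mul phi_upper_mul.
have key M p : HxC p -> height p.1 <= 2 * (1 + norm1 (bot M)) ^+ 2 * height p.1.
  move=> hp; have [b1 _ _ _] := height_ge p.1 hp.
  rewrite ler_peMl ?(le_trans ler01) //.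
  have s1 : 1 <= (1 + norm1 (bot M)) ^+ 2 :> R by rewrite exprn_ege1 // lerDl norm1_ge0.
  lra.
elim/SL2Z_euclid => [M c0|l M N N0 N1 lt0 le1 ih] p hp.
  have [b1 _ _ _] := height_ge p.1 hp.
  have b0 : 0 <= height p.1 := le_trans ler01 b1.
  rewrite c0 /absr absz0 addr0 mulr1.
  have [l [e|e]] := SL2Z_c0 M c0.
    rewrite {1}e /weighted_norm phi_upper // normC0 mul0r mulr_ge0 // exprn_ge0 //.
    exact: le_trans b0 (key M p hp).
  rewrite {1}e PhiU //.
  apply: le_trans (gens _ _ _ hp) _; first by rewrite !inE eqxx orbT.
  apply: ler_wpM2l => //; apply: lerXn2r; rewrite ?nnegrE //.
    exact: le_trans b0 (key M p hp).
  exact: key.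
have NE : N = SL2Z_mul (SL2Z_upper l) (SL2Z_mul SL2Z_T M) by [].
clearbody N.
have [b1 _ _ _] := height_ge p.1 hp.
have b0 : 0 <= height p.1 := le_trans ler01 b1.
have n1 : norm1 (bot M) <= norm1 (bot N) :> R.
  rewrite /norm1 /absr /bot !mxE N0 N1 -!natrD ler_nat.
  by move: lt0 le1; clear; lia.
(* The top row of [M] is the bottom row of [N], so both rows of [M] are controlled by [bot N]; this
   bounds the height at the image point, where phi_T is evaluated. *)
have nt : norm1 (row 0 (val M)) = norm1 (bot N) :> R by rewrite /norm1 /bot !mxE N0 N1.
have s0 : 0 <= norm1 (bot N) :> R by exact: norm1_ge0.
have s0' : 0 <= norm1 (bot M) :> R by exact: norm1_ge0.
rewrite {1}NE PhiU // -jM_mul.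
apply: le_trans (Phi_mul _ _ _ homega _ hphi _ _ _ hp) _.
set X := 2 * (1 + norm1 (bot N)) ^+ 2 * height p.1.
have hX : height (jacobi_act (jM M) p).1 <= X.
  apply: le_trans (height_act _ _ hp) _; rewrite /= nt /X ler_wpM2r //.
  have : norm1 (bot M) ^+ 2 <= norm1 (bot N) ^+ 2 :> R by rewrite ler_pXn2r ?nnegrE.
  have : norm1 (bot N) ^+ 2 <= (1 + norm1 (bot N)) ^+ 2 :> R.
    by rewrite ler_pXn2r ?nnegrE ?addr_ge0 // lerDr.
  lra.
have hp' := HxC_act (jM M) p hp.
have [b1' _ _ _] := height_ge _ hp'.
have b0' : 0 <= height (jacobi_act (jM M) p).1 := le_trans ler01 b1'.
have X0 : 0 <= X := le_trans b0' hX.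
have t1 : Phi (jM SL2Z_T) (jacobi_act (jM M) p) <= C * X ^+ A.
  apply: le_trans (gens _ _ _ hp') _; first by rewrite !inE eqxx.
  by apply: ler_wpM2l => //; apply: lerXn2r.
have t2 : Phi (jM M) p <= C * absr (val N 1 0) * X ^+ A.
  apply: le_trans (ih _ hp) _.
  (* The factor 1 + |c| counts the steps of the algorithm: each adds at most C X^A and lowers |c| by
     at least 1. *)
  have c1 : 1 + absr (val M 1 0) <= absr (val N 1 0) :> R.
    by rewrite N0 /absr nat1r ler_nat.
  apply: ler_pM.
  - by rewrite mulr_ge0 // addr_ge0 // ler0n.
  - by rewrite exprn_ge0 // (le_trans b0) // key.
  - by apply: ler_wpM2l.
  - apply: lerXn2r; rewrite ?nnegrE //; first by rewrite (le_trans b0) // key.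
    rewrite /X ler_wpM2r //; rewrite ler_pM2l //; apply: lerXn2r; rewrite ?nnegrE ?addr_ge0 //.
    by rewrite lerD2l.
apply: le_trans (lerD t1 t2) _.
by rewrite le_eqVlt; apply/orP; left; apply/eqP; ring.
Qed.

Definition unitv0 : 'rV[int]_2 := row2 1 0.
Definition unitv1 : 'rV[int]_2 := row2 0 1.

(** Translations fix tau, hence the height, so subadditivity gives a bound linear in the word length
    |lambda| + |mu|. *)
Lemma Phi_jX C A : 0 <= C ->
  (forall g p, g \in [:: jX unitv0; jX (- unitv0); jX unitv1; jX (- unitv1)] -> HxC p ->
     Phi g p <= C * height p.1 ^+ A) ->
  forall x p, HxC p -> Phi (jX x) p <= C * norm1 x * height p.1 ^+ A.
Proof.
move=> C0 gens.
pose bd x (K : R) := forall p, HxC p -> Phi (jX x) p <= C * K * height p.1 ^+ A.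
have bdD x y K L : bd x K -> bd y L -> bd (x + y) (K + L).
  move=> hx hy p hp; rewrite -jX_mul; apply: le_trans (Phi_mul _ _ _ homega _ hphi _ _ _ hp) _.
  have := hx _ (HxC_act (jX y) p hp); rewrite jX_act_fst // => hx'.
  by apply: le_trans (lerD hx' (hy _ hp)) _; rewrite -mulrDl -mulrDr.
have bd0 : bd 0 0.
  by move=> p hp; rewrite /weighted_norm (phi1 p hp) normC0 mul0r mulr0 mul0r.
have bdMn x n : bd x 1 -> bd (x *+ n) n%:R.
  move=> hx; elim: n => [|n ih]; first exact: bd0.
  by rewrite mulrSr -natr1; apply: bdD.
have gen x : jX x \in [:: jX unitv0; jX (- unitv0); jX unitv1; jX (- unitv1)] -> bd x 1.
  by move=> hx p hp; rewrite mulr1; exact: gens.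
have bdZ x (n : int) : bd x 1 -> bd (- x) 1 -> bd (x *~ n) (absr n).
  move=> h1 h2; case: n => n; first exact: bdMn.
  by have := bdMn _ n.+1 h2; rewrite NegzE mulrNz mulNrn.
move=> x; suff h : bd x (norm1 x) by exact: h.
have xE : x = unitv0 *~ (x 0 0) + unitv1 *~ (x 0 1).
  by apply: rV2_eq; rewrite mxE -!scaler_int !mxE /= ?mulr0 ?mulr1 ?addr0 ?add0r intz.
rewrite {1}xE /norm1.
by apply: bdD; apply: bdZ; apply: gen; rewrite !inE eqxx ?orbT.
Qed.

(** [M,x] is split as [M,0][I,x]. Of the exponent 2A + 1, the part 2A comes from the heights met
    along the Euclidean algorithm and 1 from the number of its steps. *)
Lemma cocycle_growth : exists C A, 0 <= C /\ forall g p, HxC p ->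
  Phi g p <= C * (1 + norm1 (bot g.1)) ^+ (2 * A + 1) * (1 + norm1 g.2) * height p.1 ^+ A.
Proof.
have [C [A [C0 gens]]] := Phi_gens [:: jM SL2Z_T; jM SL2Z_N; jX unitv0; jX (- unitv0); jX unitv1; jX (- unitv1)].
exists (C * 2 ^+ A), A; split; first by rewrite mulr_ge0 // exprn_ge0.
move=> g p hp; rewrite [X in Phi X](jMX g).
apply: le_trans (Phi_mul _ _ _ homega _ hphi _ _ _ hp) _.
have h1 := Phi_SL2Z C A C0 _ g.1 _ (HxC_act (jX g.2) p hp).
have h2 := Phi_jX C A C0 _ g.2 p hp.
apply: le_trans (lerD (h1 _) (h2 _)) _.
- move=> k q hk hq; apply: (gens k q _ hq).
  change (k \in [:: jM SL2Z_T; jM SL2Z_N] ++ [:: jX unitv0; jX (- unitv0); jX unitv1; jX (- unitv1)]).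
  by rewrite mem_cat hk.
- move=> k q hk hq; apply: (gens k q _ hq).
  change (k \in [:: jM SL2Z_T; jM SL2Z_N] ++ [:: jX unitv0; jX (- unitv0); jX unitv1; jX (- unitv1)]).
  by rewrite mem_cat hk orbT.
rewrite jX_act_fst //; have [b1 _ _ _] := height_ge _ hp.
have b0 : 0 <= height p.1 ^+ A by rewrite exprn_ge0 // (le_trans ler01).
set s := 1 + norm1 (bot g.1); set w := height p.1 ^+ A in b0 *.
have s1 : 1 <= s by rewrite lerDl norm1_ge0.
have s0 : 0 <= s := le_trans ler01 s1.
have -> : (2 * s ^+ 2 * height p.1) ^+ A = 2 ^+ A * s ^+ (2 * A) * w.
  by rewrite [LHS]exprMn [X in X * _]exprMn exprM.
rewrite exprD expr1.
have cs : 1 + absr (val g.1 1 0) <= s.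
  by rewrite /s /norm1 /bot !mxE lerD2l lerDl ler0n.
have x0 : 0 <= norm1 g.2 :> R by exact: norm1_ge0.
have p1 : 1 <= 2 ^+ A * (s ^+ (2 * A) * s) :> R.
  rewrite -exprSr; apply: mulr_ege1; first by rewrite exprn_ege1 // ler1n.
  by rewrite exprn_ege1.
have t1 : C * (1 + absr (val g.1 1 0)) * (2 ^+ A * s ^+ (2 * A) * w) <=
  C * (2 ^+ A * (s ^+ (2 * A) * s)) * w.
  have -> : C * (2 ^+ A * (s ^+ (2 * A) * s)) * w = C * s * (2 ^+ A * s ^+ (2 * A) * w) by ring.
  apply: ler_wpM2r; first by rewrite !mulr_ge0 // exprn_ge0.
  exact: ler_wpM2l.
have t2 : C * norm1 g.2 * w <= C * (2 ^+ A * (s ^+ (2 * A) * s)) * norm1 g.2 * w.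
  rewrite ler_wpM2r // -mulrA ler_wpM2l // ler_peMl //.
apply: le_trans (lerD t1 t2) _.
by rewrite le_eqVlt; apply/orP; left; apply/eqP; ring.
Qed.

End CocycleGrowth.

(** * The kernel and its sums *)

Section Kernel.
Context {R : realType}.
Implicit Types (u x : 'rV[int]_2) (M : SL2Z) (g : jacobi) (p : C2 R) (l : int).

(* (u, x) stands for the coset of the elements [M, x] such that u is the bottom
   row of M; it is meaningful if u is primitive. *)
Definition coset_index := ('rV[int]_2 * 'rV[int]_2)%type.

Definition primitive u : bool := `[< exists M, bot M = u >].

(** Bounded convex open sets exhausting H x C. Estimates are uniform on each of them, and convexity
    supplies the connectedness demanded by [meromorphic_on]. *)
Definition region (T : R) : set (C2 R) :=
  [set p | [/\ normC p.1 < T, normC p.2 < T & T^-1 < Im p.1]].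

Definition slope (T : R) : R := T * (1 + 2 * T).

Lemma region_HxC T : 0 < T -> region T `<=` HxC.
Proof. by move=> T0 p [_ _ h]; apply: lt_trans h; rewrite invr_gt0. Qed.

(** With L = |c tau + d|: |c| <= L/v <= TL and |d| <= L + |c||tau| <= L + T^2 L. A point of the
    region forces T^2 >= 1, so the sum is at most (T + 2T^2) L. *)
Lemma norm1_lin T p u : 0 < T -> region T p -> norm1 u <= slope T * normC (lin u p.1).
Proof.
move=> T0 hp; have v0 : 0 < Im p.1 := region_HxC T T0 p hp; case: hp => h1 _ h3.
move: (p.1) v0 h1 h3 => tau v0 h1 h3.
have a0 : 0 <= absr (u 0 0) :> R by exact: ler0n.
have c0 : absr (u 0 0) * Im tau <= normC (lin u tau).
  by apply: le_trans (normC_Im _); rewrite Im_lin normrM normr_absr (gtr0_norm v0).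
have c1 : absr (u 0 1) <= normC (lin u tau) + absr (u 0 0) * normC tau.
  have -> : absr (u 0 1) = normC (lin u tau - (u 0 0)%:~R * tau) :> R.
    by rewrite /lin addrC addKr normC_intr.
  by apply: le_trans (normCB _ _) _; rewrite normCM normC_intr.
set L := normC (lin u tau) in c0 c1 *.
have L0 : 0 <= L by exact: normC_ge0.
have c2 : absr (u 0 0) <= T * L.
  have : absr (u 0 0) * T^-1 <= L by apply: le_trans c0; rewrite ler_wpM2l // ltW.
  by rewrite ler_pdivrMr // mulrC.
have c3 : absr (u 0 0) * normC tau <= T * L * T by apply: ler_pM => //; [exact: normC_ge0|exact: ltW].
have T1 : 1 <= T ^+ 2.
  have vn : Im tau <= normC tau := le_trans (ler_norm _) (normC_Im tau).
  have : T^-1 < T by apply: lt_trans h3 _; exact: le_lt_trans vn h1.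
  by rewrite -(ltr_pM2l T0) divff ?gt_eqF // -expr2 => /ltW.
have : L <= T ^+ 2 * L by rewrite ler_peMl.
rewrite /norm1 /slope; nra.
Qed.

Lemma norm1_nat u : norm1 u = (absz (u 0 0)%R + absz (u 0 1)%R)%:R :> R.
Proof. by rewrite /norm1 /absr -natrD. Qed.

Lemma norm1_ge1 u : u != 0 -> 1 <= norm1 u :> R.
Proof.
move=> u0; rewrite norm1_nat ler1n lt0n addn_eq0 !absz_eq0; apply: contra u0.
by move=> /andP[/eqP h0 /eqP h1]; apply/eqP; apply: rV2_eq; rewrite mxE.
Qed.

Definition int_range (n : nat) : seq int :=
  map Posz (iota 0 n) ++ map (fun j => - Posz j) (iota 0 n).

Definition box (n : nat) : seq 'rV[int]_2 :=
  undup [seq row2 a b | a <- int_range n, b <- int_range n].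

Lemma mem_int_range n (a : int) : (absz a < n)%N -> a \in int_range n.
Proof.
move=> h; rewrite /int_range mem_cat; apply/orP; case: a h => a h.
  by left; apply: map_f; rewrite mem_iota.
by right; rewrite NegzE; apply: (map_f (fun j => - Posz j)); rewrite mem_iota.
Qed.

Lemma mem_box n u : norm1 u < n%:R :> R -> u \in box n.
Proof.
rewrite norm1_nat ltr_nat => h; rewrite mem_undup; apply/allpairsP; exists (u 0 0, u 0 1).
split => /=; last by apply: rV2_eq; rewrite !mxE.
  by apply: mem_int_range; rewrite (leq_ltn_trans _ h) // leq_addr.
by apply: mem_int_range; rewrite (leq_ltn_trans _ h) // leq_addl.
Qed.

Lemma int_range_le n (a : int) : a \in int_range n -> (absz a <= n)%N.
Proof.
rewrite mem_cat => /orP[] /mapP[j]; rewrite mem_iota add0n => /andP[_ /ltnW h] ->//.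
by rewrite abszN.
Qed.

Lemma box_le n u : u \in box n -> norm1 u <= (n + n)%:R :> R.
Proof.
rewrite mem_undup => /allpairsP[[a b] /= [ha hb ->]].
by rewrite norm1_nat !mxE /= ler_nat leq_add // int_range_le.
Qed.

Section Series.
Variables (N k : nat) (a : coset_index -> C2 R -> R[i]^o).
Hypothesis adiff : forall i p, HxC p -> differentiable (a i) p.
Hypothesis abnd : forall T : R, 0 < T -> exists2 G : R, 0 <= G & forall i p, region T p ->
  normC (a i p) <= G * ((1 + norm1 i.1) ^+ N * (1 + norm1 i.2) ^+ k).

(** The exponents [N] and [k] absorb the growth of the coefficients [a]; the additional 4 in each
    makes the series summable by [bsum_rV2]. *)
Definition ker (i : coset_index) p : R[i] :=
  if primitive i.1 then
    (lin i.1 p.1 ^+ (N + 4))^-1 * ((p.2 + lin i.2 p.1) ^+ (k + 4))^-1 else 0.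

Variable T : R.
Hypothesis T0 : 0 < T.

(** Finitely many (lambda,mu), containing all whose polar line meets the region: outside the list
    norm1 >= 2 [slope] T + 1, so |lambda tau + mu| > 2T while |z| < T. *)
Definition poles : seq 'rV[int]_2 := box (Num.truncn (2 * slope T * T + 1)).+1.

(* The exponent exceeds the order k + 4 of the poles, so that clearedE also holds
   on the polar set, where 0^-1 = 0. *)
Definition cofactor0 (W : seq 'rV[int]_2) p : R[i] :=
  \prod_(x <- W) (p.2 + lin x p.1) ^+ (k + 5).

Definition clear p : R[i] := cofactor0 poles p.

(** The singularity at a listed x is removed algebraically: k + 5 factors against a pole of order k
    + 4 leave one factor. *)
Definition cleared x p : R[i] :=
  if x \in poles then cofactor0 (rem x poles) p * (p.2 + lin x p.1)
  else clear p * ((p.2 + lin x p.1) ^+ (k + 4))^-1.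

Lemma clearedE x p : clear p * ((p.2 + lin x p.1) ^+ (k + 4))^-1 = cleared x p.
Proof.
rewrite /cleared; case: ifP => // xW; rewrite /clear /cofactor0 (big_rem x) //=.
have [->|h] := eqVneq (p.2 + lin x p.1) 0; first by rewrite !expr0n !addnS /= !mul0r mulr0.
have -> : (k + 5 = (k + 4).+1)%N by rewrite addnS.
by rewrite exprS; field; rewrite expf_neq0.
Qed.

Lemma slope_gt0 : 0 < slope T.
Proof. by rewrite mulr_gt0 // addr_gt0 // mulr_gt0. Qed.

Lemma far_from_pole x p : region T p -> x \notin poles ->
  1 + norm1 x <= 4 * slope T * normC (p.2 + lin x p.1).
Proof.
move=> hp xW.
have h : 2 * slope T * T + 1 <= norm1 x.
  rewrite leNgt; apply: contra xW => h; apply: mem_box; apply: lt_trans h _.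
  exact: truncnS_gt.
have i0 := norm1_lin _ _ x T0 hp; have s0 := slope_gt0; case: hp => _ h2 _.
have i1 : slope T * (normC (lin x p.1) - normC p.2) <= slope T * normC (p.2 + lin x p.1).
  by rewrite ler_pM2l // [p.2 + _]addrC normC_triB.
have i2 : slope T * normC p.2 <= slope T * T by rewrite ler_pM2l // ltW.
have x0 := norm1_ge0 x : 0 <= norm1 x :> R.
lra.
Qed.


Lemma cofactor0_bound (L : R) (W : seq 'rV[int]_2) p : 1 <= L ->
  {in W, forall y, normC (p.2 + lin y p.1) <= L} ->
  normC (cofactor0 W p) <= L ^+ ((k + 5) * size W).
Proof.
move=> L1; have L0 : 0 <= L := le_trans ler01 L1.
rewrite /cofactor0; elim: W => [|y W ih] hW; first by rewrite big_nil normC1 muln0.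
rewrite big_cons normCM normCX /= mulnS [L ^+ _]exprD; apply: ler_pM.
- by apply: exprn_ge0; exact: normC_ge0.
- exact: normC_ge0.
- by apply: lerXn2r; rewrite ?nnegrE ?normC_ge0 // hW // mem_head.
- by apply: ih => z zW; apply: hW; rewrite inE zW orbT.
Qed.

Lemma cleared_bound : exists2 C : R, 0 <= C & forall x p, region T p ->
  normC (cleared x p) <= C * ((1 + norm1 x) ^+ (k + 4))^-1.
Proof.
have [n nP] : exists n, poles = box n by exists (Num.truncn (2 * slope T * T + 1)).+1.
set n2 : R := (n + n)%:R; have n20 : 0 <= n2 by exact: ler0n.
set L := 1 + T + n2 * (1 + T).
have L1 : 1 <= L by rewrite /L -addrA lerDl addr_ge0 ?(ltW T0) // mulr_ge0 // addr_ge0 // ltW.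
have L0 : 0 <= L := le_trans ler01 L1.
have Lp y p : region T p -> y \in poles -> normC (p.2 + lin y p.1) <= L.
  move=> [h1 h2 _]; rewrite nP => /box_le yn.
  have a0 : 0 <= absr (y 0 0) :> R by exact: ler0n.
  have a1 : 0 <= absr (y 0 1) :> R by exact: ler0n.
  have ly : normC (lin y p.1) <= norm1 y * (1 + T).
    apply: le_trans (normCD _ _) _; rewrite normCM !normC_intr /norm1.
    have : absr (y 0 0) * normC p.1 <= absr (y 0 0) * T by rewrite ler_wpM2l // ltW.
    have : 0 <= absr (y 0 1) * T by rewrite mulr_ge0 // ltW.
    move: (absr (y 0 0)) (absr (y 0 1)) a0 a1 => b c *; nra.
  apply: le_trans (normCD _ _) _; rewrite /L.
  have : norm1 y * (1 + T) <= n2 * (1 + T) by rewrite ler_wpM2r // addr_ge0 // ltW.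
  lra.
set Q := L ^+ ((k + 5) * size poles + 1).
have Q1 : 1 <= Q by exact: exprn_ege1.
have Q0 : 0 <= Q := le_trans ler01 Q1.
have s0 : 0 <= 4 * slope T by rewrite mulr_ge0 // ltW // slope_gt0.
have c1 : 0 <= (1 + n2) ^+ (k + 4) by rewrite exprn_ge0 // addr_ge0.
have c2 : 0 <= (4 * slope T) ^+ (k + 4) by rewrite exprn_ge0.
(* The first summand serves the x in [poles], where norm1 is at most [n2]; the second serves the
   others, which decay by [far_from_pole]. *)
exists (Q * ((1 + n2) ^+ (k + 4) + (4 * slope T) ^+ (k + 4))); first by rewrite mulr_ge0 // addr_ge0.
move=> x p hp; have x0 := norm1_ge0 x : 0 <= norm1 x :> R.
have x1 : 0 < (1 + norm1 x) ^+ (k + 4) :> R by rewrite exprn_gt0 // ltr_wpDr.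
rewrite ler_pdivlMr //.
rewrite /cleared; case: ifP => [xW|/negbT xW].
  have h1 : normC (cofactor0 (rem x poles) p * (p.2 + lin x p.1)) <= Q.
    rewrite normCM /Q exprD expr1; apply: ler_pM.
    - exact: normC_ge0.
    - exact: normC_ge0.
    - apply: (@le_trans _ _ (L ^+ ((k + 5) * size (rem x poles)))).
        by apply: cofactor0_bound => // y /mem_rem; exact: Lp.
      by rewrite ler_weXn2l // leq_mul2l size_rem // leq_pred orbT.
    - exact: Lp.
  have h2 : (1 + norm1 x) ^+ (k + 4) <= (1 + n2) ^+ (k + 4).
    apply: lerXn2r; rewrite ?nnegrE ?addr_ge0 // lerD2l.
    by move: xW; rewrite nP => /box_le.
  apply: le_trans (ler_pM (normC_ge0 _) (ltW x1) h1 h2) _.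
  by rewrite mulrDr lerDl mulr_ge0.
have h1 : normC (clear p) <= Q.
  apply: (@le_trans _ _ (L ^+ ((k + 5) * size poles))).
    by apply: cofactor0_bound => // y; exact: Lp.
  by rewrite ler_weXn2l // leq_addr.
have far := far_from_pole _ _ hp xW.
have D0 : 0 < normC (p.2 + lin x p.1).
  rewrite lt0r normC_ge0 andbT; apply: contraTneq far => ->.
  by rewrite mulr0 -ltNge ltr_wpDr.
have h2 : normC ((p.2 + lin x p.1) ^+ (k + 4))^-1 * (1 + norm1 x) ^+ (k + 4) <= (4 * slope T) ^+ (k + 4).
  rewrite normCV normCX mulrC ler_pdivrMr ?exprn_gt0 // -exprMn.
  by apply: lerXn2r; rewrite ?nnegrE ?addr_ge0 // mulr_ge0 // ltW.
rewrite normCM -mulrA; apply: le_trans (ler_pM (normC_ge0 _) _ h1 h2) _.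
  by rewrite mulr_ge0 ?normC_ge0 // ltW.
by rewrite mulrDr lerDr mulr_ge0.
Qed.

Lemma primitive_neq0 u : primitive u -> u != 0.
Proof. by move=> /asboolP[M <-]; exact: bot_neq0. Qed.

Lemma lin_inv_bound u p n : region T p -> primitive u ->
  normC (lin u p.1 ^+ n)^-1 <= (2 * slope T) ^+ n * ((1 + norm1 u) ^+ n)^-1.
Proof.
move=> hp pu; have u1 := norm1_ge1 _ (primitive_neq0 _ pu).
have v0 : 0 < Im p.1 := region_HxC T T0 p hp.
have l0 : 0 < normC (lin u p.1) by rewrite normC_gt0 lin_neq0 // primitive_neq0.
have n0 : 0 < 1 + norm1 u :> R by lra.
rewrite normCV normCX ler_pdivlMr ?exprn_gt0 // mulrC ler_pdivrMr ?exprn_gt0 // -exprMn.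
have := norm1_lin _ _ u T0 hp; have s0 := slope_gt0 => h.
have h' : 1 + norm1 u <= 2 * slope T * normC (lin u p.1) by lra.
by apply: lerXn2r; rewrite ?nnegrE //; [exact: ltW | apply: le_trans h'; exact: ltW].
Qed.

Definition term (i : coset_index) p : R[i] := clear p * (a i p * ker i p).

Lemma termE i p : term i p =
  if primitive i.1 then a i p * ((lin i.1 p.1 ^+ (N + 4))^-1 * cleared i.2 p) else 0.
Proof. by rewrite /term /ker -clearedE; case: ifP => _; rewrite ?mulr0 //; ring. Qed.

Definition weight4 (i : coset_index) : R := ((1 + norm1 i.1) ^+ 4)^-1 * ((1 + norm1 i.2) ^+ 4)^-1.

Lemma weight4_gt0 i : 0 < weight4 i.
Proof. by rewrite mulr_gt0 // invr_gt0 exprn_gt0 // ltr_wpDr // norm1_ge0. Qed.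

Lemma bsum_weight4 : bsum weight4 (16 * 16).
Proof.
have b0 u : 0 <= ((1 + norm1 u) ^+ 4)^-1 :> R.
  by rewrite invr_ge0 exprn_ge0 // addr_ge0 // norm1_ge0.
exact: (bsum_prod _ _ _ _ _ _ b0 b0 bsum_rV2 bsum_rV2).
Qed.

Lemma term_bound : exists2 C : R, 0 <= C & forall i p, region T p ->
  normC (term i p) <= C * weight4 i.
Proof.
have [G G0 GP] := abnd T T0; have [C C0 CP] := cleared_bound.
have s0 : 0 <= 2 * slope T by rewrite mulr_ge0 // ltW // slope_gt0.
exists (G * (2 * slope T) ^+ (N + 4) * C); first by rewrite !mulr_ge0 // exprn_ge0.
move=> [u x] p hp; rewrite termE /=; case: ifP => [pu|_]; last first.
  rewrite normC0; apply: mulr_ge0; last exact: ltW (weight4_gt0 _).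
  by rewrite !mulr_ge0 ?exprn_ge0.
have h1 := GP (u, x) p hp; have h2 := lin_inv_bound u p (N + 4) hp pu; have h3 := CP x p hp.
rewrite (normCM (a _ _)) (normCM (lin _ _ ^+ _)^-1).
have u0 : 0 < 1 + norm1 u :> R by rewrite ltr_wpDr // norm1_ge0.
have x0 : 0 < 1 + norm1 x :> R by rewrite ltr_wpDr // norm1_ge0.
apply: le_trans (ler_pM (normC_ge0 _) _ h1 (ler_pM (normC_ge0 _) (normC_ge0 _) h2 h3)) _.
  by rewrite mulr_ge0 ?normC_ge0.
rewrite /weight4 /= [(1 + norm1 u) ^+ (N + 4)]exprD [(1 + norm1 x) ^+ (k + 4)]exprD.
have : (1 + norm1 u) ^+ N != 0 :> R by rewrite expf_neq0 // gt_eqF.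
have : (1 + norm1 u) ^+ 4 != 0 :> R by rewrite expf_neq0 // gt_eqF.
have : (1 + norm1 x) ^+ k != 0 :> R by rewrite expf_neq0 // gt_eqF.
have : (1 + norm1 x) ^+ 4 != 0 :> R by rewrite expf_neq0 // gt_eqF.
move: ((1 + norm1 x) ^+ 4) ((1 + norm1 x) ^+ k) ((1 + norm1 u) ^+ 4) ((1 + norm1 u) ^+ N) (_ ^+ (N + 4)).
move=> X4 Xk U4 UN S x40 xk0 u40 un0.
rewrite le_eqVlt; apply/orP; left; apply/eqP; field.
by rewrite x40 xk0 u40 un0.
Qed.

Lemma differentiable_pow (f : C2 R -> R[i]^o) n p : differentiable f p ->
  differentiable (fun q => f q ^+ n : R[i]^o) p.
Proof.
move=> df; case: n => [|n]; first exact: (differentiable_cst (1 : R[i]^o) p).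
by have := differentiableX n df; rewrite exprfctE.
Qed.

Lemma differentiable_inv_pow (f : C2 R -> R[i]^o) n p : differentiable f p -> f p != 0 ->
  differentiable (fun q => (f q ^+ n)^-1 : R[i]^o) p.
Proof.
move=> df f0; have fn0 : f p ^+ n != 0 by rewrite expf_neq0.
have dn := differentiable_pow f n p df.
exact: (@differentiableV _ _ (fun q => f q ^+ n : R[i]^o) p dn fn0).
Qed.

Lemma differentiable_lin u p : differentiable (fun q : C2 R => lin u q.1 : R[i]^o) p.
Proof.
have d1 := differentiableZ (u 0 0)%:~R (differentiable_fst p).
exact: (differentiableD d1 (differentiable_cst ((u 0 1)%:~R : R[i]^o) p)).
Qed.

Lemma differentiable_linz u p : differentiable (fun q : C2 R => q.2 + lin u q.1 : R[i]^o) p.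
Proof. exact: (differentiableD (differentiable_snd p) (differentiable_lin u p)). Qed.

Lemma differentiable_cofactor0 W p : differentiable (cofactor0 W : C2 R -> R[i]^o) p.
Proof.
elim: W => [|x W ih].
  have -> : cofactor0 [::] = cst 1 by apply/funext => q; rewrite /cofactor0 big_nil.
  exact: differentiable_cst.
have -> : cofactor0 (x :: W) = fun q => (q.2 + lin x q.1) ^+ (k + 5) * cofactor0 W q.
  by apply/funext => q; rewrite /cofactor0 big_cons.
exact: (differentiableM (differentiable_pow (fun q => q.2 + lin x q.1) (k + 5) p (differentiable_linz x p)) ih).
Qed.

Lemma differentiable_cleared x p : region T p -> differentiable (cleared x : C2 R -> R[i]^o) p.
Proof.
move=> hp.
have -> : cleared x = if x \in poles then fun q => cofactor0 (rem x poles) q * (q.2 + lin x q.1)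
  else fun q => clear q * ((q.2 + lin x q.1) ^+ (k + 4))^-1.
  by apply/funext => q; rewrite /cleared; case: ifP.
case: ifP => [xW|/negbT xW].
  exact: (differentiableM (differentiable_cofactor0 _ p) (differentiable_linz x p)).
have far := far_from_pole _ _ hp xW.
have D0 : p.2 + lin x p.1 != 0.
  rewrite -normC_eq0; apply: contraTneq far => ->.
  by rewrite mulr0 -ltNge ltr_wpDr // norm1_ge0.
have d1 := differentiable_inv_pow (fun q => q.2 + lin x q.1) (k + 4) p (differentiable_linz x p) D0.
exact: (differentiableM (differentiable_cofactor0 _ p) d1).
Qed.

Lemma differentiable_term i p : region T p -> differentiable (term i : C2 R -> R[i]^o) p.
Proof.
move=> hp; have -> : term i = if primitive i.1 then
    fun q => a i q * ((lin i.1 q.1 ^+ (N + 4))^-1 * cleared i.2 q) else cst 0.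
  by apply/funext => q; rewrite termE; case: ifP.
case: ifP => [pu|_]; last exact: (differentiable_cst (0 : R[i]^o) p).
have v0 : 0 < Im p.1 := region_HxC T T0 p hp.
have D0 : lin i.1 p.1 != 0 by rewrite lin_neq0 // primitive_neq0.
have d1 := differentiable_inv_pow (fun q => lin i.1 q.1) (N + 4) p (differentiable_lin i.1 p) D0.
exact: (differentiableM (adiff _ _ v0) (differentiableM d1 (differentiable_cleared i.2 p hp))).
Qed.

Lemma region_polydisc p : region T p -> exists2 d : R, 0 < d &
  forall x y : R[i], normC (x - p.1) < d -> normC (y - p.2) < d -> region T (x, y).
Proof.
move=> [h1 h2 h3]; exists (Num.min (T - normC p.1) (Num.min (T - normC p.2) (Im p.1 - T^-1))).
  by rewrite !lt_min !subr_gt0 h1 h2 h3.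
move=> x y; rewrite !lt_min => /and3P[x1 x2 x3] /and3P[y1 y2 y3].
have e1 : normC x <= normC (x - p.1) + normC p.1 by rewrite -{1}(subrK p.1 x) normCD.
have e2 : normC y <= normC (y - p.2) + normC p.2 by rewrite -{1}(subrK p.2 y) normCD.
have e3 : Im p.1 - Im x <= normC (x - p.1).
  apply: le_trans (normC_Im _); rewrite ImD ImN -normrN opprB; exact: ler_norm.
by split => /=; lra.
Qed.

Lemma has_sum_term p : region T p -> has_sum (fun i => term i p) (sumC (fun i => term i p)).
Proof.
move=> hp; have [C C0 CP] := term_bound.
apply: (sumCP _ _ (C * (16 * 16))); apply: bsum_le (bsumZ _ _ _ _ C0 bsum_weight4) => i.
exact: CP.
Qed.

Lemma differentiable_series p : region T p ->
  differentiable (fun q => sumC (fun i => term i q) : R[i]^o) p.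
Proof.
case: p => x y hp; have [d d0 dP] := region_polydisc _ hp; have [C C0 CP] := term_bound.
apply: (has_sum_differentiable _ (term : coset_index -> C2 R -> R[i]^o) (fun i => C * weight4 i) (C * (16 * 16)) d) => //.
- by move=> i; rewrite mulr_ge0 // ltW // weight4_gt0.
- exact: bsumZ bsum_weight4.
- by move=> i x' y' hx hy; split; [apply: differentiable_term | apply: CP]; exact: dP.
- by move=> x' y' hx hy; apply: has_sum_term; exact: dP.
Qed.

End Series.
End Kernel.

(** * Nonvanishing of the kernel sum at one point *)

Section Nonvanishing.
Context {R : realType}.
Implicit Types (u x : 'rV[int]_2) (M : SL2Z).

Lemma primitive_unitv1 : primitive unitv1.
Proof. by apply/asboolP; exists SL2Z_I; apply: rV2_eq; rewrite !mxE. Qed.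

Lemma primitive_Nunitv1 : primitive (- unitv1).
Proof. by apply/asboolP; exists SL2Z_N; apply: rV2_eq; rewrite !mxE. Qed.

Lemma primitive_u0 u : primitive u -> u 0 0 = 0 -> u = unitv1 \/ u = - unitv1.
Proof.
move=> /asboolP[M <-] h; rewrite !mxE in h.
have [l [->|->]] := SL2Z_c0 M h.
  by left; apply: rV2_eq; rewrite !mxE.
by right; apply: rV2_eq; rewrite /bot mxE /= mulmx2E !mxE.
Qed.

Variables (N k : nat).
Hypothesis N0 : (0 < N)%N.
Hypothesis Neven : ~~ odd N.

(** The 4 and 8 are the constants of [lin_tau_norm1] and [shift_tau_norm1], and 256 = 16 * 16 bounds
    the sum of [weight4]. The choice of [Y] ensures Y >= 2 and 2Y > 256 Q. *)
Variables (Q Y : R).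
Hypothesis QE : Q = 4 ^+ (N + 4) * 8 ^+ (k + 4).
Hypothesis YE : Y = 2 + 256 * Q.
Let tau : R[i] := 0 +i* Y.
Let z : R[i] := (Y^-1)%:C.

Lemma Q_ge0 : 0 <= Q.
Proof. by rewrite QE; apply: mulr_ge0; apply: exprn_ge0; exact: ler0n. Qed.

Lemma Y_ge2 : 2 <= Y.
Proof. by rewrite YE lerDl; apply: mulr_ge0; [exact: ler0n|exact: Q_ge0]. Qed.

Let Y0 : 0 < Y. Proof. by apply: lt_le_trans Y_ge2. Qed.

Lemma lin_tau_ge u : absr (u 0 0) * Y <= normC (lin u tau) /\ absr (u 0 1) <= normC (lin u tau).
Proof.
split.
  by apply: le_trans (normC_Im _); rewrite Im_lin normrM normr_absr /= (gtr0_norm Y0).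
by apply: le_trans (normC_Re _); rewrite Re_lin /= mulr0 add0r normr_absr.
Qed.

Lemma lin_tau_norm1 u : u != 0 -> 1 + norm1 u <= 4 * normC (lin u tau).
Proof.
move=> /(@norm1_ge1 R); have [h0 h1] := lin_tau_ge u; rewrite /norm1 => h2.
have a0 : 0 <= absr (u 0 0) :> R by exact: ler0n.
have : absr (u 0 0) * 2 <= absr (u 0 0) * Y by rewrite ler_wpM2l // Y_ge2.
lra.
Qed.

Lemma shift_tau_norm1 x : x != 0 -> 1 + norm1 x <= 8 * normC (z + lin x tau).
Proof.
move=> x0; have h := lin_tau_norm1 x x0.
have [h0 h1] := lin_tau_ge x.
have n1 := @norm1_ge1 R x x0.
have z1 : normC z <= 2^-1.
  by rewrite normC_real gtr0_norm ?invr_gt0 // lef_pV2 ?posrE // Y_ge2.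
have l1 : 1 <= normC (lin x tau).
  have a0 : 0 <= absr (x 0 0) :> R by exact: ler0n.
  have : absr (x 0 0) * 2 <= absr (x 0 0) * Y by rewrite ler_wpM2l // Y_ge2.
  have [x00|x00] := eqVneq (x 0 0) 0.
    move=> _; apply: le_trans h1; move: n1; rewrite /norm1 x00 /absr absz0 add0r //.
  have : 1 <= absr (x 0 0) :> R by rewrite ler1n lt0n absz_eq0.
  lra.
have : normC (lin x tau) - normC z <= normC (z + lin x tau) by rewrite [z + _]addrC normC_triB.
lra.
Qed.

Lemma inv_pow_bound (L n c : R) j : 0 < n -> 0 < c -> n <= c * L -> (L ^+ j)^-1 <= c ^+ j * (n ^+ j)^-1.
Proof.
move=> n0 c0 h; have L0 : 0 < L by rewrite -(pmulr_rgt0 _ c0) (lt_le_trans n0).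
rewrite ler_pdivlMr ?exprn_gt0 // mulrC ler_pdivrMr ?exprn_gt0 // -exprMn.
by apply: lerXn2r; rewrite ?nnegrE //; [exact: ltW | rewrite ltW // mulr_gt0].
Qed.

Lemma inv_pow_le (n : R) i j : 1 <= n -> (i <= j)%N -> (n ^+ j)^-1 <= (n ^+ i)^-1.
Proof.
move=> n1 ij; have n0 : 0 < n := lt_le_trans ltr01 n1.
by rewrite lef_pV2 ?posrE ?exprn_gt0 // ler_weXn2l.
Qed.

Lemma u_bound u : primitive u -> (normC (lin u tau) ^+ (N + 4))^-1 <= 4 ^+ (N + 4) * ((1 + norm1 u) ^+ 4)^-1.
Proof.
move=> pu; have h := lin_tau_norm1 _ (primitive_neq0 _ pu).
have n1 : 1 <= 1 + norm1 u :> R by rewrite lerDl norm1_ge0.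
have n0 : 0 < 1 + norm1 u :> R := lt_le_trans ltr01 n1.
apply: le_trans (inv_pow_bound _ _ 4 (N + 4) n0 _ h) _ => //.
by apply: ler_wpM2l; [exact: exprn_ge0 | exact: inv_pow_le n1 (leq_addl _ _)].
Qed.

(** Here c is nonzero, so |c tau + d| >= Y; one of the N + 4 powers is spent on gaining Y^-1. *)
Lemma u_bound_strict u : primitive u -> u != unitv1 -> u != - unitv1 ->
  (normC (lin u tau) ^+ (N + 4))^-1 <= Y^-1 * (4 ^+ (N + 4) * ((1 + norm1 u) ^+ 4)^-1).
Proof.
move=> pu ue1 une1; have h := lin_tau_norm1 _ (primitive_neq0 _ pu).
have n1 : 1 <= 1 + norm1 u :> R by rewrite lerDl norm1_ge0.
have n0 : 0 < 1 + norm1 u :> R := lt_le_trans ltr01 n1.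
have LY : Y <= normC (lin u tau).
  have [h0 _] := lin_tau_ge u; apply: le_trans h0; rewrite ler_peMl ?(ltW Y0) // ler1n lt0n absz_eq0.
  by apply/eqP => /(primitive_u0 u pu) [e|e]; [move: ue1|move: une1]; rewrite e eqxx.
have -> : (N + 4 = (N + 3).+1)%N by rewrite addnS.
rewrite exprS invfM; apply: ler_pM.
- by rewrite invr_ge0 normC_ge0.
- by rewrite invr_ge0 exprn_ge0 // normC_ge0.
- by rewrite lef_pV2 ?posrE // (lt_le_trans Y0).
apply: le_trans (inv_pow_bound _ _ 4 (N + 3) n0 _ h) _ => //.
apply: ler_pM.
- exact: exprn_ge0.
- by rewrite invr_ge0 exprn_ge0 // ltW.
- by rewrite exprS ler_peMl ?exprn_ge0 // ler1n.
- by apply: inv_pow_le n1 _; rewrite -[4%N]/(1 + 3)%N leq_add2r.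
Qed.

Lemma x_bound x : x != 0 ->
  (normC (z + lin x tau) ^+ (k + 4))^-1 <= 8 ^+ (k + 4) * ((1 + norm1 x) ^+ 4)^-1.
Proof.
move=> x0; have h := shift_tau_norm1 x x0.
have n1 : 1 <= 1 + norm1 x :> R by rewrite lerDl norm1_ge0.
have n0 : 0 < 1 + norm1 x :> R := lt_le_trans ltr01 n1.
apply: le_trans (inv_pow_bound _ _ 8 (k + 4) n0 _ h) _ => //.
by apply: ler_wpM2l; [exact: exprn_ge0 | exact: inv_pow_le n1 (leq_addl _ _)].
Qed.

Lemma x0_value : (normC (z + lin 0 tau) ^+ (k + 4))^-1 = Y ^+ (k + 4).
Proof.
by rewrite /lin !mxE mul0r addr0 addr0 normC_real gtr0_norm ?invr_gt0 // exprVn invrK.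
Qed.

Lemma x_bound_all x : (normC (z + lin x tau) ^+ (k + 4))^-1 <= Y ^+ (k + 4) * (8 ^+ (k + 4) * ((1 + norm1 x) ^+ 4)^-1).
Proof.
have Y1 : 1 <= Y ^+ (k + 4) by rewrite exprn_ege1 // (le_trans _ Y_ge2) // ler1n.
have h8 : 1 <= 8 ^+ (k + 4) :> R by rewrite exprn_ege1 // ler1n.
have [->|x0] := eqVneq x 0.
  rewrite x0_value.
  have -> : norm1 0 = 0 :> R by rewrite /norm1 !mxE /absr absz0 addr0.
  by rewrite addr0 expr1n invr1 mulr1 ler_peMr // (le_trans ler01).
apply: le_trans (x_bound x x0) _; rewrite ler_peMl //; apply: mulr_ge0; first exact: exprn_ge0.
by rewrite invr_ge0 exprn_ge0 // addr_ge0 // norm1_ge0.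
Qed.

Let p0 : C2 R := (tau, z).
Let i1 : coset_index := (unitv1, 0).
Let i2 : coset_index := (- unitv1, 0).

Lemma normC_ker i : primitive i.1 -> normC (ker N k i p0) =
  (normC (lin i.1 tau) ^+ (N + 4))^-1 * (normC (z + lin i.2 tau) ^+ (k + 4))^-1.
Proof. by move=> pi; rewrite /ker pi normCM !normCV !normCX. Qed.

Lemma ker_bound i : normC (ker N k i p0) <= Y ^+ (k + 4) * Q * weight4 i.
Proof.
have [pi|npi] := boolP (primitive i.1); last first.
  rewrite /ker (negbTE npi) normC0 mulr_ge0 ?(ltW (weight4_gt0 _)) //.
  by rewrite mulr_ge0 ?Q_ge0 // exprn_ge0 // ltW.
rewrite normC_ker //.
have -> : Y ^+ (k + 4) * Q * weight4 i = (4 ^+ (N + 4) * ((1 + norm1 i.1) ^+ 4)^-1) *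
  (Y ^+ (k + 4) * (8 ^+ (k + 4) * ((1 + norm1 i.2) ^+ 4)^-1)) by rewrite QE /weight4; ring.
have nn j (w : R[i]) : 0 <= (normC w ^+ j)^-1 by rewrite invr_ge0 exprn_ge0 // normC_ge0.
exact: (ler_pM (nn _ _) (nn _ _) (u_bound _ pi) (x_bound_all _)).
Qed.

(** Two ways of losing a power of Y: if (c,d) = (0,1) or (0,-1), then (lambda,mu) is nonzero and the
    large factor Y^(k+4) is absent; otherwise [u_bound_strict] supplies Y^-1. *)
Lemma ker_bound_strict i : i != i1 -> i != i2 ->
  normC (ker N k i p0) <= Y ^+ (k + 3) * Q * weight4 i.
Proof.
case: i => u x ni1 ni2.
have [pu|npi] := boolP (primitive u); last first.
  rewrite /ker (negbTE npi) normC0 mulr_ge0 ?(ltW (weight4_gt0 _)) //.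
  by rewrite mulr_ge0 ?Q_ge0 // exprn_ge0 // ltW.
rewrite normC_ker //=.
have nn j (w : R[i]) : 0 <= (normC w ^+ j)^-1 by rewrite invr_ge0 exprn_ge0 // normC_ge0.
have [ue|ue] := boolP ((u == unitv1) || (u == - unitv1)).
  have x0 : x != 0.
    apply: contraTneq ue => x0; move: ni1 ni2; rewrite x0 /i1 /i2 !xpair_eqE eqxx !andbT => h1 h2.
    by rewrite negb_or h1.
  have Y1 : 1 <= Y ^+ (k + 3) by rewrite exprn_ege1 // (le_trans _ Y_ge2) // ler1n.
  apply: le_trans (ler_pM (nn _ _) (nn _ _) (u_bound u pu) (x_bound x x0)) _.
  have -> : Y ^+ (k + 3) * Q * weight4 (u, x) = Y ^+ (k + 3) * (4 ^+ (N + 4) * ((1 + norm1 u) ^+ 4)^-1 *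
    (8 ^+ (k + 4) * ((1 + norm1 x) ^+ 4)^-1)) by rewrite QE /weight4 /=; ring.
  rewrite ler_peMl //; apply: mulr_ge0; apply: mulr_ge0.
  - exact: exprn_ge0.
  - by rewrite invr_ge0 exprn_ge0 // addr_ge0 // norm1_ge0.
  - exact: exprn_ge0.
  - by rewrite invr_ge0 exprn_ge0 // addr_ge0 // norm1_ge0.
move: ue; rewrite negb_or => /andP[ue1 ue2].
apply: le_trans (ler_pM (nn _ _) (nn _ _) (u_bound_strict u pu ue1 ue2) (x_bound_all x)) _.
have -> : Y ^+ (k + 4) = Y * Y ^+ (k + 3) by rewrite -exprS addnS.
rewrite le_eqVlt; apply/orP; left; apply/eqP; rewrite QE /weight4 /=.
move: ((1 + norm1 u) ^+ 4)^-1 ((1 + norm1 x) ^+ 4)^-1 (4 ^+ (N + 4)) (8 ^+ (k + 4)) (Y ^+ (k + 3)).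
by move=> U X a b y; field; rewrite (gt_eqF Y0).
Qed.

(* At (iY, 1/Y) the cosets of the identity and of -1 contribute 2 Y^(k+4), and all
   the others together at most 256 Q Y^(k+3). *)
Lemma kernel_sum_neq0_aux : exists p : C2 R, [/\ HxC p, (forall x, p.2 + lin x p.1 != 0) &
  sumC (fun i => ker N k i p) != 0].
Proof.
exists p0; split=> // [x|].
  have [->|x0] := eqVneq x 0.
    rewrite /lin !mxE /= mul0r !addr0 /z; apply/eqP => /(congr1 (@normC R)).
    by rewrite normC0 normC_real => /eqP; rewrite normr_eq0 invr_eq0 gt_eqF.
  rewrite -normC_gt0 -(pmulr_rgt0 _ (ltr0n R 8)).
  apply: lt_le_trans (shift_tau_norm1 x x0).
  by rewrite ltr_wpDr // norm1_ge0.
have c0 : 0 <= Y ^+ (k + 4) * Q by rewrite mulr_ge0 ?Q_ge0 // exprn_ge0 // ltW.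
have c3 : 0 <= Y ^+ (k + 3) * Q by rewrite mulr_ge0 ?Q_ge0 // exprn_ge0 // ltW.
have S : has_sum (fun i => ker N k i p0) (sumC (fun i => ker N k i p0)).
  apply: (sumCP _ _ (Y ^+ (k + 4) * Q * (16 * 16))).
  by apply: bsum_le (bsumZ _ _ _ _ c0 bsum_weight4) => i; exact: ker_bound.
have e12 : i1 != i2 by apply/eqP => -[/(congr1 (fun u : 'rV_2 => u 0 1))]; rewrite !mxE.
have := has_sum_tail _ _ _ [:: i1; i2] (Y ^+ (k + 3) * Q * (16 * 16)) _ _ S.
rewrite /= inE e12 => /(_ isT) H.
have {H} : normC (sumC (fun i => ker N k i p0) - \sum_(i <- [:: i1; i2]) ker N k i p0) <= Y ^+ (k + 3) * Q * (16 * 16).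
  apply: H; apply: bsum_le (bsumZ _ _ _ _ c3 bsum_weight4) => i.
  case: ifP => [_|/negbT]; first by rewrite mulr_ge0 // ltW // weight4_gt0.
  by rewrite !inE negb_or => /andP[h1 h2]; exact: ker_bound_strict.
move=> H; apply/eqP => s0; move: H; rewrite s0 sub0r normCN big_cons big_seq1.
have l1 : lin unitv1 tau = 1 by rewrite /lin !mxE /= mul0r add0r.
have l2 : lin (- unitv1) tau = - 1 by rewrite /lin !mxE /= oppr0 mul0r add0r rmorphN.
have l0 : z + lin 0 tau = z by rewrite /lin !mxE mul0r !addr0.
have k1 : ker N k i1 p0 = (z ^+ (k + 4))^-1.
  by rewrite /ker /= primitive_unitv1 l1 l0 expr1n invr1 mul1r.
have k2 : ker N k i2 p0 = (z ^+ (k + 4))^-1.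
  (* Evenness of [N] makes (-1)^(N+4) = 1, so the cosets of 1 and -1 reinforce each other. *)
  rewrite /ker /= primitive_Nunitv1 l2 l0 -signr_odd oddD (negbTE Neven) /= expr0 invr1 mul1r //.
rewrite k1 k2.
have -> : (z ^+ (k + 4))^-1 = (Y ^+ (k + 4))%:C.
  by rewrite /z -exprVn -fmorphV invrK rmorphXn.
rewrite -rmorphD normC_real -mulr2n normrMn gtr0_norm ?exprn_gt0 //.
have -> : Y ^+ (k + 4) = Y ^+ (k + 3) * Y by rewrite -exprSr addnS.
rewrite -mulrnAr -mulrA ler_pM2l ?exprn_gt0 //.
apply/negP; rewrite -ltNge mulr2n.
have := Q_ge0; move: YE; move: (Q) (Y) => q y yE q0; lra.
Qed.

End Nonvanishing.

Lemma kernel_sum_neq0 (R : realType) (N k : nat) : (0 < N)%N -> ~~ odd N ->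
  exists p : C2 R, [/\ HxC p, (forall x, p.2 + lin x p.1 != 0) &
    sumC (fun i => ker N k i p) != 0].
Proof. by move=> N0 No; exact: (kernel_sum_neq0_aux _ _ N0 No _ _ erefl erefl). Qed.

(** * Topology of the exhausting regions *)

Section Region.
Context {R : realType}.
Implicit Types (T : R) (p q : C2 R).

Lemma region_open T : open (region T).
Proof.
rewrite openE => p hp; have [d d0 dP] := region_polydisc T p hp.
change (nbhs p (region T)); apply/(@nbhs_normP _ (C2 R) p); exists d%:C; first by rewrite /= ltcR.
move=> q /=; rewrite -normrN opprB normr_maxC ltcR /maxC gt_max => /andP[h1 h2].
by rewrite (surjective_pairing q); exact: dP.
Qed.

Lemma region_convex T p q (t : R) : 0 <= t <= 1 -> region T p -> region T q ->
  region T (p.1 + t%:C * (q.1 - p.1), p.2 + t%:C * (q.2 - p.2)).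
Proof.
move=> t01 [p1 p2 p3] [q1 q2 q3]; split => /=.
- have := disc_convex 0 p.1 q.1 T t t01; rewrite !subr0; exact.
- have := disc_convex 0 p.2 q.2 T t t01; rewrite !subr0; exact.
rewrite ImD ImM /= mul0r addr0 ImD ImN.
have [->|tn] := eqVneq t 0; first by rewrite mul0r addr0.
move: t01 => /andP[t0 t1]; have tp : 0 < t by rewrite lt0r tn.
have h1 : t * T^-1 < t * Im q.1 by rewrite ltr_pM2l.
have h2 : (1 - t) * T^-1 <= (1 - t) * Im p.1 by rewrite ler_wpM2l ?subr_ge0 // ltW.
move: (T^-1) h1 h2 => w h1 h2; lra.
Qed.

(** A union of segments issuing from one point. *)
Lemma region_connected T : connected (region T).
Proof.
have [->|/set0P[p0 hp0]] := eqVneq (region T) set0; first exact: connected0.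
pose seg q (t : R) : C2 R := (p0.1 + t%:C * (q.1 - p0.1), p0.2 + t%:C * (q.2 - p0.2)).
have -> : region T = \bigcup_(q in region T) (seg q @` `[0, 1]).
  apply/seteqP; split => [q hq|_ [q hq [t /= tP <-]]].
    exists q => //; exists 1; first by rewrite /= in_itv /= ler01 lexx.
    by rewrite /seg !mul1r ![_ + (_ - _)]addrC !subrK -surjective_pairing.
  by apply: region_convex => //; rewrite in_itv /= in tP.
apply: bigcup_connected.
  exists p0 => q hq; exists 0; first by rewrite /= in_itv /= ler01 lexx.
  by rewrite /seg !mul0r !addr0 -surjective_pairing.
move=> q hq; apply: connected_continuous_connected; first exact: segment_connected.
apply: continuous_subspaceT => t.
apply/cvgrPdist_le => e' /gt0CE[-> e0]; set e := Re e' in e0 *.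
pose K := normC (q.1 - p0.1) + normC (q.2 - p0.2) + 1.
have K0 : 0 < K by rewrite ltr_wpDl // addr_ge0 // normC_ge0.
apply/(@nbhs_normP _ R t); exists (e / K); first by rewrite /= divr_gt0.
move=> s /=; rewrite ltr_pdivlMr // => hs.
have -> : seg q t - seg q s = ((t - s)%:C * (q.1 - p0.1), (t - s)%:C * (q.2 - p0.2)).
  by rewrite rmorphB; apply: injective_projections; rewrite /= ; ring.
rewrite normr_maxC lecR /maxC /= !normCM !normC_real ge_max.
have n1 := normC_ge0 (q.1 - p0.1); have n2 := normC_ge0 (q.2 - p0.2).
apply/andP; split; apply: le_trans (ltW hs); rewrite ler_wpM2l // /K; lra.
Qed.

(** Two points at once: an arbitrary point is put into one region with the point where E is known to
    be nonzero, so that the denominator is not identically zero there. *)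
Lemma region_exists p q : HxC p -> HxC q -> exists2 T, 0 < T & region T p /\ region T q.
Proof.
move=> hp hq; have vp : 0 < Im p.1 by []. have vq : 0 < Im q.1 by [].
have a1 := normC_ge0 p.1; have a2 := normC_ge0 p.2.
have b1 := normC_ge0 q.1; have b2 := normC_ge0 q.2.
have ip : 0 < (Im p.1)^-1 by rewrite invr_gt0.
have iq : 0 < (Im q.1)^-1 by rewrite invr_gt0.
pose T := normC p.1 + normC p.2 + normC q.1 + normC q.2 + (Im p.1)^-1 + (Im q.1)^-1.
have T0 : 0 < T by rewrite /T; lra.
exists T => //; split; split; rewrite ?[_^-1 < _]lt_inv ?posrE //; try by rewrite /T; lra.
  by rewrite -[ltRHS]invrK ltf_pV2 ?posrE // /T; lra.
by rewrite -[ltRHS]invrK ltf_pV2 ?posrE // /T; lra.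
Qed.

End Region.

(** * Series off and on the polar set *)

Section Coefficients.
Context {R : realType}.
Implicit Types (T : R) (p q : C2 R).
Variables (N k : nat) (a : coset_index -> C2 R -> R[i]^o).
Hypothesis adiff : forall i p, HxC p -> differentiable (a i) p.
Hypothesis abnd : forall T : R, 0 < T -> exists2 G : R, 0 <= G & forall i p, region T p ->
  normC (a i p) <= G * ((1 + norm1 i.1) ^+ N * (1 + norm1 i.2) ^+ k).

Definition nonpolar p : Prop := forall x, p.2 + lin x p.1 != 0.

Lemma clear_neq0 T p : nonpolar p -> clear k T p != 0.
Proof.
move=> np; rewrite /clear /cofactor0; elim: (poles T) => [|x W ih].
  by rewrite big_nil oner_neq0.
by rewrite big_cons mulf_neq0 // expf_neq0.
Qed.

(** A polar line through the region belongs to a listed x. Hence a nonzero cleared denominator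
    certifies that the point is not polar. *)
Lemma clear_polar T p : 0 < T -> region T p -> ~ nonpolar p -> clear k T p = 0.
Proof.
move=> T0 hp; have [c0|c0 np] := eqVneq (clear k T p) 0; first by [].
case: np => x; apply/eqP => px; move/eqP: c0; apply.
have [xW|xW] := boolP (x \in poles T).
  by rewrite /clear /cofactor0 (big_rem x) //= px expr0n addnS mul0r.
have := far_from_pole T T0 x p hp xW; rewrite px normC0 mulr0.
by rewrite leNgt ltr_wpDr // norm1_ge0.
Qed.

Definition coef_sum p : R[i] := sumC (fun i => a i p * ker N k i p).

Lemma has_sum_coef p : HxC p -> nonpolar p ->
  has_sum (fun i => a i p * ker N k i p) (coef_sum p).
Proof.
move=> hp np; have [T T0 [hT _]] := region_exists _ _ hp hp.
have c0 := clear_neq0 T _ np.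
have h := has_sumZ _ (clear k T p)^-1 _ _ (has_sum_term N k a abnd T T0 p hT).
suff e : has_sum (fun i => a i p * ker N k i p) ((clear k T p)^-1 * sumC (fun i => term N k a T i p)).
  by rewrite /coef_sum (sumCE _ _ _ e).
by move: h; congr has_sum; apply/funext => i; rewrite /term mulKf.
Qed.

Lemma sumC_term T p : 0 < T -> region T p -> nonpolar p ->
  sumC (fun i => term N k a T i p) = clear k T p * coef_sum p.
Proof.
move=> T0 hp np; apply: sumCE; apply: has_sumZ; apply: has_sum_coef => //.
exact: region_HxC hp.
Qed.

Lemma sumC_term_polar T p : 0 < T -> region T p -> ~ nonpolar p ->
  sumC (fun i => term N k a T i p) = 0.
Proof.
move=> T0 hp np; apply: sumCE => e e0; exists [::] => s _ _.
rewrite big1 ?subr0 ?normC0 ?ltW // => i _.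
by rewrite /term clear_polar // mul0r.
Qed.

End Coefficients.

(** * Right translation of cosets and of the kernel *)

Section Action.
Context {R : realType}.
Implicit Types (g : jacobi) (p : C2 R) (i : coset_index).

Definition shift_index g i : coset_index := (i.1 *m val g.1, i.2 *m val g.1 + g.2).
Definition unshift_index g i : coset_index :=
  (i.1 *m val (SL2Z_inv g.1), (i.2 - g.2) *m val (SL2Z_inv g.1)).

Lemma shift_indexK g : cancel (shift_index g) (unshift_index g).
Proof.
have e : val g.1 *m val (SL2Z_inv g.1) = 1%:M by have := congr1 val (SL2Z_mulV g.1).
by move=> [u x]; rewrite /unshift_index /shift_index /= addrK -!mulmxA e !mulmx1.
Qed.

Lemma unshift_indexK g : cancel (unshift_index g) (shift_index g).
Proof.
have e : val (SL2Z_inv g.1) *m val g.1 = 1%:M by have := congr1 val (SL2Z_mulVl g.1).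
by move=> [u x]; rewrite /unshift_index /shift_index /= -!mulmxA e !mulmx1 subrK.
Qed.

Lemma primitive_mul u (M : SL2Z) : primitive (u *m val M) = primitive u.
Proof.
have imp v (L : SL2Z) : primitive v -> primitive (v *m val L).
  by move=> /asboolP[K <-]; apply/asboolP; exists (SL2Z_mul K L); exact: bot_mul.
apply/idP/idP => [h|]; last exact: imp.
have := imp _ (SL2Z_inv M) h; rewrite -mulmxA.
have -> : val M *m val (SL2Z_inv M) = 1%:M by have := congr1 val (SL2Z_mulV M).
by rewrite mulmx1.
Qed.

Lemma lin_shift_act x g p : HxC p ->
  (jacobi_act g p).2 + lin x (jacobi_act g p).1 =
  (p.2 + lin (x *m val g.1 + g.2) p.1) / lin (bot g.1) p.1.
Proof.
move=> hp; rewrite act_snd lin_act // linD -mulrDl; congr (_ / _); ring.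
Qed.

Lemma ker_act N k i g p : HxC p -> ker N k i (jacobi_act g p) =
  lin (bot g.1) p.1 ^+ (N + 4 + (k + 4)) * ker N k (shift_index g i) p.
Proof.
move=> hp; rewrite /ker /= primitive_mul; case: ifP => _; last by rewrite mulr0.
have inv_div (b d : R[i]) n : ((b / d) ^+ n)^-1 = d ^+ n * (b ^+ n)^-1.
  by rewrite expr_div_n invf_div.
rewrite lin_shift_act // lin_act // (inv_div _ _ (N + 4)%N) (inv_div _ _ (k + 4)%N).
rewrite [_ ^+ (N + 4 + (k + 4))]exprD mulrACA //.
Qed.

Lemma nonpolar_act g p : HxC p -> nonpolar p -> nonpolar (jacobi_act g p).
Proof.
move=> hp np x; rewrite lin_shift_act // mulf_neq0 ?invr_eq0 ?np //.
by rewrite lin_neq0 // bot_neq0.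
Qed.

End Action.

(** * The coboundary *)

Section Coboundary.
Context {R : realType}.
Variables (r m : R) (omega : jacobi -> R[i]).
Hypothesis homega : multiplier_system r m omega.
Variable phi : jacobi -> C2 R -> R[i]^o.
Hypothesis hphi : cocycle omega r m phi.
Hypothesis hS : forall p : C2 R, HxC p -> phi (SL2Z_S, row2 0 0) p = 0.
Implicit Types (u x : 'rV[int]_2) (g : jacobi) (p q : C2 R) (i : coset_index).

(* Junk value SL2Z_I if u is not primitive. *)
Definition rep u : SL2Z := xget SL2Z_I [set M | bot M = u].

Lemma repP u : primitive u -> bot (rep u) = u.
Proof. by move=> /asboolP[M Mu]; rewrite /rep; case: xgetP => [//|/(_ M)]. Qed.

Definition coef i p : R[i]^o := if primitive i.1 then phi (rep i.1, i.2) p else 0.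

(** This is phi_gamma|g = phi_(gamma g) - phi_g. The chosen representative of the coset of gamma g
    need not be that of gamma times g; the two differ by a power of S on the left, which phi does
    not see. *)
Lemma coef_act i g p : HxC p -> primitive i.1 ->
  slash omega r m (coef i) g p = coef (shift_index g i) p - phi g p.
Proof.
move=> hp pu; rewrite /slash /coef pu primitive_mul pu.
have [l lE] : exists l, SL2Z_mul (rep i.1) g.1 = SL2Z_mul (SL2Z_upper l) (rep (i.1 *m val g.1)).
  by apply: bot_eq; rewrite bot_mul !repP // primitive_mul.
have := hphi.2 (rep i.1, i.2) g p hp.
have -> : jacobi_mul (rep i.1, i.2) g =
    jacobi_mul (jM (SL2Z_upper l)) (rep (i.1 *m val g.1), i.2 *m val g.1 + g.2).
  by rewrite /jacobi_mul /jM /= lE mul0mx add0r.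
rewrite (phi_upper_mul r m omega homega phi hphi hS) // /slash => ->.
by rewrite addrK.
Qed.

Lemma coef_differentiable i p : HxC p -> differentiable (coef i) p.
Proof.
move=> hp; have -> : coef i = if primitive i.1 then phi (rep i.1, i.2) else cst 0.
  by apply/funext => q; rewrite /coef; case: ifP.
case: ifP => _; last exact: (differentiable_cst (0 : R[i]^o) p).
exact: (hphi.1 _).1.
Qed.

Lemma weight_lower T : 0 < T -> exists2 c : R, 0 < c & forall p, region T p -> c <= weight r m p.
Proof.
move=> T0; exists (expR (- (`|r / 2| * ln T) - `|2 * pi * m| * (T ^+ 2 * T))); first exact: expR_gt0.
move=> p hp; have v0 : 0 < Im p.1 := region_HxC T T0 p hp; case: hp => [h1 h2 h3].
rewrite /weight ler_expR; apply: lerB.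
  have lnT : `|ln (Im p.1)| <= ln T.
    rewrite ler_norml; apply/andP; split.
      by rewrite -lnV ?posrE // ler_ln ?posrE ?invr_gt0 // ltW.
    rewrite ler_ln ?posrE //; apply: le_trans (ltW h1).
    exact: le_trans (ler_norm _) (normC_Im _).
  rewrite lerNl; apply: le_trans (ler_norm _) _; rewrite normrN normrM.
  by apply: ler_wpM2l.
apply: le_trans (ler_norm _) _; rewrite normrM; apply: ler_wpM2l => //.
rewrite ger0_norm; last by rewrite mulr_ge0 ?sqr_ge0 // invr_ge0 ltW.
apply: ler_pM; rewrite ?sqr_ge0 // ?invr_ge0; first exact: ltW.
  rewrite -(real_normK (num_real (Im p.2))); apply: lerXn2r; rewrite ?nnegrE ?normr_ge0 ?(ltW T0) //.
  exact: le_trans (normC_Im _) (ltW h2).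
by rewrite -[leRHS]invrK lef_pV2 ?posrE ?invr_gt0 // ltW.
Qed.

Lemma height_upper T p : 0 < T -> region T p -> height p.1 <= (T ^+ 2 + 1) * T.
Proof.
move=> T0 hp; have v0 : 0 < Im p.1 := region_HxC T T0 p hp; case: hp => [h1 h2 h3].
rewrite /height; apply: ler_pM.
- by rewrite addr_ge0 // sqr_ge0.
- by rewrite invr_ge0 ltW.
- by rewrite lerD2r; apply: lerXn2r; rewrite ?nnegrE ?normC_ge0 ?(ltW T0) // ltW.
- by rewrite -[leRHS]invrK lef_pV2 ?posrE ?invr_gt0 // ltW.
Qed.

(** On a region [height] is bounded above and [weight] below. The exponent 2A + 1 of
    [cocycle_growth] is raised to 2A + 2 to make it even. *)
Lemma coef_bounded : exists A : nat, forall T : R, 0 < T -> exists2 G : R, 0 <= G &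
  forall i p, region T p ->
    normC (coef i p) <= G * ((1 + norm1 i.1) ^+ (2 * A + 2) * (1 + norm1 i.2) ^+ 1).
Proof.
have [C [A [C0 CP]]] := cocycle_growth r m omega homega phi hphi hS.
exists A => T T0; have [c c0 cP] := weight_lower T T0.
have T20 : 0 <= (T ^+ 2 + 1) * T by rewrite mulr_ge0 ?(ltW T0) // addr_ge0 // sqr_ge0.
exists (C * ((T ^+ 2 + 1) * T) ^+ A / c).
  by rewrite mulr_ge0 // ?invr_ge0 ?(ltW c0) // mulr_ge0 // exprn_ge0.
move=> i p hp; have u0 := norm1_ge0 i.1 : 0 <= norm1 i.1 :> R.
have x0 := norm1_ge0 i.2 : 0 <= norm1 i.2 :> R.
have s1 : 1 <= 1 + norm1 i.1 :> R by rewrite lerDl.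
have s0 : 0 <= 1 + norm1 i.1 :> R := le_trans ler01 s1.
have y0 : 0 <= 1 + norm1 i.2 :> R by rewrite addr_ge0.
rewrite /coef; case: ifP => [pu|_]; last first.
  rewrite normC0; apply: mulr_ge0; last by rewrite mulr_ge0 // exprn_ge0.
  by rewrite mulr_ge0 // ?invr_ge0 ?(ltW c0) // mulr_ge0 // exprn_ge0.
have hp' : HxC p := region_HxC T T0 p hp.
have := CP (rep i.1, i.2) p hp'; rewrite /weighted_norm /= repP // => h.
have n0 := normC_ge0 (phi (rep i.1, i.2) p).
have h2 : normC (phi (rep i.1, i.2) p) * c <= normC (phi (rep i.1, i.2) p) * weight r m p.
  by rewrite ler_wpM2l // cP.
have [b1 _ _ _] := height_ge p.1 hp'.
have b0 : 0 <= height p.1 := le_trans ler01 b1.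
have h3 : height p.1 ^+ A <= ((T ^+ 2 + 1) * T) ^+ A.
  by apply: lerXn2r; rewrite ?nnegrE // height_upper.
rewrite -(ler_pM2r c0); apply: le_trans h2 _; apply: le_trans h _.
have -> : C * ((T ^+ 2 + 1) * T) ^+ A / c *
   ((1 + norm1 i.1) ^+ (2 * A + 2) * (1 + norm1 i.2) ^+ 1) * c =
   C * (1 + norm1 i.1) ^+ (2 * A + 2) * (1 + norm1 i.2) * ((T ^+ 2 + 1) * T) ^+ A.
  rewrite expr1; move: (_ ^+ A) (_ ^+ (2 * A + 2)) => a b; field; exact: lt0r_neq0.
apply: ler_pM => //.
- by rewrite !mulr_ge0 // exprn_ge0.
- exact: exprn_ge0.
apply: ler_wpM2r => //; apply: ler_wpM2l => //.
by rewrite ler_weXn2l // leq_add2l.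
Qed.

Section Quotient.
Variable N : nat.
Hypothesis N0 : (0 < N)%N.
Hypothesis Neven : ~~ odd N.
Hypothesis coefN : forall T : R, 0 < T -> exists2 G : R, 0 <= G &
  forall i p, region T p ->
    normC (coef i p) <= G * ((1 + norm1 i.1) ^+ N * (1 + norm1 i.2) ^+ 1).

(** Makes E an instance of the series with coefficients [a]. *)
Definition one_coef i : C2 R -> R[i]^o := cst 1.

Lemma one_coef_bound (T : R) : 0 < T -> exists2 G : R, 0 <= G & forall i p, region T p ->
  normC (one_coef i p) <= G * ((1 + norm1 i.1) ^+ N * (1 + norm1 i.2) ^+ 1).
Proof.
move=> _; exists 1 => // i p _; rewrite /one_coef /cst normC1 mul1r.
by apply: mulr_ege1; rewrite exprn_ege1 // lerDl norm1_ge0.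
Qed.

Lemma one_coef_differentiable i p : HxC p -> differentiable (one_coef i) p.
Proof. move=> _; exact: (differentiable_cst (1 : R[i]^o) p). Qed.

Definition denominator p : R[i] := coef_sum N 1 one_coef p.
Definition numerator p : R[i] := coef_sum N 1 coef p.

Lemma has_sum_denominator p : HxC p -> nonpolar p ->
  has_sum (fun i => ker N 1 i p) (denominator p).
Proof.
move=> hp np; have := has_sum_coef N 1 one_coef one_coef_bound p hp np.
by congr has_sum; apply/funext => i; rewrite mul1r.
Qed.

Lemma has_sum_numerator p : HxC p -> nonpolar p ->
  has_sum (fun i => coef i p * ker N 1 i p) (numerator p).
Proof. exact: (has_sum_coef N 1 coef coefN). Qed.

Definition factor g p : R[i] := lin (bot g.1) p.1 ^+ (N + 4 + (1 + 4)).

Lemma factor_neq0 g p : HxC p -> factor g p != 0.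
Proof. by move=> hp; rewrite expf_neq0 // lin_neq0 // bot_neq0. Qed.

Lemma denominator_act g p : HxC p -> nonpolar p ->
  denominator (jacobi_act g p) = factor g p * denominator p.
Proof.
move=> hp np; apply: has_sum_unique (has_sum_denominator _ (HxC_act g p hp) (nonpolar_act g p hp np)) _.
have := has_sumZ _ (factor g p) _ _ (has_sum_reindex _ _ _ _ _ (shift_indexK g) (unshift_indexK g) (has_sum_denominator p hp np)).
by congr has_sum; apply/funext => i; rewrite ker_act.
Qed.

(** Termwise [coef_act], then reindexing; the term -phi_g does not depend on the coset and so
    multiplies E. Only H is slashed, whereas E is composed with g, so E needs no weight or
    multiplier of its own. *)
Lemma numerator_act g p : HxC p -> nonpolar p ->
  slash omega r m numerator g p = factor g p * (numerator p - phi g p * denominator p).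
Proof.
move=> hp np; rewrite /slash.
have h1 := has_sumZ _ (omega g * automorphy r m g p) _ _
  (has_sum_numerator _ (HxC_act g p hp) (nonpolar_act g p hp np)).
apply: has_sum_unique h1 _.
have h2 := has_sumB _ _ _ _ _ (has_sum_numerator p hp np)
  (has_sumZ _ (phi g p) _ _ (has_sum_denominator p hp np)).
have := has_sumZ _ (factor g p) _ _ (has_sum_reindex _ _ _ _ _ (shift_indexK g) (unshift_indexK g) h2).
congr has_sum; apply/funext => i; rewrite ker_act // -/(factor g p).
have [pu|npu] := boolP (primitive i.1); last by rewrite /ker primitive_mul (negbTE npu) !mulr0 subrr mulr0.
have := coef_act i g p hp pu; rewrite /slash => e.
have -> : omega g * automorphy r m g p * (coef i (jacobi_act g p) * (factor g p * ker N 1 (shift_index g i) p)) =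
  (omega g * automorphy r m g p * coef i (jacobi_act g p)) * (factor g p * ker N 1 (shift_index g i) p) by ring.
rewrite e; ring.
Qed.

Definition good p : Prop := [/\ HxC p, nonpolar p & denominator p != 0].

Lemma good_act g p : good p -> good (jacobi_act g p).
Proof.
move=> [hp np d0]; split; [exact: HxC_act|exact: nonpolar_act|].
by rewrite denominator_act // mulf_neq0 // factor_neq0.
Qed.

Definition quotient p : R[i]^o := - (numerator p / denominator p).

Lemma quotient_act g p : good p ->
  slash omega r m quotient g p - quotient p = phi g p.
Proof.
move=> [hp np d0]; rewrite /slash /quotient denominator_act //.
have := numerator_act g p hp np; rewrite /slash => e.
have f0 := factor_neq0 g p hp.
have -> : omega g * automorphy r m g p * - (numerator (jacobi_act g p) / (factor g p * denominator p)) =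
  - (omega g * automorphy r m g p * numerator (jacobi_act g p)) / (factor g p * denominator p).
  by rewrite mulrN mulrA mulNr.
by rewrite e; field; rewrite d0 f0.
Qed.

Definition near_limit p (L : R[i]) : Prop := forall e : R, 0 < e -> exists2 d : R, 0 < d &
  forall q, good q -> maxC (q - p) < d -> normC (quotient q - L) <= e.

Definition adherent p : Prop := forall d : R, 0 < d -> exists2 q, good q & maxC (q - p) < d.

(* Values at the points where E vanishes or has a pole, chosen so that the function
   is differentiable at none of them: at a limit of good points the value differs
   from the limit of -H/E, if any; near any other point the function equals Re tau.
   This dispenses with the identity theorem, by which the second
   case does not occur. *)
Definition junk p : R[i] :=
  if `[< adherent p >] then xget 0 [set L | near_limit p L] + 1 else (Re p.1)%:C.

Definition solution p : R[i]^o := if `[< good p >] then quotient p else junk p.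

Lemma solution_good p : good p -> solution p = quotient p.
Proof. by move=> gp; rewrite /solution; case: asboolP. Qed.

Lemma near_limit_unique p L1 L2 : adherent p -> near_limit p L1 -> near_limit p L2 -> L1 = L2.
Proof.
move=> ap h1 h2; apply/eqP; rewrite -subr_eq0 -normC_eq0 eq_le normC_ge0 andbT.
apply/ler_addgt0Pr => e e0; rewrite add0r; have e20 : 0 < e / 2 by rewrite divr_gt0.
have [d1 d10 P1] := h1 _ e20; have [d2 d20 P2] := h2 _ e20.
have [|q gq] := ap (Num.min d1 d2); first by rewrite lt_min d10.
rewrite lt_min => /andP[/(P1 _ gq) q1 /(P2 _ gq) q2].
have -> : L1 - L2 = (quotient q - L2) - (quotient q - L1) by ring.
apply: le_trans (normCB _ _) _; lra.
Qed.

Lemma maxC_triangle p q s : maxC (p - s) <= maxC (p - q) + maxC (q - s).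
Proof. by rewrite -lecR rmorphD /= -!normr_maxC -(subrKA q p) ler_normD. Qed.

(** A derivative l would be within 1/4 of 1 along real increments and within 1/4 of 0 along
    imaginary ones. *)
Lemma re_not_differentiable (f : R[i]^o -> R[i]^o) (x : R[i]^o) (d : R) : 0 < d ->
  (forall h, normC h < d -> f (x + h) = (Re (x + h))%:C) -> ~ differentiable f x.
Proof.
move=> d0 fE /differentiable_cderiv[l fl].
have [d1 d10 P1] := fl 4^-1 ltac:(by rewrite invr_gt0).
pose t := Num.min d d1 / 2.
have t0 : 0 < t by rewrite divr_gt0 // lt_min d0.
have [td td1] : t < d /\ t < d1 by split; rewrite /t; case: (leP d d1) => h; lra.
have f0 : f x = (Re x)%:C by have := fE 0; rewrite normC0 !addr0; apply.
have nt : normC (t%:C : R[i]) = t by rewrite normC_real gtr0_norm.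
have nit : normC ('i * t%:C : R[i]) = t by rewrite normCM normCi mul1r.
have h1 := P1 t%:C; rewrite nt in h1; have {}h1 := h1 td1.
have h2 := P1 ('i * t%:C); rewrite nit in h2; have {}h2 := h2 td1.
rewrite fE ?nt // f0 ReD rmorphD /= [_ + t%:C]addrC addrK in h1.
rewrite fE ?nit // f0 ReD ReM /= !mul0r mulr0 subr0 addr0 subrr sub0r normCN normCM nit in h2.
rewrite -[X in X - _]mul1r -mulrBl normCM nt in h1.
rewrite !ler_pM2r // in h1 h2.
have : normC (1 : R[i]) <= normC (1 - l) + normC l by rewrite -{1}(subrK l 1) normCD.
rewrite normC1; lra.
Qed.

Lemma bad_not_differentiable p : ~ good p -> ~ differentiable solution p.
Proof.
move=> np dp; have [ap|nap] := pselect (adherent p).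
  (* Continuity would make the value at p the limit along good points, whereas [junk] is that limit
     plus 1. *)
  have lim : near_limit p (solution p).
    move=> e e0; have := differentiable_continuous dp.
    have e0' : 0 < e%:C by rewrite ltcR.
    move=> /cvgrPdist_le/(_ _ e0')/nbhs_normP[d /gt0CE[-> d0] dP].
    exists (Re d) => // q gq qd; have := dP q.
    rewrite /= -normrN opprB normr_maxC ltcR => /(_ qd).
    by rewrite -normrN opprB normr_normC lecR solution_good.
  have xl : near_limit p (xget 0 [set L | near_limit p L]).
    by case: xgetP => [//|/(_ (solution p))].
  have := near_limit_unique _ _ _ ap lim xl.
  rewrite {1}/solution; case: asboolP => // _; rewrite /junk; case: asboolP => // _.
  by move/eqP; rewrite -subr_eq0 addrC addKr oner_eq0.
have [d d0 dP] : exists2 d : R, 0 < d & forall q, good q -> d <= maxC (q - p).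
  apply: contrapT => H; apply: nap => d d0; apply: contrapT => H'; apply: H.
  exists d => // q gq; rewrite leNgt; apply/negP => qd; apply: H'; by exists q.
(* By the triangle inequality no point of this neighbourhood is a limit of good points, so [junk] is
   Re tau throughout. *)
have near q : maxC (q - p) < d -> solution q = (Re q.1)%:C.
  move=> qd; rewrite /solution; case: asboolP => [/dP|_]; first by rewrite leNgt qd.
  rewrite /junk; case: asboolP => // aq.
  have [|s gs sq] := aq (d - maxC (q - p)); first by rewrite subr_gt0.
  by exfalso; have := dP _ gs; have := maxC_triangle s q p; lra.
move: dp; rewrite (surjective_pairing p) => /differentiable_sectl.
apply: (re_not_differentiable _ _ d d0) => h hd.
rewrite near // /maxC /= addrC addKr subrr normC0 gt_max hd.
by rewrite (le_lt_trans (normC_ge0 h)).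
Qed.

Lemma solution_equation g p : HxC p -> holomorphic_at solution p ->
  holomorphic_at solution (jacobi_act g p) ->
  slash omega r m solution g p - solution p = phi g p.
Proof.
move=> hp /nbhs_singleton dp _.
(* Holomorphy at p forces p to be good, and goodness passes to the image point. *)
have gp : good p by apply: contrapT => np; exact: bad_not_differentiable np dp.
rewrite -quotient_act // /slash !solution_good //; exact: good_act.
Qed.

Lemma solution_meromorphic : meromorphic_on HxC solution.
Proof.
move=> p hp; have [q0 [hq0 np0 d0]] := kernel_sum_neq0 R N 1 N0 Neven.
have [T T0 [hTp hTq]] := region_exists _ _ hp hq0.
exists (region T); split => //.
- exact: region_open.
- exact: region_connected.
- exact: region_HxC.
(* Both series carry the same factor [clear], which makes them holomorphic on the region and drops
   out of the quotient. *)
exists (fun q => - sumC (fun i => term N 1 coef T i q)), (fun q => sumC (fun i => term N 1 one_coef T i q)).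
split.
- move=> q hq; apply: differentiableN.
  exact: (differentiable_series N 1 coef coef_differentiable coefN T T0).
- move=> q hq.
  exact: (differentiable_series N 1 one_coef one_coef_differentiable one_coef_bound T T0).
- exists q0 => //.
  rewrite (sumC_term N 1 one_coef one_coef_bound) //.
  rewrite mulf_neq0 ?clear_neq0 //.
  rewrite (_ : coef_sum _ _ _ _ = sumC (fun i => ker N 1 i q0)) //.
  by rewrite /coef_sum; congr sumC; apply/funext => i; rewrite mul1r.
move=> q hq h0; have hHq := region_HxC T T0 q hq.
have nq : nonpolar q.
  by apply: contrapT => nq; move: h0; rewrite sumC_term_polar // eqxx.
move: h0; rewrite (sumC_term N 1 one_coef one_coef_bound) // (sumC_term N 1 coef coefN) //.
rewrite mulf_eq0 negb_or => /andP[c0 e0].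
rewrite solution_good // /quotient /numerator /denominator.
by field; rewrite c0 e0.
Qed.

End Quotient.
End Coboundary.

(* The identity f|gamma - f = phi_gamma of meromorphic functions is asserted at
   every point p such that f is holomorphic at both p and gamma p. *)
Theorem theorem5p3 (R : realType) (r m : R) (hm : 0 < m)
    (hm2 : 2 * m \is a Num.int)
    (omega : jacobi -> R[i]) (homega : multiplier_system r m omega)
    (phi : jacobi -> C2 R -> R[i]^o)
    (hphi : parabolic_cocycle omega r m phi)
    (hS : forall p : C2 R, HxC p -> phi (SL2Z_S, row2 0 0) p = 0)
    (hI : forall p : C2 R, HxC p -> phi (SL2Z_I, row2 0 1) p = 0) :
  exists f : C2 R -> R[i]^o,
    meromorphic_on HxC f /\
    forall (g : jacobi) (p : C2 R), HxC p ->
      holomorphic_at f p -> holomorphic_at f (jacobi_act g p) ->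
      slash omega r m f g p - f p = phi g p.
Proof.
have [A bnd] := coef_bounded r m omega homega phi hphi.1 hS.
exists (solution phi (2 * A + 2)); split.
  apply: (solution_meromorphic r m omega) => //; first exact: hphi.1.
    by rewrite addn2.
  by rewrite oddD mul2n odd_double.
by apply: solution_equation => //; exact: hphi.1.
Qed.
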